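(* Let $k\geqslant 3$ and consider the action of $G=\mathrm{U}(k)\times\mathrm{U}(n-k)\subset\mathrm{U}(n)\subset\mathrm{Sp}(n)$ on $\mathbb{H}\mathbb{P}^{n-1}$. Then the Lie algebra of a principal isotropy subgroup is isomorphic to $\mathfrak{u}(k-2)\oplus\mathfrak{u}(n-k-2)$, whence the cohomogeneity of the action is $4$ and the homogeneity rank of the action vanishes; however, the action is not quaternion-coisotropic.
   Context: For a smooth action of a compact Lie group $G$ on a smooth manifold $M$, let $c(G,M)$ be the cohomogeneity (the codimension of the principal orbits), let $G_{\mathrm{princ}}$ be a principal isotropy subgroup, and let $\mathrm{rk}$ denote the rank (dimension of a maximal torus). The homogeneity rank is $\mathrm{hrk}(G,M)=\mathrm{rk}\,G-\mathrm{rk}\,G_{\mathrm{princ}}-c(G,M)$. A quaternionic-Kähler structure on a Riemannian manifold $(M,g)$ with Levi-Civita connection $\nabla$ is a $\nabla$-parallel rank 3 subbundle $Q$ of $\mathrm{End}\,TM$ which is locally generated by a triple of locally defined anticommuting $g$-orthogonal almost complex structures $(J_1,J_2,J_3=J_1J_2)$. A submanifold $N$ of $M$ is quaternion-coisotropic if for every $p\in N$ and $J\in Q_p$ one has $J(T_pN)^\perp\subseteq T_pN$. An action of a compact Lie group of isometries on $M$ is quaternion-coisotropic if its principal orbits are quaternion-coisotropic submanifolds of $M$. $\mathbb{H}\mathbb{P}^{n-1}=\mathrm{Sp}(n)/\mathrm{Sp}(1)\mathrm{Sp}(n-1)$ carries its standard quaternionic-Kähler structure, and $\mathrm{U}(n)\subset\mathrm{Sp}(n)$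 is the standard inclusion. *)

(* Defs.v *)
From HB Require Import structures.
From mathcomp Require Import all_boot all_order all_algebra.
From mathcomp Require Import spectral complex.
From mathcomp Require Import all_classical all_reals all_analysis.
From mathcomp Require Import ring.

Set Implicit Arguments.
Unset Strict Implicit.
Unset Printing Implicit Defensive.

Import Order.TTheory GRing.Theory Num.Theory.
Import numFieldNormedType.Exports.

Local Open Scope classical_set_scope.
Local Open Scope ring_scope.
Local Open Scope sesquilinear_scope.

(* [Quat a b c d] is a + b i + c j + d k. *)
Record quat (R : Type) : Type := Quat { q1 : R; qi : R; qj : R; qk : R }.

Section QuatRing.
Variable R : realType.
Local Notation H := (quat R).

Definition quat_tuple (x : H) : R * R * R * R := (q1 x, qi x, qj x, qk x).
Definition tuple_quat (t : R * R * R * R) : H :=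
  Quat t.1.1.1 t.1.1.2 t.1.2 t.2.

Lemma quat_tupleK : cancel quat_tuple tuple_quat.
Proof. by case. Qed.

HB.instance Definition _ := Choice.copy H (can_type quat_tupleK).

Definition addq (x y : H) : H :=
  Quat (q1 x + q1 y) (qi x + qi y) (qj x + qj y) (qk x + qk y).
Definition oppq (x : H) : H := Quat (- q1 x) (- qi x) (- qj x) (- qk x).
Definition mulq (x y : H) : H :=
  Quat (q1 x * q1 y - qi x * qi y - qj x * qj y - qk x * qk y)
       (q1 x * qi y + qi x * q1 y + qj x * qk y - qk x * qj y)
       (q1 x * qj y - qi x * qk y + qj x * q1 y + qk x * qi y)
       (q1 x * qk y + qi x * qj y - qj x * qi y + qk x * q1 y).

Lemma addqA : associative addq.
Proof. by move=> [? ? ? ?] [? ? ? ?] [? ? ? ?]; rewrite /addq /= !addrA. Qed.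
Lemma addqC : commutative addq.
Proof. by move=> [a b c d] [? ? ? ?]; congr Quat; rewrite /= addrC. Qed.
Lemma add0q : left_id (Quat 0 0 0 0) addq.
Proof. by move=> [? ? ? ?]; rewrite /addq /= !add0r. Qed.
Lemma addNq : left_inverse (Quat 0 0 0 0) oppq addq.
Proof. by move=> [? ? ? ?]; rewrite /addq /= !addNr. Qed.

HB.instance Definition _ := GRing.isZmodule.Build H addqA addqC add0q addNq.

Lemma mulqA : associative mulq.
Proof. by move=> [? ? ? ?] [? ? ? ?] [? ? ? ?]; congr Quat; rewrite /=; ring. Qed.
Lemma mul1q : left_id (Quat 1 0 0 0) mulq.
Proof. by move=> [? ? ? ?]; congr Quat; rewrite /=; ring. Qed.
Lemma mulq1 : right_id (Quat 1 0 0 0) mulq.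
Proof. by move=> [? ? ? ?]; congr Quat; rewrite /=; ring. Qed.
Lemma mulqDl : left_distributive mulq +%R.
Proof. by move=> [? ? ? ?] [? ? ? ?] [? ? ? ?]; congr Quat; rewrite /=; ring. Qed.
Lemma mulqDr : right_distributive mulq +%R.
Proof. by move=> [? ? ? ?] [? ? ? ?] [? ? ? ?]; congr Quat; rewrite /=; ring. Qed.
Lemma oneq_neq0 : Quat 1 0 0 0 != 0 :> H.
Proof. by apply/eqP => -[] /eqP; rewrite oner_eq0. Qed.

HB.instance Definition _ :=
  GRing.Zmodule_isNzRing.Build H mulqA mul1q mulq1 mulqDl mulqDr oneq_neq0.

Definition conjq (x : H) : H := Quat (q1 x) (- qi x) (- qj x) (- qk x).
Definition real_quat (r : R) : H := Quat r 0 0 0.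
Definition complex_quat (z : R[i]) : H := Quat (complex.Re z) (complex.Im z) 0 0.

End QuatRing.

Section Geometry.
Variable R : realType.
Local Notation H := (quat R).
Local Notation C := (R[i]).

Definition adjq n (X : 'M[H]_n) : 'M[H]_n := map_mx (@conjq R) X^T.

Definition scaleq n (c : R) (X : 'M[H]_n) : 'M[H]_n := real_quat c *: X.

Definition bracket (T : pzRingType) n (X Y : 'M[T]_n) : 'M[T]_n :=
  X *m Y - Y *m X.

Definition inner n (X Y : 'M[H]_n) : R := q1 (\tr (adjq X *m Y)).

Definition has_dim n (S : set 'M[H]_n) (d : nat) : Prop :=
  exists e : 'I_d -> 'M[H]_n,
    (forall c : 'I_d -> R,
       \sum_i scaleq (c i) (e i) = 0 -> forall i, c i = 0) /\
    S = [set \sum_i scaleq (c i) (e i) | c in [set: 'I_d -> R]].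

(* The default 0 is never used when S is a real linear subspace. *)
Definition dim n (S : set 'M[H]_n) : nat := xget 0%N [set d | has_dim S d].

Definition smooth (f : R -> R) : Prop :=
  forall (m : nat) (t : R), derivable (derive1n m f) t 1.

Definition smooth_curve n (g : R -> 'M[H]_n) : Prop :=
  forall i j, [/\ smooth (fun t => q1 (g t i j)),
                  smooth (fun t => qi (g t i j)),
                  smooth (fun t => qj (g t i j)) &
                  smooth (fun t => qk (g t i j))].

Definition velocity n (g : R -> 'M[H]_n) (t : R) : 'M[H]_n :=
  \matrix_(i, j) Quat (derive1 (fun t => q1 (g t i j)) t)
                      (derive1 (fun t => qi (g t i j)) t)
                      (derive1 (fun t => qj (g t i j)) t)
                      (derive1 (fun t => qk (g t i j)) t).

(* Meant for N an embedded submanifold, where this is the tangent space at p. *)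
Definition tangent n (N : set 'M[H]_n) (p : 'M[H]_n) : set 'M[H]_n :=
  [set v | exists g : R -> 'M[H]_n,
     [/\ smooth_curve g, forall t, N (g t), g 0 = p & velocity g 0 = v]].

(* For a closed subgroup K of Sp(n), with [bracket] as Lie bracket. *)
Definition lie n (K : set 'M[H]_n) : set 'M[H]_n := tangent K 1%:M.

(* T is a torus of dimension r: it is the isomorphic image of R^r / Z^r. *)
Definition is_torus n (r : nat) (T : set 'M[H]_n) : Prop :=
  exists phi : 'rV[R]_r -> 'M[H]_n,
    [/\ forall i j, [/\ continuous (fun x => q1 (phi x i j)),
                        continuous (fun x => qi (phi x i j)),
                        continuous (fun x => qj (phi x i j)) &
                        continuous (fun x => qk (phi x i j))],
        forall x y, phi (x + y) = phi x *m phi y,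
        forall x, phi x = 1%:M <-> (forall j, exists z : int, x 0 j = z%:~R) &
        T = range phi].

Definition is_maximal_torus n (K : set 'M[H]_n) (r : nat) (T : set 'M[H]_n) :=
  [/\ is_torus r T, T `<=` K &
      forall r' T', is_torus r' T' -> T' `<=` K -> T `<=` T' -> T' = T].

(* All maximal tori of a compact Lie group K have the same dimension. *)
Definition rk n (K : set 'M[H]_n) : nat :=
  xget 0%N [set r | exists T, is_maximal_torus K r T].

(* HP^(n-1) as the Sp(n)-conjugacy class of orthogonal projections of H^n onto
   right quaternionic lines.  The metric induced by [inner] is Sp(n)-invariant,
   hence a multiple of the standard one. *)
Definition HP n : set 'M[H]_n :=
  [set P | [/\ adjq P = P, P *m P = P & \tr P = 1]].

(* The isotropy algebra of Sp(n) at P is sp(1) + sp(n-1), where the ideal sp(1)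
   consists of the S below; Q_P is its image in the isotropy representation.
   For v tangent at P one has v = v P + P v, so that, identifying v with
   v P : im P -> (im P)^perp, the endomorphism is precomposition with S; it
   squares to -|S|^2. *)
Definition quatK n (P : 'M[H]_n) : set ('M[H]_n -> 'M[H]_n) :=
  [set (fun v => bracket v S) |
     S in [set S | [/\ adjq S = - S, P *m S = S & S *m P = S]]].

Definition normal n (N : set 'M[H]_n) (P : 'M[H]_n) : set 'M[H]_n :=
  [set v | tangent (@HP n) P v /\
           forall w, tangent N P w -> inner v w = 0].

Definition quaternion_coisotropic n (N : set 'M[H]_n) : Prop :=
  forall P, N P -> forall J, quatK P J ->
    [set J v | v in normal N P] `<=` tangent N P.

(* On projections this is the action of g in Sp(n) on lines, since
   g^-1 = adjq g. *)
Definition act n (g P : 'M[H]_n) : 'M[H]_n := g *m P *m adjq g.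

Definition orbit n (G : set 'M[H]_n) (P : 'M[H]_n) : set 'M[H]_n :=
  [set act g P | g in G].

Definition isotropy n (G : set 'M[H]_n) (P : 'M[H]_n) : set 'M[H]_n :=
  [set g | G g /\ act g P = P].

(* The isotropy group at P is subconjugate to all isotropy groups. *)
Definition principal n (G : set 'M[H]_n) (P : 'M[H]_n) : Prop :=
  @HP n P /\
  forall P', @HP n P' -> exists2 a, G a &
    forall g, isotropy G P g -> isotropy G P' (a *m g *m adjq a).

(* [cohomogeneity G P] and [hrk G P] are c(G, HP^(n-1)) and hrk(G, HP^(n-1))
   when P is principal; they do not depend on the choice of such a P. *)
Definition cohomogeneity n (G : set 'M[H]_n) (P : 'M[H]_n) : nat :=
  dim (tangent (@HP n) P) - dim (tangent (orbit G P) P).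

Definition hrk n (G : set 'M[H]_n) (P : 'M[H]_n) : int :=
  (rk G)%:Z - (rk (isotropy G P))%:Z - (cohomogeneity G P)%:Z.

Definition quaternion_coisotropic_action n (G : set 'M[H]_n) : Prop :=
  forall P, principal G P -> quaternion_coisotropic (orbit G P).

Definition Ugrp n : set 'M[H]_n :=
  [set map_mx (@complex_quat R) A | A in [set A : 'M[C]_n | A \is unitarymx]].

(* U(k) x U(n-k), embedded block-diagonally. *)
Definition UU n k : set 'M[H]_n :=
  [set g | @Ugrp n g /\
           forall i j : 'I_n, (i < k)%N != (j < k)%N -> g i j = 0].

Definition u m : set 'M[C]_m := [set X | X ^t* = - X].

Definition lie_isomorphic_uu n a b (L : set 'M[H]_n) : Prop :=
  exists f : 'M[H]_n -> 'M[C]_a * 'M[C]_b,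
    [/\ set_bij L (@u a `*` @u b) f,
        forall (c : R) X Y, L X -> L Y ->
          f (scaleq c X + Y) = ((c%:C)%C *: (f X).1 + (f Y).1,
                                (c%:C)%C *: (f X).2 + (f Y).2) &
        forall X Y, L X -> L Y ->
          f (bracket X Y) = (bracket (f X).1 (f Y).1,
                             bracket (f X).2 (f Y).2)].

End Geometry.

Arguments HP R n : clear implicits.
Arguments Ugrp R n : clear implicits.
Arguments UU R n k : clear implicits.
Arguments u R m : clear implicits.

(* Main.v *)
(** A line of H^n is spanned by a unit vector v, and v corresponds to a complex
    n x 2 matrix with blocks A_1 (k rows) and A_2 (n - k rows), on which U(k) and
    U(n-k) act from the left.  The invariants are the moments p_b = v^* i D_b v,
    imaginary quaternions that Sp(1) rotates (D_b is the projection to block b).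

    Householder reflections make v vanish outside two coordinates in each block.
    If A_1 and A_2 have rank 2 and p_1, p_2 do not commute, an element of G fixing
    the line maps v to v q with q commuting with p_1 and p_2, so q = +-1 and
    the element is +-1 times one of U(k-2) x U(n-k-2).  This group lies in a
    conjugate of every isotropy group, so such lines are principal.  Conversely,
    the isotropy group is larger if the rank drops (a reflection) or if p_1, p_2
    commute (rotations v -> v q with q in their common centralizer), so that all
    principal lines are of this form.

    The tangent space of such an orbit consists of the brackets [X, P] with X in
    the Lie algebra of G: the Gram matrix of (p_1, p_2) is constant along a curve
    in the orbit, hence the p_b vary by an infinitesimal rotation, and then X is
    found by linear algebra, as the A_b have left inverses.  Counting dimensions
    gives the cohomogeneity 4(n-1) - (4n-8) = 4, and the ranks are n and n - 4.

    Writing nu_b = v^* D_b v, the normal vectors y_0 = nu_2 D_1 v - nu_1 D_2 v and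
    y_1 = i D_1 v p_2 + i D_2 v p_1 - v (p_1 p_2 + p_2 p_1) have a product
    y_1^* y_0 whose imaginary part is a nonzero multiple of the commutator of p_1
    and p_2, so y_0 q is not orthogonal to y_1 for a suitable imaginary q. *)

From mathcomp Require Import all_boot all_order all_algebra.
From mathcomp Require Import all_classical all_reals all_analysis.
From HB Require Import structures.
From mathcomp Require Import spectral complex.
From mathcomp Require Import ring lra zify.
Require Import Defs.

Set Implicit Arguments.
Unset Strict Implicit.
Unset Printing Implicit Defensive.

Import Order.TTheory GRing.Theory Num.Theory.
Import numFieldNormedType.Exports.

Local Open Scope classical_set_scope.
Local Open Scope ring_scope.
Local Open Scope sesquilinear_scope.

(** * Quaternion matrices *)

Section QuatTheory.
Variable R : realType.
Local Notation H := (quat R).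
Local Notation C := (R[i]).
Implicit Types (x y z : H) (c : R).

(** [tangent] uses all smooth curves in a set, and a curve in an orbit need not come with a smooth
    lift to the group. So the upper bound for the tangent space of an orbit comes from functions of
    the projection [P] that are constant on orbits: the real traces of [D_b P] and of
    [i D_b P i D_c P]. The latter form, up to sign, the Gram matrix of the moments and do not depend
    on the choice of the unit vector [v], whereas the moments do. Since [-1] acts trivially,
    principal isotropy groups are not connected, and [IsoStd] carries a sign. Curves and tori in
    them are handled by squaring, which removes it. The definition of [principal] only gives
    subconjugacy. That every principal line is nondegenerate is obtained by comparison with one
    explicit line, that of [v0]; the obstacle is the conjugating element, which has to be shown to
    preserve the slice coordinates. *)

Lemma quat_eqP x y :
  [/\ q1 x = q1 y, qi x = qi y, qj x = qj y & qk x = qk y] -> x = y.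
Proof. by case: x y => [? ? ? ?] [? ? ? ?] /= [-> -> -> ->]. Qed.

Lemma q1D x y : q1 (x + y) = q1 x + q1 y. Proof. by []. Qed.
Lemma qiD x y : qi (x + y) = qi x + qi y. Proof. by []. Qed.
Lemma qjD x y : qj (x + y) = qj x + qj y. Proof. by []. Qed.
Lemma qkD x y : qk (x + y) = qk x + qk y. Proof. by []. Qed.
Lemma q1N x : q1 (- x) = - q1 x. Proof. by []. Qed.
Lemma qiN x : qi (- x) = - qi x. Proof. by []. Qed.
Lemma qjN x : qj (- x) = - qj x. Proof. by []. Qed.
Lemma qkN x : qk (- x) = - qk x. Proof. by []. Qed.

Lemma q1_zmod : zmod_morphism (@q1 R). Proof. by []. Qed.
Lemma qi_zmod : zmod_morphism (@qi R). Proof. by []. Qed.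
Lemma qj_zmod : zmod_morphism (@qj R). Proof. by []. Qed.
Lemma qk_zmod : zmod_morphism (@qk R). Proof. by []. Qed.
HB.instance Definition _ := GRing.isZmodMorphism.Build H R (@q1 R) q1_zmod.
HB.instance Definition _ := GRing.isZmodMorphism.Build H R (@qi R) qi_zmod.
HB.instance Definition _ := GRing.isZmodMorphism.Build H R (@qj R) qj_zmod.
HB.instance Definition _ := GRing.isZmodMorphism.Build H R (@qk R) qk_zmod.

Lemma q1M x y :
  q1 (x * y) = q1 x * q1 y - qi x * qi y - qj x * qj y - qk x * qk y.
Proof. by []. Qed.
Lemma qiM x y :
  qi (x * y) = q1 x * qi y + qi x * q1 y + qj x * qk y - qk x * qj y.
Proof. by []. Qed.
Lemma qjM x y :
  qj (x * y) = q1 x * qj y - qi x * qk y + qj x * q1 y + qk x * qi y.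
Proof. by []. Qed.
Lemma qkM x y :
  qk (x * y) = q1 x * qk y + qi x * qj y - qj x * qi y + qk x * q1 y.
Proof. by []. Qed.

Definition quatE := (q1M, qiM, qjM, qkM, q1D, qiD, qjD, qkD, q1N, qiN, qjN, qkN).

Lemma conjq_zmod : zmod_morphism (@conjq R).
Proof. by move=> x y; apply: quat_eqP; split; rewrite /= -?opprD ?opprB // opprK addrC. Qed.
HB.instance Definition _ := GRing.isZmodMorphism.Build H H (@conjq R) conjq_zmod.

Lemma conjqK : involutive (@conjq R).
Proof. by move=> [a b c d]; rewrite /conjq /= !opprK. Qed.

Lemma conjqM x y : conjq (x * y) = conjq y * conjq x.
Proof. by apply: quat_eqP; split; rewrite /=; ring. Qed.

Lemma conjq1 : conjq (1 : H) = 1.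
Proof. by apply: quat_eqP; split; rewrite //= oppr0. Qed.

Lemma real_quat_zmod : zmod_morphism (@real_quat R).
Proof. by move=> a b; apply: quat_eqP; split; rewrite //= subr0. Qed.
HB.instance Definition _ :=
  GRing.isZmodMorphism.Build R H (@real_quat R) real_quat_zmod.

Lemma real_quat_monoid : monoid_morphism (@real_quat R).
Proof. by split=> // a b; apply: quat_eqP; split; rewrite /=; ring. Qed.
HB.instance Definition _ :=
  GRing.isMonoidMorphism.Build R H (@real_quat R) real_quat_monoid.

Lemma real_quatC c x : real_quat c * x = x * real_quat c.
Proof. by apply: quat_eqP; split; rewrite /=; ring. Qed.

Lemma conj_real_quat c : conjq (real_quat c) = real_quat c.
Proof. by rewrite /conjq /real_quat /= oppr0. Qed.

Lemma complex_quat_zmod : zmod_morphism (@complex_quat R).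
Proof.
by move=> [a b] [c d]; apply: quat_eqP; split; rewrite //= subr0.
Qed.
HB.instance Definition _ :=
  GRing.isZmodMorphism.Build C H (@complex_quat R) complex_quat_zmod.

Lemma complex_quat_monoid : monoid_morphism (@complex_quat R).
Proof. by split=> // [[a b] [c d]]; apply: quat_eqP; split; rewrite /=; ring. Qed.
HB.instance Definition _ :=
  GRing.isMonoidMorphism.Build C H (@complex_quat R) complex_quat_monoid.

Lemma conj_complex_quat (a : C) : conjq (complex_quat a) = complex_quat a^*.
Proof. by case: a => a b; rewrite /conjq /complex_quat /= oppr0. Qed.

(* [x = cpart x + jpart x * j] *)
Definition cpart x : C := (q1 x +i* qi x)%C.
Definition jpart x : C := (qj x +i* qk x)%C.

Lemma cpart_zmod : zmod_morphism cpart. Proof. by []. Qed.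
Lemma jpart_zmod : zmod_morphism jpart. Proof. by []. Qed.
HB.instance Definition _ := GRing.isZmodMorphism.Build H C cpart cpart_zmod.
HB.instance Definition _ := GRing.isZmodMorphism.Build H C jpart jpart_zmod.

Lemma parts_eq x y : cpart x = cpart y -> jpart x = jpart y -> x = y.
Proof. by case: x y => [? ? ? ?] [? ? ? ?] [-> ->] [-> ->]. Qed.

Lemma cpartM x y : cpart (x * y) = cpart x * cpart y - jpart x * (jpart y)^*.
Proof. by apply/eqP; rewrite eq_complex /=; apply/andP; split; apply/eqP; ring. Qed.
Lemma jpartM x y : jpart (x * y) = cpart x * jpart y + jpart x * (cpart y)^*.
Proof. by apply/eqP; rewrite eq_complex /=; apply/andP; split; apply/eqP; ring. Qed.

Lemma cpart_complex (a : C) : cpart (complex_quat a) = a. Proof. by case: a. Qed.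
Lemma cpart_conj x : cpart (conjq x) = (cpart x)^*. Proof. by []. Qed.
Lemma jpart_conj x : jpart (conjq x) = - jpart x. Proof. by []. Qed.

Definition sqnorm x : R := q1 x ^+ 2 + qi x ^+ 2 + qj x ^+ 2 + qk x ^+ 2.

Lemma sqnorm_ge0 x : 0 <= sqnorm x.
Proof. by rewrite /sqnorm !addr_ge0 ?sqr_ge0. Qed.

Lemma sqnorm_eq0 x : (sqnorm x == 0) = (x == 0).
Proof.
apply/eqP/eqP => [|->]; last by rewrite /sqnorm /= expr0n /= !addr0.
rewrite /sqnorm => x0; apply: quat_eqP.
have := sqr_ge0 (q1 x); have := sqr_ge0 (qi x).
have := sqr_ge0 (qj x); have := sqr_ge0 (qk x) => hk hj hi h1.
by split; apply/eqP; rewrite /= -sqrf_eq0; apply/eqP; lra.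
Qed.

Lemma mul_conjq x : conjq x * x = real_quat (sqnorm x).
Proof. by rewrite /sqnorm; apply: quat_eqP; split; rewrite /=; ring. Qed.
Lemma mulq_conj x : x * conjq x = real_quat (sqnorm x).
Proof. by rewrite /sqnorm; apply: quat_eqP; split; rewrite /=; ring. Qed.

Lemma q1_mulC x y : q1 (x * y) = q1 (y * x).
Proof. by rewrite /=; ring. Qed.

Lemma invq_exists x : x != 0 -> exists2 y, x * y = 1 & y * x = 1.
Proof.
rewrite -sqnorm_eq0 => x0; exists (real_quat (sqnorm x)^-1 * conjq x).
  by rewrite mulrA -real_quatC -mulrA mulq_conj -rmorphM mulVf.
by rewrite -mulrA mul_conjq -rmorphM mulVf.
Qed.

Lemma mulq_eq0 x y : x * y = 0 -> x = 0 \/ y = 0.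
Proof.
have [-> _|/invq_exists [z _ zx] xy0] := eqVneq x 0; first by left.
by right; rewrite -[y]mul1r -zx -mulrA xy0 mulr0.
Qed.

End QuatTheory.

(* Locked: otherwise unification of the pattern [_ *m _] with these unfolds
   everything. *)
HB.lock Definition adj (R : realType) m n (X : 'M[quat R]_(m, n)) :
  'M[quat R]_(n, m) := map_mx (@conjq R) X^T.
HB.lock Definition iota (R : realType) m n (A : 'M[R[i]]_(m, n)) :
  'M[quat R]_(m, n) := map_mx (@complex_quat R) A.
HB.lock Definition Cpart (R : realType) m n (X : 'M[quat R]_(m, n)) :
  'M[R[i]]_(m, n) := map_mx (@cpart R) X.
HB.lock Definition Jpart (R : realType) m n (X : 'M[quat R]_(m, n)) :
  'M[R[i]]_(m, n) := map_mx (@jpart R) X.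

Section QuatMatrix.
Variable R : realType.
Local Notation H := (quat R).
Local Notation C := (R[i]).

Lemma adjqE n (X : 'M[H]_n) : adjq X = adj X. Proof. by rewrite adj.unlock. Qed.

Lemma adjE m n (X : 'M[H]_(m, n)) i j : adj X i j = conjq (X j i).
Proof. by rewrite adj.unlock !mxE. Qed.

Lemma CpartE m n (X : 'M[H]_(m, n)) i j : Cpart X i j = cpart (X i j).
Proof. by rewrite Cpart.unlock mxE. Qed.

Lemma JpartE m n (X : 'M[H]_(m, n)) i j : Jpart X i j = jpart (X i j).
Proof. by rewrite Jpart.unlock mxE. Qed.

Lemma adjK m n (X : 'M[H]_(m, n)) : adj (adj X) = X.
Proof. by apply/matrixP => i j; rewrite !adjE conjqK. Qed.

Lemma iotaE m n (A : 'M[C]_(m, n)) i j : iota A i j = complex_quat (A i j).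
Proof. by rewrite iota.unlock mxE. Qed.

Definition mxqE := (adjE, iotaE, CpartE, JpartE, mxE).

Lemma adj_zmod m n : zmod_morphism (@adj R m n).
Proof.
by move=> X Y; apply/matrixP => i j; rewrite adjE !mxE !adjE -raddfB.
Qed.
HB.instance Definition _ m n :=
  GRing.isZmodMorphism.Build 'M[H]_(m, n) 'M[H]_(n, m) (@adj R m n) (@adj_zmod m n).

Lemma adjD m n (X Y : 'M[H]_(m, n)) : adj (X + Y) = adj X + adj Y.
Proof. exact: raddfD. Qed.

Lemma adjN m n (X : 'M[H]_(m, n)) : adj (- X) = - adj X.
Proof. exact: raddfN. Qed.

Lemma adjB m n (X Y : 'M[H]_(m, n)) : adj (X - Y) = adj X - adj Y.
Proof. exact: raddfB. Qed.

Lemma adj0 m n : adj (0 : 'M[H]_(m, n)) = 0.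
Proof. exact: raddf0. Qed.

Lemma adjM m n p (X : 'M[H]_(m, n)) (Y : 'M[H]_(n, p)) :
  adj (X *m Y) = adj Y *m adj X.
Proof.
apply/matrixP => i j; rewrite !mxqE raddf_sum; apply: eq_bigr => k _.
by rewrite !mxqE [LHS]conjqM.
Qed.

Lemma adj_scalar n (a : H) : adj (a%:M : 'M[H]_n) = (conjq a)%:M.
Proof.
by apply/matrixP => i j; rewrite !mxqE eq_sym; case: eqP; rewrite //= raddf0.
Qed.

Lemma adj1 n : adj (1%:M : 'M[H]_n) = 1%:M.
Proof. by rewrite adj_scalar conjq1. Qed.

Lemma iota_zmod m n : zmod_morphism (@iota R m n).
Proof.
by move=> X Y; apply/matrixP => i j; rewrite iotaE !mxE !iotaE -raddfB.
Qed.
HB.instance Definition _ m n :=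
  GRing.isZmodMorphism.Build 'M[C]_(m, n) 'M[H]_(m, n) (@iota R m n) (@iota_zmod m n).

Lemma iotaD m n (A B : 'M[C]_(m, n)) : iota (A + B) = iota A + iota B.
Proof. exact: raddfD. Qed.

Lemma iotaB m n (A B : 'M[C]_(m, n)) : iota (A - B) = iota A - iota B.
Proof. exact: raddfB. Qed.

Lemma iotaN m n (A : 'M[C]_(m, n)) : iota (- A) = - iota A.
Proof. exact: raddfN. Qed.

Lemma iota0 m n : iota (0 : 'M[C]_(m, n)) = 0.
Proof. exact: raddf0. Qed.

Lemma iotaM m n p (A : 'M[C]_(m, n)) (B : 'M[C]_(n, p)) :
  iota (A *m B) = iota A *m iota B.
Proof. by rewrite iota.unlock map_mxM. Qed.

Lemma iota1 n : iota (1%:M : 'M[C]_n) = 1%:M.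
Proof. by rewrite iota.unlock map_mx1. Qed.

Lemma adj_iota m n (A : 'M[C]_(m, n)) : adj (iota A) = iota (A ^t*).
Proof. by apply/matrixP => i j; rewrite !mxqE conj_complex_quat. Qed.

Lemma Cpart_zmod m n : zmod_morphism (@Cpart R m n).
Proof. by move=> X Y; apply/matrixP => i j; rewrite CpartE !mxE !CpartE -raddfB. Qed.
Lemma Jpart_zmod m n : zmod_morphism (@Jpart R m n).
Proof. by move=> X Y; apply/matrixP => i j; rewrite JpartE !mxE !JpartE -raddfB. Qed.
HB.instance Definition _ m n :=
  GRing.isZmodMorphism.Build 'M[H]_(m, n) 'M[C]_(m, n) (@Cpart R m n) (@Cpart_zmod m n).
HB.instance Definition _ m n :=
  GRing.isZmodMorphism.Build 'M[H]_(m, n) 'M[C]_(m, n) (@Jpart R m n) (@Jpart_zmod m n).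

Lemma Parts_eq m n (X Y : 'M[H]_(m, n)) :
  Cpart X = Cpart Y -> Jpart X = Jpart Y -> X = Y.
Proof.
move=> /matrixP eC /matrixP eJ; apply/matrixP => i j.
by apply: parts_eq; [have := eC i j | have := eJ i j]; rewrite !mxqE.
Qed.

(** The conjugation comes from [j a = a^* j] for complex [a]. *)
Lemma CpartM m n p (X : 'M[H]_(m, n)) (Y : 'M[H]_(n, p)) :
  Cpart (X *m Y) = Cpart X *m Cpart Y - Jpart X *m map_mx Num.conj (Jpart Y).
Proof.
apply/matrixP => i j; rewrite !mxqE raddf_sum -sumrB; apply: eq_bigr => k _.
by rewrite !mxqE [LHS]cpartM.
Qed.

Lemma JpartM m n p (X : 'M[H]_(m, n)) (Y : 'M[H]_(n, p)) :
  Jpart (X *m Y) = Cpart X *m Jpart Y + Jpart X *m map_mx Num.conj (Cpart Y).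
Proof.
apply/matrixP => i j; rewrite !mxqE raddf_sum -big_split; apply: eq_bigr => k _.
by rewrite !mxqE [LHS]jpartM.
Qed.

Lemma Cpart_iota m n (A : 'M[C]_(m, n)) : Cpart (iota A) = A.
Proof. by apply/matrixP => i j; rewrite !mxqE cpart_complex. Qed.

Lemma Jpart_iota m n (A : 'M[C]_(m, n)) : Jpart (iota A) = 0.
Proof. by apply/matrixP => i j; rewrite !mxqE. Qed.

Lemma iota_inj m n : injective (@iota R m n).
Proof. by move=> A B /(congr1 (@Cpart R m n)); rewrite !Cpart_iota. Qed.

Lemma iotaP m n (X : 'M[H]_(m, n)) : Jpart X = 0 -> X = iota (Cpart X).
Proof. by move=> JX; apply: Parts_eq; rewrite ?Cpart_iota ?Jpart_iota. Qed.

Lemma Cpart_iotaM m n p (A : 'M[C]_(m, n)) (Y : 'M[H]_(n, p)) :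
  Cpart (iota A *m Y) = A *m Cpart Y.
Proof. by rewrite CpartM Cpart_iota Jpart_iota mul0mx subr0. Qed.

Lemma Jpart_iotaM m n p (A : 'M[C]_(m, n)) (Y : 'M[H]_(n, p)) :
  Jpart (iota A *m Y) = A *m Jpart Y.
Proof. by rewrite JpartM Cpart_iota Jpart_iota mul0mx addr0. Qed.

Lemma Cpart_adj m n (X : 'M[H]_(m, n)) : Cpart (adj X) = (Cpart X) ^t*.
Proof. by apply/matrixP => i j; rewrite !mxqE. Qed.

Lemma Jpart_adj m n (X : 'M[H]_(m, n)) : Jpart (adj X) = - (Jpart X)^T.
Proof. by apply/matrixP => i j; rewrite !mxqE. Qed.

(** Over the quaternions the trace itself is not cyclic; its real part is, because the real part of
    a product is symmetric. *)
Lemma q1_mxtraceC m n (X : 'M[H]_(m, n)) (Y : 'M[H]_(n, m)) :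
  q1 (\tr (X *m Y)) = q1 (\tr (Y *m X)).
Proof.
rewrite /mxtrace !raddf_sum; under eq_bigr do rewrite mxE raddf_sum.
rewrite exchange_big; apply: eq_bigr => j _; rewrite mxE raddf_sum.
by apply: eq_bigr => i _; exact: q1_mulC.
Qed.

(** The real trace is the sum of the squared norms of the entries. For a hermitian idempotent [E]
    one has [adj E *m E = E], so such an [E] vanishes as soon as its real trace does. *)
Lemma q1_tr_adj_eq0 m n (X : 'M[H]_(m, n)) : q1 (\tr (adj X *m X)) = 0 -> X = 0.
Proof.
rewrite /mxtrace raddf_sum => /eqP.
have E j : q1 ((adj X *m X) j j) = \sum_i sqnorm (X i j).
  rewrite mxE raddf_sum; apply: eq_bigr => i _.
  by rewrite !mxqE mul_conjq.
rewrite (eq_bigr _ (fun j _ => E j)).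
rewrite psumr_eq0 => [/allP X0|j _]; last first.
  by apply: sumr_ge0 => i _; apply: sqnorm_ge0.
apply/matrixP => i j; have := X0 j (mem_index_enum _).
rewrite psumr_eq0 => [/allP Xj|l _]; last exact: sqnorm_ge0.
by have := Xj i (mem_index_enum _); rewrite /= sqnorm_eq0 mxE => /eqP.
Qed.

Lemma scaleqE n c (X : 'M[H]_n) : scaleq c X = real_quat c *: X.
Proof. by []. Qed.

Lemma scaleq_mull n p c (X : 'M[H]_(n, p)) m (Y : 'M[H]_(m, n)) :
  Y *m (real_quat c *: X) = real_quat c *: (Y *m X).
Proof.
apply/matrixP => i j; rewrite !mxqE mulr_sumr; apply: eq_bigr => k _.
by rewrite !mxqE mulrA -real_quatC mulrA.
Qed.

Lemma adj_scaleq m n c (X : 'M[H]_(m, n)) :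
  adj (real_quat c *: X) = real_quat c *: adj X.
Proof.
by apply/matrixP => i j; rewrite !mxqE conjqM conj_real_quat real_quatC.
Qed.

End QuatMatrix.

(** * Block unitary groups *)

Section BlockUnitary.
Variables (C : numClosedFieldType) (n : nat).
Implicit Types (r : rel 'I_n) (X Y W : 'M[C]_n) (c : pred 'I_n).

Lemma tmxCM m p q (A : 'M[C]_(m, p)) (B : 'M[C]_(p, q)) :
  (A *m B) ^t* = B ^t* *m A ^t*.
Proof. by rewrite trmx_mul map_mxM. Qed.

Lemma tmxCE m p (A : 'M[C]_(m, p)) i j : (A ^t*) i j = (A j i)^*.
Proof. by rewrite !mxE. Qed.

Lemma tmxCD m p (A B : 'M[C]_(m, p)) : (A + B) ^t* = A ^t* + B ^t*.
Proof. by apply/matrixP => i j; rewrite !mxE rmorphD. Qed.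

Lemma tmxCN m p (A : 'M[C]_(m, p)) : (- A) ^t* = - A ^t*.
Proof. by apply/matrixP => i j; rewrite !mxE rmorphN. Qed.

Lemma tmxCB m p (A B : 'M[C]_(m, p)) : (A - B) ^t* = A ^t* - B ^t*.
Proof. by rewrite tmxCD tmxCN. Qed.

Lemma tmxCZ m p (a : C) (A : 'M[C]_(m, p)) : (a *: A) ^t* = a^* *: A ^t*.
Proof. by apply/matrixP => i j; rewrite !mxE rmorphM. Qed.

Lemma tmxC1 : (1%:M : 'M[C]_n) ^t* = 1%:M.
Proof. by rewrite trmx1 map_mx1. Qed.

Definition supp r X := forall i j, ~~ r i j -> X i j = 0.

(* For a partial equivalence relation [r] this is the product of the unitary
   groups of the classes of [r], acting trivially on the coordinates [i] with
   [~~ r i i]. *)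
Definition Kgrp r X := X \is unitarymx /\ supp r (X - 1%:M).

Lemma supp0 r : supp r 0. Proof. by move=> i j _; rewrite mxE. Qed.

Lemma suppD r X Y : supp r X -> supp r Y -> supp r (X + Y).
Proof. by move=> sX sY i j rij; rewrite mxE sX ?sY ?addr0. Qed.

Lemma suppN r X : supp r X -> supp r (- X).
Proof. by move=> sX i j rij; rewrite mxE sX ?oppr0. Qed.

Lemma suppM r X Y : transitive r -> supp r X -> supp r Y -> supp r (X *m Y).
Proof.
move=> tr sX sY i j rij; rewrite mxE big1 // => k _.
have [rik|/sX->] := boolP (r i k); last by rewrite mul0r.
by rewrite sY ?mulr0 //; apply: contra rij; apply: tr.
Qed.

Lemma supp_adj r X : symmetric r -> supp r X -> supp r (X ^t*).
Proof. by move=> sr sX i j rij; rewrite tmxCE sX ?conjC0 // sr. Qed.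

Lemma supp_sub r r' X : subrel r r' -> supp r X -> supp r' X.
Proof. by move=> rr' sX i j r'ij; apply: sX; apply: contra r'ij => /rr'. Qed.

Lemma Kgrp_sub r r' X : subrel r r' -> Kgrp r X -> Kgrp r' X.
Proof. by move=> rr' [uX sX]; split=> //; apply: supp_sub sX. Qed.

Lemma Kgrp1 r : Kgrp r 1%:M.
Proof. by split; [apply/unitarymxP; rewrite tmxC1 mulmx1 | rewrite subrr; apply: supp0]. Qed.

Lemma KgrpM r X Y : transitive r -> Kgrp r X -> Kgrp r Y -> Kgrp r (X *m Y).
Proof.
move=> tr [uX sX] [uY sY]; split; first exact: mul_unitarymx.
have -> : X *m Y - 1%:M = (X - 1%:M) *m (Y - 1%:M) + (X - 1%:M) + (Y - 1%:M).
  by rewrite mulmxBr mulmx1 subrK mulmxBl mul1mx addrA subrK.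
by apply: suppD => //; apply: suppD => //; apply: suppM.
Qed.

Lemma KgrpV r X : symmetric r -> Kgrp r X -> Kgrp r (X ^t*).
Proof.
move=> sr [uX sX]; split; first by rewrite trmxC_unitary.
by rewrite -tmxC1 -tmxCB; apply: supp_adj.
Qed.

Lemma Kgrp_mulVmx r X : Kgrp r X -> X *m X ^t* = 1%:M.
Proof. by case=> /unitarymxP. Qed.
Lemma Kgrp_mulmxV r X : Kgrp r X -> X ^t* *m X = 1%:M.
Proof. by case=> /unitarymxP /mulmx1C. Qed.

Lemma Kgrp_off r X i j : Kgrp r X -> ~~ r i j -> X i j = (i == j)%:R.
Proof.
by move=> [_ sX] rij; have /eqP := sX i j rij; rewrite !mxE subr_eq0 => /eqP.
Qed.

Lemma KgrpE r X : X \is unitarymx -> (forall i j, ~~ r i j -> X i j = (i == j)%:R) ->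
  Kgrp r X.
Proof. by move=> uX sX; split=> // i j /sX; rewrite !mxE => ->; rewrite subrr. Qed.

(* [W] is a complex Householder reflection. *)
Lemma householder c (i0 : 'I_n) (a : 'cV[C]_n) : c i0 ->
  exists W, Kgrp [rel i j | c i && c j] W /\
    forall i, c i -> i != i0 -> (W *m a) i 0 = 0.
Proof.
move=> ci0; pose s := \sum_(i | c i) `|a i 0| ^+ 2.
have s_ge0 : 0 <= s by apply: sumr_ge0 => i _; rewrite exprn_ge0.
have [s0|sN0] := eqVneq s 0.
  exists 1%:M; split=> [|i ci _]; first exact: Kgrp1.
  move: s0 => /eqP; rewrite psumr_eq0 => [/allP /(_ i (mem_index_enum _))|j _].
    by rewrite ci /= sqrf_eq0 normr_eq0 mul1mx => /eqP.
  by rewrite exprn_ge0.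
pose rho := sqrtC s; pose a0 := a i0 0.
have rho_gt0 : 0 < rho by rewrite sqrtC_gt0 lt_def sN0.
have rhoJ : rho^* = rho by apply/CrealP/ger0_real/ltW.
(* The phase of [a0], so that [a0] and [th * rho] add up without cancellation. *)
pose th := if a0 == 0 then 1 else a0 / `|a0|.
have th1 : th * th^* = 1.
  rewrite /th; have [_|a0N0] := eqVneq a0 0; first by rewrite conjC1 mulr1.
  rewrite -normCK normrM normfV normr_id divff ?normr_eq0 //.
  by rewrite expr1n.
have tha : th^* * a0 = `|a0|.
  rewrite /th; have [->|a0N0] := eqVneq a0 0; first by rewrite mulr0 normr0.
  rewrite rmorphM fmorphV /= conj_normC mulrAC [_^* * _]mulrC -normCK expr2 mulfK //.
  by rewrite normr_eq0.
pose u : 'cV[C]_n := \col_i ((if c i then a i 0 else 0) + (i == i0)%:R * (th * rho)).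
(* Since [u^* a = sig] and [u^* u = 2 sig], the matrix [W] below is the reflection in the hyperplane
   orthogonal to [u], and [W a = a - u] vanishes on [c] except at [i0]. *)
pose sig := s + rho * `|a0|.
have sigN0 : sig != 0.
  by rewrite gt_eqF // ltr_wpDr ?mulr_ge0 ?normr_ge0 ?(ltW rho_gt0) // lt_def sN0.
have sigJ : sig^* = sig.
  apply/CrealP/ger0_real/addr_ge0 => //.
  by rewrite mulr_ge0 ?normr_ge0 ?(ltW rho_gt0).
have ua : u ^t* *m a = sig%:M.
  rewrite [LHS]mx11_scalar; congr (_%:M); rewrite mxE.
  have -> : \sum_j (u ^t*) 0 j * a j 0 =
    \sum_j ((if c j then `|a j 0| ^+ 2 else 0) + (j == i0)%:R * (rho * `|a0|)).
    apply: eq_bigr => j _; rewrite tmxCE mxE rmorphD mulrDl; congr (_ + _).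
      by case: (c j); rewrite ?rmorph0 ?mul0r // normCK mulrC.
    have [->|_] := eqVneq j i0; last by rewrite !mul0r rmorph0 mul0r.
    by rewrite !mul1r rmorphM /= rhoJ mulrAC tha mulrC.
  rewrite big_split /= -big_mkcond; congr (_ + _).
  rewrite (bigD1 i0) //= eqxx mul1r big1 ?addr0 // => j /negbTE->.
  by rewrite mul0r.
have uu : u ^t* *m u = (sig *+ 2)%:M.
  have uE : u = (\col_i (if c i then a i 0 else 0)) + (th * rho) *: delta_mx i0 0.
    apply/matrixP => i j; rewrite ord1 !mxE eqxx andbT.
    by rewrite [X in _ + X]mulrC.
  rewrite {2}uE mulmxDr.
  have -> : u ^t* *m \col_i (if c i then a i 0 else 0) = u ^t* *m a.
    rewrite [LHS]mx11_scalar [RHS]mx11_scalar; congr (_%:M); rewrite !mxE.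
    apply: eq_bigr => j _; rewrite !mxE; case: ifP => // cj.
    have -> : (j == i0) = false by apply/eqP => ji; rewrite ji ci0 in cj.
    by rewrite mul0r addr0 rmorph0 !mul0r.
  rewrite ua mulr2n [(sig + sig)%:M]raddfD; congr (_ + _).
  rewrite -scalemxAr [X in _ *: X]mx11_scalar -colE mxE tmxCE mxE ci0 eqxx mul1r.
  rewrite scale_scalar_mx -/a0; congr (_%:M).
  rewrite rmorphD rmorphM /= rhoJ mulrDr.
  rewrite [X in _ + X](_ : _ = rho * rho); last first.
    by rewrite mulrACA th1 mul1r.
  rewrite -expr2 sqrtCK addrC /sig; congr (_ + _).
  rewrite -[`|a0|](CrealP (normr_real _)) -tha rmorphM /= conjCK.
  by rewrite mulrCA mulrA.
pose W := 1%:M - sig^-1 *: (u *m u ^t*).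
have WJ : W ^t* = W.
  rewrite tmxCB tmxC1 tmxCZ fmorphV /= sigJ tmxCM.
  by rewrite trmxCK.
exists W; split.
  apply: KgrpE => [|i j /=].
    apply/unitarymxP; rewrite WJ /W mulmxBl mul1mx mulmxBr mulmx1.
    rewrite -scalemxAl -scalemxAr mulmxA -(mulmxA u) uu mul_mx_scalar.
    rewrite -scalemxAl !scalerA (_ : sig^-1 * (_ * _) = sig^-1 *+ 2); last first.
      by rewrite !mulrnAr mulVf // mulr1.
    by rewrite mulr2n scalerDl opprB addrK subrK.
  rewrite negb_and => cij; rewrite !mxE big_ord1 tmxCE !mxE.
  suff -> : ((if c i then a i 0 else 0) + (i == i0)%:R * (th * rho)) *
    ((if c j then a j 0 else 0) + (j == i0)%:R * (th * rho))^* = 0.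
    by rewrite mulr0 subr0.
  have cF k : ~~ c k -> (if c k then a k 0 else 0) + (k == i0)%:R * (th * rho) = 0.
    move=> ck; rewrite (negbTE ck).
    have -> : (k == i0) = false by apply/eqP => ki; rewrite ki ci0 in ck.
    by rewrite mul0r addr0.
  by case/orP: cij => /cF ->; rewrite ?rmorph0 ?mulr0 ?mul0r.
move=> i ci ii0; rewrite mulmxBl mul1mx -scalemxAl -mulmxA ua mul_mx_scalar.
rewrite scalerA mulVf // scale1r !mxE ci (negbTE ii0) mul0r addr0 subrr.
by [].
Qed.

End BlockUnitary.

(** * Simultaneous diagonalization inside block unitary groups *)

Section Diagonalization.
Variables (C : numClosedFieldType) (n : nat).
Implicit Types (r : rel 'I_n) (X Y W t : 'M[C]_n) (c : pred 'I_n).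

(* Cayley-Hamilton makes some product of the [t - z] vanish on [v]; the last
   nonzero partial product is an eigenvector, still supported in [c]. *)
Lemma eigenvector_in c t (v : 'cV[C]_n) :
  (forall i j, c j -> ~~ c i -> t i j = 0) ->
  (forall i, ~~ c i -> v i 0 = 0) -> v != 0 ->
  exists a (w : 'cV[C]_n),
    [/\ t *m w = a *: w, forall i, ~~ c i -> w i 0 = 0 & w != 0].
Proof.
move=> tc; have tcv (w : 'cV[C]_n) a : (forall i, ~~ c i -> w i 0 = 0) ->
    forall i, ~~ c i -> (t *m w - a *: w) i 0 = 0.
  move=> cw i ci; rewrite !mxE cw // mulr0 subr0 big1 // => j _.
  by have [cj|/cw->] := boolP (c j); rewrite ?mulr0 // tc ?mul0r.
have [s s0] : exists s : seq C, forall w : 'cV[C]_n,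
    foldr (fun a u => t *m u - a *: u) w s = 0.
  case: n t {tcv tc} => [|m] t'; first by exists [::] => w; rewrite flatmx0.
  have [s Es] := closed_field_poly_normal (char_poly t').
  have := Cayley_Hamilton t'; rewrite Es (monicP (char_poly_monic t')) scale1r.
  rewrite rmorph_prod /= => CH; exists s => w.
  suff -> : foldr (fun a u => t' *m u - a *: u) w s =
     (\prod_(z <- s) horner_mx t' ('X - z%:P)) *m w by rewrite CH mul0mx.
  elim: s {Es CH} => [|a s IHs] /=; first by rewrite big_nil mul1mx.
  rewrite big_cons IHs rmorphB /= horner_mx_X horner_mx_C.
  by rewrite -[RHS]mulmxA mulmxBl mul_scalar_mx.
move=> cv v0; have {s0} := s0 v.
elim: s => [/eqP|a s IHs /=]; first by rewrite (negbTE v0).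
set w := foldr _ _ _ => /subr0_eq tw.
have [w0|w0] := eqVneq w 0; first exact: IHs.
exists a, w; split=> //; rewrite /w; elim: (s) => [|b s' IHs'] //=.
exact: tcv.
Qed.

(** Separates [i0] from the rest of its class, as happens to a unitary matrix once an eigenvector
    lies on the axis [i0]. *)
Definition isolate r (i0 : 'I_n) : rel 'I_n :=
  [rel i j | r i j && ((i == i0) == (j == i0))].

Lemma isolate_sub r i0 : subrel (isolate r i0) r.
Proof. by move=> i j /andP[]. Qed.

Lemma isolate_sym r i0 : symmetric r -> symmetric (isolate r i0).
Proof. by move=> sr i j; rewrite /isolate /= sr eq_sym. Qed.

Lemma isolate_trans r i0 : transitive r -> transitive (isolate r i0).
Proof.
move=> tr j i k; rewrite /isolate /= => /andP[rij /eqP->] /andP[rjk ->].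
by rewrite (tr j).
Qed.

(** The measure for the inductions below, and later the real dimension of the space of
    skew-hermitian matrices supported in [r]. *)
Definition cardr r := #|[pred p : 'I_n * 'I_n | r p.1 p.2]|.

Lemma cardr_lt r r' i j : subrel r' r -> r i j -> ~~ r' i j -> (cardr r' < cardr r)%N.
Proof.
move=> r'r rij r'ij; apply: proper_card; apply/properP; split.
  by apply/fintype.subsetP => p; rewrite !inE => /r'r.
by exists (i, j); rewrite inE.
Qed.

(** A class with a nonzero off-diagonal entry contains an eigenvector of [t]. A reflection moves it
    onto an axis [i0] of that class, which then splits off and leaves a smaller relation. *)
Lemma diag_conj1 r t : symmetric r -> transitive r -> Kgrp r t ->
  exists2 W, Kgrp r W & is_diag_mx (W *m t *m W ^t*).
Proof.
have [m] := ubnP (cardr r); elim: m r t => // m IHm r t ltm sr tr Kt.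
have [dt|] := boolP (is_diag_mx t).
  by exists 1%:M; rewrite ?tmxC1 ?mul1mx ?mulmx1 //; apply: Kgrp1.
move=> ndt; have [i0 [j0 [ij0 tij0]]] : exists i0 j0, i0 != j0 /\ t i0 j0 != 0.
  move: ndt => /is_diag_mxP /existsNP[i0] /existsNP[j0] /not_implyP[ij /eqP tij].
  by exists i0, j0.
have r0 : r i0 j0.
  by apply: contraNT tij0 => /(Kgrp_off Kt) ->; rewrite (negbTE ij0).
have r00 : r i0 i0 by apply: (tr j0) => //; rewrite sr.
have rCt i j : r i0 j -> ~~ r i0 i -> t i j = 0.
  move=> rj ri; rewrite (Kgrp_off Kt); last first.
    by apply: contra ri => rij; apply: (tr j) => //; rewrite sr.
  by case: eqP ri => // ->; rewrite rj.
have := @eigenvector_in (r i0) t (delta_mx i0 0) rCt.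
case=> [i ri||a [w [tw cw w0]]].
- by rewrite mxE; case: eqP ri => // ->; rewrite r00.
- by apply/eqP => /matrixP /(_ i0 0); rewrite !mxE !eqxx => /eqP; rewrite oner_eq0.
have [W [KW Ww]] := @householder C n (r i0) i0 w r00.
have cr : subrel [rel i j | r i0 i && r i0 j] r.
  by move=> i j /andP[ri rj]; apply: (tr i0) => //; rewrite sr.
have KrW := Kgrp_sub cr KW.
pose b := (W *m w) i0 0.
have WwE : W *m w = b *: delta_mx i0 0.
  apply/matrixP => i j; rewrite !ord1 [RHS]mxE [X in _ * X]mxE eqxx andbT.
  have [->|ii0] := eqVneq i i0; first by rewrite mulr1.
  rewrite mulr0; have [/Ww ->//|ri] := boolP (r i0 i).
  rewrite mxE big1 // => j' _; rewrite (Kgrp_off KW) /= ?(negbTE ri) //.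
  by case: eqP => [<-|_]; rewrite ?mul0r // cw ?mulr0.
have b0 : b != 0.
  apply: contra w0 => /eqP b0; have := congr1 (mulmx (W ^t*)) WwE.
  by rewrite mulmxA (Kgrp_mulmxV KW) mul1mx b0 scale0r mulmx0 => ->.
pose t1 := W *m t *m W ^t*.
have Kt1 : Kgrp r t1 by apply: KgrpM => //; [apply: KgrpM | apply: KgrpV].
have t1e : t1 *m delta_mx i0 0 = a *: (delta_mx i0 0 : 'cV[C]_n).
  apply: (scalerI b0); rewrite scalemxAr -WwE /t1 -!mulmxA.
  rewrite (mulmxA (W ^t*)) (Kgrp_mulmxV KW) mul1mx tw.
  by rewrite -scalemxAr WwE !scalerA mulrC.
have t1i i : i != i0 -> t1 i i0 = 0.
  move=> ii0; have /matrixP/(_ i 0) := t1e.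
  by rewrite -colE !mxE (negbTE ii0) /= mulr0.
have a0 : a != 0.
  apply/eqP => a0; have /(congr1 (mulmx (t1 ^t*))) := t1e.
  rewrite mulmxA (Kgrp_mulmxV Kt1) mul1mx a0 scale0r mulmx0.
  by move/matrixP/(_ i0 0); rewrite !mxE !eqxx => /eqP; rewrite oner_eq0.
(* [t1] is unitary, so the axis vector is an eigenvector of the adjoint as well, and row [i0] is
   cleared along with column [i0]. *)
have t1j i : i != i0 -> t1 i0 i = 0.
  move=> ii0; have /(congr1 (mulmx (t1 ^t*))) := t1e.
  rewrite mulmxA (Kgrp_mulmxV Kt1) mul1mx -scalemxAr -colE.
  move/matrixP/(_ i 0); rewrite !mxE (negbTE ii0) /= => /esym/eqP.
  by rewrite mulf_eq0 (negbTE a0) /= conjC_eq0 => /eqP.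
have Kt1' : Kgrp (isolate r i0) t1.
  apply: KgrpE => [|i j]; first by case: Kt1.
  rewrite negb_and => /orP[/(Kgrp_off Kt1)//|].
  have [->|ii0] := eqVneq i i0; have [->|ji0] := eqVneq j i0 => //= _.
    by rewrite t1j // eq_sym (negbTE ji0).
  by rewrite t1i // (negbTE ii0).
have ltr : (cardr (isolate r i0) < cardr r)%N.
  apply: (@cardr_lt _ _ i0 j0) => //; first exact: isolate_sub.
  by rewrite /isolate /= r0 eqxx [j0 == _]eq_sym (negbTE ij0).
have [||W2 KW2 dW2] := IHm _ t1 (leq_trans ltr ltm) _ _ Kt1'.
- exact: isolate_sym.
- exact: isolate_trans.
have KrW2 := Kgrp_sub (@isolate_sub r i0) KW2.
exists (W2 *m W); first exact: KgrpM.
by rewrite tmxCM -!mulmxA; rewrite -!mulmxA in dW2.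
Qed.

(* If all matrices of [T] are conjugated by [W] into matrices that commute with
   a diagonal one, they preserve its eigenspaces, which refine [r]. *)
Lemma diag_conj r (T : 'M[C]_n -> Prop) : symmetric r -> transitive r ->
  (forall t, T t -> Kgrp r t) -> (forall s t, T s -> T t -> s *m t = t *m s) ->
  exists2 W, Kgrp r W & forall t, T t -> is_diag_mx (W *m t *m W ^t*).
Proof.
have [m] := ubnP (cardr r); elim: m r T => // m IHm r T ltm sr tr KT cT.
have [dT|] := pselect (forall t, T t -> is_diag_mx t).
  exists 1%:M => [|t Tt]; first exact: Kgrp1.
  by rewrite tmxC1 mul1mx mulmx1; apply: dT.
move=> /existsNP[t0] /not_implyP[Tt0 /negP ndt0].
have [W KW /is_diag_mxP dW] := diag_conj1 sr tr (KT _ Tt0).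
pose d := W *m t0 *m W ^t*; rewrite -/d in dW.
pose r1 : rel 'I_n := [rel i j | r i j && (d i i == d j j)].
have sub1 : subrel r1 r by move=> i j /andP[].
have sr1 : symmetric r1 by move=> i j; rewrite /r1 /= sr eq_sym.
have tr1 : transitive r1.
  by move=> j i k; rewrite /r1 /= => /andP[rij /eqP->] /andP[rjk ->]; rewrite (tr j).
pose T1 t := exists2 s, T s & t = W *m s *m W ^t*.
have KT1 t : T1 t -> Kgrp r t.
  by move=> [s Ts ->]; apply: KgrpM => //; [apply: KgrpM => //; exact: KT | exact: KgrpV].
have WM s t : (W *m s *m W ^t*) *m (W *m t *m W ^t*) = W *m (s *m t) *m W ^t*.
  by rewrite -!mulmxA (mulmxA (W ^t*)) (Kgrp_mulmxV KW) mul1mx.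
have comd X : X *m d = d *m X -> forall i j, d i i != d j j -> X i j = 0.
  move=> /matrixP Xd i j dij; have := Xd i j; rewrite !mxE.
  rewrite (bigD1 j) //= big1 ?addr0 => [|k kj]; last first.
    by rewrite [d k j]dW ?mulr0.
  rewrite (bigD1 i) //= big1 ?addr0 => [|k ki]; last first.
    by rewrite [d i k]dW ?mul0r // eq_sym.
  move/eqP; rewrite mulrC -subr_eq0 -mulrBl mulf_eq0 subr_eq0 eq_sym.
  by rewrite (negbTE dij) => /eqP.
have KT1' t : T1 t -> Kgrp r1 t.
  move=> T1t; apply: KgrpE => [|i j]; first by case: (KT1 _ T1t).
  rewrite negb_and => /orP[/(Kgrp_off (KT1 _ T1t))//|dij].
  rewrite comd //; last by case: T1t => s Ts ->; rewrite /d !WM (cT s t0).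
  by case: (i =P j) dij => [->|//]; rewrite eqxx.
have cT1 s t : T1 s -> T1 t -> s *m t = t *m s.
  by move=> [s' Ts ->] [t' Tt ->]; rewrite !WM (cT s' t').
have ltr : (cardr r1 < cardr r)%N.
  have [i [j [rij dij]]] : exists i j, r i j /\ d i i != d j j.
    (* If [d] were constant on the classes of [r], it would commute with [W], and [t0 = d] would be
       diagonal. *)
    apply: contrapT => nd; case/negP: ndt0.
    have {}nd i j : r i j -> d i i = d j j.
      by move=> rij; apply/eqP; apply: contrapT => /negP dij; apply: nd; exists i, j.
    have Wd : W *m d = d *m W.
      apply/matrixP => i j; rewrite !mxE.
      rewrite (bigD1 j) //= big1 ?addr0 => [|k kj]; last first.
        by rewrite [d k j]dW ?mulr0.
      rewrite (bigD1 i) //= big1 ?addr0 => [|k ki]; last first.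
        by rewrite [d i k]dW ?mul0r // eq_sym.
      have [/nd ->|rij] := boolP (r i j); first by rewrite mulrC.
      rewrite (Kgrp_off KW rij).
      by case: eqP => [->|_]; rewrite ?mulr0 ?mul0r // mulrC.
    have -> : t0 = d.
      have := congr1 (mulmx (W ^t*)) Wd.
      rewrite mulmxA (Kgrp_mulmxV KW) mul1mx /d -!mulmxA (Kgrp_mulmxV KW) mulmx1.
      by rewrite !mulmxA (Kgrp_mulmxV KW) mul1mx.
    by apply/is_diag_mxP => i j; exact: dW.
  by apply: (@cardr_lt _ _ i j) => //; rewrite /r1 /= rij (negbTE dij).
have [W2 KW2 dW2] := IHm r1 T1 (leq_trans ltr ltm) sr1 tr1 KT1' cT1.
exists (W2 *m W) => [|t Tt].
  by apply: KgrpM => //; apply: Kgrp_sub KW2.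
rewrite tmxCM -!mulmxA; have := dW2 (W *m t *m W ^t*).
by rewrite -!mulmxA; apply; exists t => //; rewrite -!mulmxA.
Qed.

End Diagonalization.

(** * Smooth curves *)

Section Smooth.
Variable R : realType.
Implicit Types f g : R -> R.

(** Coinduction: a class of differentiable functions that is closed under differentiation contains
    only smooth functions. This avoids formulas for iterated derivatives. *)
Lemma smooth_coind (P : (R -> R) -> Prop) :
  (forall f, P f -> (forall t, derivable f t 1) /\ P (derive1 f)) ->
  forall f, P f -> smooth f.
Proof.
move=> HP f Pf m; suff : P (derive1n m f) by move/HP => -[].
by elim: m => [//|m IHm]; rewrite derive1nS; have [] := HP _ IHm.
Qed.

Lemma smooth_derivable f t : smooth f -> derivable f t 1.
Proof. by move=> sf; exact: (sf 0%N). Qed.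

Lemma smooth_derive1 f : smooth f -> smooth (derive1 f).
Proof.
move=> sf m t; have := sf m.+1 t.
by rewrite /derive1n iterSr.
Qed.

Lemma derive1_mul f g t : derivable f t 1 -> derivable g t 1 ->
  derive1 (fun x => f x * g x) t = derive1 f t * g t + f t * derive1 g t.
Proof.
move=> df dg; rewrite !derive1E.
have -> := @deriveM _ _ f g t 1 df dg.
by rewrite addrC -!/(_ * _) [_ *: 'D_1 f t]mulrC.
Qed.

Lemma derive1_add f g t : derivable f t 1 -> derivable g t 1 ->
  derive1 (fun x => f x + g x) t = derive1 f t + derive1 g t.
Proof. by move=> df dg; rewrite !derive1E (deriveD df dg). Qed.

Lemma derive1_opp f t : derivable f t 1 ->
  derive1 (fun x => - f x) t = - derive1 f t.
Proof. by move=> df; rewrite !derive1E; exact: deriveN. Qed.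

Lemma smooth_cst (c : R) : smooth (fun=> c).
Proof.
apply: (@smooth_coind (fun f => exists c, f = fun=> c)); last by exists c.
move=> _ [a ->]; split=> [t|]; first exact: derivable_cst.
by exists 0; apply/funext => t; rewrite derive1_cst.
Qed.

Lemma smoothD f g : smooth f -> smooth g -> smooth (fun t => f t + g t).
Proof.
move=> sf sg; apply: (@smooth_coind (fun h => exists f g,
  [/\ smooth f, smooth g & h = fun t => f t + g t])); last by exists f, g.
move=> _ [f1 [g1 [sf1 sg1 ->]]]; split=> [t|].
  by apply: derivableD; apply: smooth_derivable.
exists (derive1 f1), (derive1 g1); split; try exact: smooth_derive1.
by apply/funext => t; rewrite derive1_add //; apply: smooth_derivable.
Qed.

Lemma smoothM f g : smooth f -> smooth g -> smooth (fun t => f t * g t).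
Proof.
(* Single products are not closed under differentiation; finite sums of products are. *)
move=> sf sg; apply: (@smooth_coind (fun h => exists s : seq ((R -> R) * (R -> R)),
  (forall p, List.In p s -> smooth p.1 /\ smooth p.2) /\
  h = fun t => \sum_(p <- s) p.1 t * p.2 t)); last first.
  exists [:: (f, g)]; split=> [p /= [<-|[]]|]; first by split.
  by apply/funext => t; rewrite big_seq1.
move=> _ [s [ss ->]]; suff [ds [s' [ss' dE]]] :
  (forall t, derivable (fun t => \sum_(p <- s) p.1 t * p.2 t) t 1) /\
  exists s' : seq ((R -> R) * (R -> R)),
  (forall p, List.In p s' -> smooth p.1 /\ smooth p.2) /\
  derive1 (fun t => \sum_(p <- s) p.1 t * p.2 t) =
    fun t => \sum_(p <- s') p.1 t * p.2 t by split=> //; exists s'.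
elim: s ss => [|[f1 g1] s IHs] ss.
  split=> [t|]; first by under eq_fun do rewrite big_nil; apply: derivable_cst.
  exists [::]; split=> //; apply/funext => t.
  by under eq_fun do rewrite big_nil; rewrite derive1_cst big_nil.
have [|ds [s' [ss' dE]]] := IHs _; first by move=> p ps; apply: ss; right.
have [/= sf1 sg1] := ss _ (or_introl (erefl _)).
have dfg t : derivable (fun t => f1 t * g1 t) t 1.
  by apply: derivableM; apply: smooth_derivable.
split=> [t|].
  by under eq_fun do rewrite big_cons; apply: derivableD.
exists [:: (derive1 f1, g1), (f1, derive1 g1) & s']; split=> [p /= [<-|[<-|/ss'//]]|].
- by split; [exact: smooth_derive1 | exact: sg1].
- by split; [exact: sf1 | exact: smooth_derive1].
apply/funext => t; under eq_fun do rewrite big_cons.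
rewrite derive1_add; [|exact: dfg|exact: ds].
rewrite derive1_mul; [|exact: smooth_derivable..].
by rewrite dE !big_cons /= addrA.
Qed.

Lemma smoothN f : smooth f -> smooth (fun t => - f t).
Proof.
move=> sf; under eq_fun do rewrite -mulN1r.
by apply: smoothM; [exact: smooth_cst | exact: sf].
Qed.

Lemma is_derive_trig (a b c t : R) :
  is_derive t 1 (fun t => a * sin (c * t) + b * cos (c * t))
    (- (c * b) * sin (c * t) + c * a * cos (c * t)).
Proof.
have dc : is_derive t 1 (fun x => c * x) c.
  apply: (is_derive_eq (is_deriveZ c (is_derive_id t 1))).
  by rewrite /GRing.scale /= mulr1.
have ds := is_derive1_comp (is_derive_sin (c * t)) dc.
have dco := is_derive1_comp (is_derive_cos (c * t)) dc.
apply: (is_derive_eq (is_deriveD (is_deriveZ a ds) (is_deriveZ b dco))).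
by rewrite /GRing.scale /=; ring.
Qed.

(** The span of [sin (c t)] and [cos (c t)] is closed under differentiation. *)
Lemma smooth_trig (a b c : R) : smooth (fun t => a * sin (c * t) + b * cos (c * t)).
Proof.
apply: (@smooth_coind (fun f => exists a b,
  f = fun t => a * sin (c * t) + b * cos (c * t))); last by exists a, b.
move=> _ [a' [b' ->]]; split=> [t|]; first by have [] := is_derive_trig a' b' c t.
exists (- (c * b')), (c * a'); apply/funext => t.
by rewrite derive1E; have := is_derive_trig a' b' c t => ?; rewrite derive_val.
Qed.

Lemma smooth_derive1D f g t : smooth f -> smooth g ->
  derive1 (fun x => f x + g x) t = derive1 f t + derive1 g t.
Proof. by move=> sf sg; rewrite (derive1_add (sf 0%N t) (sg 0%N t)). Qed.

Lemma smooth_derive1M f g t : smooth f -> smooth g ->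
  derive1 (fun x => f x * g x) t = derive1 f t * g t + f t * derive1 g t.
Proof. by move=> sf sg; rewrite (derive1_mul (sf 0%N t) (sg 0%N t)). Qed.

Lemma smooth_derive1N f t : smooth f -> derive1 (fun x => - f x) t = - derive1 f t.
Proof. by move=> sf; rewrite (derive1_opp (sf 0%N t)). Qed.

Lemma derive1_trig (a b c t : R) :
  derive1 (fun t => a * sin (c * t) + b * cos (c * t)) t =
  - (c * b) * sin (c * t) + c * a * cos (c * t).
Proof.
by rewrite derive1E (@derive_val _ _ _ _ _ _ _ (is_derive_trig a b c t)).
Qed.

End Smooth.

Arguments smooth_cst {R} c.
Arguments smooth_trig {R} a b c.

(* Otherwise tactics closing trivial goals compute with iterated derivatives. *)
#[global] Opaque smooth.

(** * Calculus of quaternionic matrix curves *)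

Section Curves.
Variable R : realType.
Local Notation H := (quat R).
Local Notation C := (R[i]).

Definition smoothq (f : R -> H) := [/\ smooth (fun t => q1 (f t)),
  smooth (fun t => qi (f t)), smooth (fun t => qj (f t)) &
  smooth (fun t => qk (f t))].

Definition derq (f : R -> H) (t : R) : H :=
  Quat (derive1 (fun t => q1 (f t)) t) (derive1 (fun t => qi (f t)) t)
       (derive1 (fun t => qj (f t)) t) (derive1 (fun t => qk (f t)) t).

Lemma smoothq_ext (f g : R -> H) : f =1 g -> smoothq f -> smoothq g.
Proof. by move=> /funext ->. Qed.

Lemma derq_ext (f g : R -> H) t : f =1 g -> derq f t = derq g t.
Proof. by move=> /funext ->. Qed.

Lemma smoothq_cst (a : H) : smoothq (fun=> a).
Proof. by split; apply: smooth_cst. Qed.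

Lemma derq_cst (a : H) t : derq (fun=> a) t = 0.
Proof. by rewrite /derq !derive1_cst. Qed.

Lemma smoothqD f g : smoothq f -> smoothq g -> smoothq (fun t => f t + g t).
Proof. move=> [f1 f2 f3 f4] [g1 g2 g3 g4]; split.
- exact: smoothD f1 g1.
- exact: smoothD f2 g2.
- exact: smoothD f3 g3.
- exact: smoothD f4 g4. Qed.

Lemma derqD f g t : smoothq f -> smoothq g ->
  derq (fun t => f t + g t) t = derq f t + derq g t.
Proof.
move=> [f1 f2 f3 f4] [g1 g2 g3 g4].
by apply: quat_eqP; split; [exact: (smooth_derive1D t f1 g1) | exact: (smooth_derive1D t f2 g2)
  | exact: (smooth_derive1D t f3 g3) | exact: (smooth_derive1D t f4 g4)].
Qed.

(** The common shape of the four components of a quaternion product, with the signs as the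
    parameters [a], [b], [c]. *)
Lemma smooth_mulB (f1 g1 f2 g2 f3 g3 f4 g4 : R -> R) (a b c : R) :
  smooth f1 -> smooth f2 -> smooth f3 -> smooth f4 ->
  smooth g1 -> smooth g2 -> smooth g3 -> smooth g4 ->
  smooth (fun t => f1 t * g1 t + a * (f2 t * g2 t) + b * (f3 t * g3 t)
                   + c * (f4 t * g4 t)).
Proof.
move=> sf1 sf2 sf3 sf4 sg1 sg2 sg3 sg4.
have sM (k : R) f g : smooth f -> smooth g -> smooth (fun t => k * (f t * g t)).
  by move=> sf sg; exact: smoothM (smooth_cst k) (smoothM sf sg).
exact: smoothD (smoothD (smoothD (smoothM sf1 sg1) (sM a _ _ sf2 sg2))
  (sM b _ _ sf3 sg3)) (sM c _ _ sf4 sg4).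
Qed.

Lemma derive1_mulB (f1 g1 f2 g2 f3 g3 f4 g4 : R -> R) (a b c : R) t :
  smooth f1 -> smooth f2 -> smooth f3 -> smooth f4 ->
  smooth g1 -> smooth g2 -> smooth g3 -> smooth g4 ->
  derive1 (fun t => f1 t * g1 t + a * (f2 t * g2 t) + b * (f3 t * g3 t)
                   + c * (f4 t * g4 t)) t =
  (derive1 f1 t * g1 t + f1 t * derive1 g1 t) +
  a * (derive1 f2 t * g2 t + f2 t * derive1 g2 t) +
  b * (derive1 f3 t * g3 t + f3 t * derive1 g3 t) +
  c * (derive1 f4 t * g4 t + f4 t * derive1 g4 t).
Proof.
move=> sf1 sf2 sf3 sf4 sg1 sg2 sg3 sg4.
have sM (k : R) f g : smooth f -> smooth g -> smooth (fun t => k * (f t * g t)).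
  by move=> sf sg; exact: smoothM (smooth_cst k) (smoothM sf sg).
have dM (k : R) f g : smooth f -> smooth g ->
    derive1 (fun t => k * (f t * g t)) t = k * (derive1 f t * g t + f t * derive1 g t).
  move=> sf sg; rewrite (smooth_derive1M t (smooth_cst k) (smoothM sf sg)).
  by rewrite derive1_cst mul0r add0r (smooth_derive1M t sf sg).
have s1 := smoothM sf1 sg1.
have s2 := smoothD s1 (sM a _ _ sf2 sg2).
have s3 := smoothD s2 (sM b _ _ sf3 sg3).
rewrite (smooth_derive1D _ s3 (sM c _ _ sf4 sg4)) (smooth_derive1D _ s2 (sM b _ _ sf3 sg3)).
by rewrite (smooth_derive1D _ s1 (sM a _ _ sf2 sg2)) (dM a _ _ sf2 sg2) (dM b _ _ sf3 sg3)
  (dM c _ _ sf4 sg4) (smooth_derive1M t sf1 sg1).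
Qed.

(* The shape of the right-hand sides is that of [smooth_mulB]. *)
Lemma mulq_comp (f g : R -> H) :
  [/\ (fun t => q1 (f t * g t)) = fun t => q1 (f t) * q1 (g t) +
        -1 * (qi (f t) * qi (g t)) + -1 * (qj (f t) * qj (g t)) +
        -1 * (qk (f t) * qk (g t)),
      (fun t => qi (f t * g t)) = fun t => q1 (f t) * qi (g t) +
        1 * (qi (f t) * q1 (g t)) + 1 * (qj (f t) * qk (g t)) +
        -1 * (qk (f t) * qj (g t)),
      (fun t => qj (f t * g t)) = fun t => q1 (f t) * qj (g t) +
        -1 * (qi (f t) * qk (g t)) + 1 * (qj (f t) * q1 (g t)) +
        1 * (qk (f t) * qi (g t)) &
      (fun t => qk (f t * g t)) = fun t => q1 (f t) * qk (g t) +
        1 * (qi (f t) * qj (g t)) + -1 * (qj (f t) * qi (g t)) +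
        1 * (qk (f t) * q1 (g t))].
Proof. by split; apply/funext => t; rewrite quatE; ring. Qed.

Lemma smoothqM f g : smoothq f -> smoothq g -> smoothq (fun t => f t * g t).
Proof.
move=> [f1 f2 f3 f4] [g1 g2 g3 g4]; have [e1 e2 e3 e4] := mulq_comp f g.
split; rewrite ?e1 ?e2 ?e3 ?e4.
- exact: (smooth_mulB f1 f2 f3 f4 g1 g2 g3 g4).
- exact: (smooth_mulB f1 f2 f3 f4 g2 g1 g4 g3).
- exact: (smooth_mulB f1 f2 f3 f4 g3 g4 g1 g2).
- exact: (smooth_mulB f1 f2 f3 f4 g4 g3 g2 g1).
Qed.

Lemma derqM f g t : smoothq f -> smoothq g ->
  derq (fun t => f t * g t) t = derq f t * g t + f t * derq g t.
Proof.
move=> [f1 f2 f3 f4] [g1 g2 g3 g4]; have [e1 e2 e3 e4] := mulq_comp f g.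
rewrite {1}/derq e1 e2 e3 e4.
rewrite (derive1_mulB _ _ _ t f1 f2 f3 f4 g1 g2 g3 g4).
rewrite (derive1_mulB _ _ _ t f1 f2 f3 f4 g2 g1 g4 g3).
rewrite (derive1_mulB _ _ _ t f1 f2 f3 f4 g3 g4 g1 g2).
rewrite (derive1_mulB _ _ _ t f1 f2 f3 f4 g4 g3 g2 g1).
rewrite /derq.
move: (derive1 (fun t => q1 (f t)) t) (derive1 (fun t => qi (f t)) t).
move: (derive1 (fun t => qj (f t)) t) (derive1 (fun t => qk (f t)) t).
move: (derive1 (fun t => q1 (g t)) t) (derive1 (fun t => qi (g t)) t).
move: (derive1 (fun t => qj (g t)) t) (derive1 (fun t => qk (g t)) t).
move: (f t) (g t) => x y *.
by apply: quat_eqP; split; rewrite /=; ring.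
Qed.

Lemma smoothq_sum (I : Type) (r : seq I) (F : I -> R -> H) :
  (forall i, smoothq (F i)) -> smoothq (fun t => \sum_(i <- r) F i t).
Proof.
move=> sF; elim: r => [|i r IHr].
  by under eq_fun do rewrite big_nil; apply: smoothq_cst.
by under eq_fun do rewrite big_cons; apply: smoothqD; [exact: sF|exact: IHr].
Qed.

Lemma derq_sum (I : Type) (r : seq I) (F : I -> R -> H) t :
  (forall i, smoothq (F i)) ->
  derq (fun t => \sum_(i <- r) F i t) t = \sum_(i <- r) derq (F i) t.
Proof.
move=> sF; elim: r => [|i r IHr].
  by under eq_fun do rewrite big_nil; rewrite derq_cst big_nil.
under eq_fun do rewrite big_cons; rewrite big_cons -IHr derqD //.
by apply: smoothq_sum.
Qed.

Lemma smoothq_conj f : smoothq f -> smoothq (fun t => conjq (f t)).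
Proof.
move=> [f1 fi fj fk]; split; [exact: f1|exact: smoothN fi|exact: smoothN fj|].
exact: smoothN fk.
Qed.

Lemma derq_conj f t : smoothq f -> derq (fun t => conjq (f t)) t = conjq (derq f t).
Proof.
move=> [s1 si sj sk].
by apply: quat_eqP; split; [by [] | exact: (smooth_derive1N t si)
  | exact: (smooth_derive1N t sj) | exact: (smooth_derive1N t sk)].
Qed.

Lemma smoothq_real (f : R -> R) : smooth f -> smoothq (fun t => real_quat (f t)).
Proof. by move=> sf; split; [exact: sf|exact: smooth_cst..]. Qed.

Lemma derq_real (f : R -> R) t :
  derq (fun t => real_quat (f t)) t = real_quat (derive1 f t).
Proof. by rewrite /derq /= !derive1_cst. Qed.

Variable n : nat.
Implicit Types g h : R -> 'M[H]_n.

Lemma velocityE g t i j : velocity g t i j = derq (fun t => g t i j) t.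
Proof. by rewrite mxE. Qed.

Lemma smooth_curve_cst (X : 'M[H]_n) : smooth_curve (fun=> X).
Proof. by move=> i j; apply: smoothq_cst. Qed.

Lemma velocity_cst (X : 'M[H]_n) t : velocity (fun=> X) t = 0.
Proof. by apply/matrixP => i j; rewrite velocityE derq_cst mxE. Qed.

Lemma smooth_curveD g h : smooth_curve g -> smooth_curve h ->
  smooth_curve (fun t => g t + h t).
Proof.
move=> sg sh i j; apply: smoothq_ext (smoothqD (sg i j) (sh i j)) => t.
by rewrite mxE.
Qed.

Lemma velocityD g h t : smooth_curve g -> smooth_curve h ->
  velocity (fun t => g t + h t) t = velocity g t + velocity h t.
Proof.
move=> sg sh; apply/matrixP => i j; rewrite velocityE [RHS]mxE !velocityE -derqD //.
by apply: derq_ext => u; rewrite mxE.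
Qed.

Lemma smooth_curveM g h : smooth_curve g -> smooth_curve h ->
  smooth_curve (fun t => g t *m h t).
Proof.
move=> sg sh i j.
apply: smoothq_ext (@smoothq_sum _ (index_enum 'I_n) _
  (fun k => smoothqM (sg i k) (sh k j))) => t.
by rewrite mxE.
Qed.

Lemma velocityM g h t : smooth_curve g -> smooth_curve h ->
  velocity (fun t => g t *m h t) t = velocity g t *m h t + g t *m velocity h t.
Proof.
move=> sg sh; apply/matrixP => i j; rewrite velocityE [RHS]mxE.
rewrite [X in X + _]mxE [X in _ + X]mxE.
transitivity (derq (fun t => \sum_k g t i k * h t k j) t).
  by apply: derq_ext => u; rewrite mxE.
rewrite derq_sum => [|k]; last exact: smoothqM.
rewrite -big_split; apply: eq_bigr => k _.
by rewrite /= !velocityE; exact: derqM.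
Qed.

Lemma smooth_curve_adj g : smooth_curve g -> smooth_curve (fun t => adj (g t)).
Proof.
move=> sg i j; apply: smoothq_ext (smoothq_conj (sg j i)) => t.
by rewrite adjE.
Qed.

Lemma velocity_adj g t : smooth_curve g ->
  velocity (fun t => adj (g t)) t = adj (velocity g t).
Proof.
move=> sg; apply/matrixP => i j; rewrite adjE !velocityE -derq_conj //.
by apply: derq_ext => u; rewrite adjE.
Qed.

Lemma smooth_curveZ (f : R -> R) (X : 'M[H]_n) : smooth f ->
  smooth_curve (fun t => real_quat (f t) *: X).
Proof.
move=> sf i j.
apply: smoothq_ext (smoothqM (smoothq_real sf) (smoothq_cst (X i j))) => t.
by rewrite mxE.
Qed.

Lemma velocityZ (f : R -> R) (X : 'M[H]_n) t : smooth f ->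
  velocity (fun t => real_quat (f t) *: X) t = real_quat (derive1 f t) *: X.
Proof.
move=> sf; apply/matrixP => i j; rewrite velocityE mxE.
transitivity (derq (fun t => real_quat (f t) * X i j) t).
  by apply: derq_ext => u; rewrite mxE.
rewrite (derqM t (smoothq_real sf) (smoothq_cst _)) derq_cst mulr0 addr0.
by rewrite derq_real.
Qed.

Lemma velocity_q1_tr g t : smooth_curve g ->
  derive1 (fun t => q1 (\tr (g t))) t = q1 (\tr (velocity g t)).
Proof.
move=> sg; transitivity (q1 (derq (fun t => \tr (g t)) t)); first by [].
congr q1; rewrite /mxtrace derq_sum => [|i]; last exact: sg.
by apply: eq_bigr => i _; rewrite velocityE.
Qed.

(* If [F^3 = - c^2 F] then [1 + sin (c t) / c F + (1 - cos (c t)) / c^2 F^2]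
   is [exp (t F)]. *)
Lemma exp_curve (F : 'M[H]_n) (c : R) : c != 0 -> adj F = - F ->
  F *m F *m F = - (real_quat (c ^+ 2) *: F) ->
  exists a b : R -> R, let g t :=
      1%:M + real_quat (a t) *: F + real_quat (b t) *: (F *m F) in
    [/\ smooth_curve g, g 0 = 1%:M, velocity g 0 = F &
        forall t, g t *m adj (g t) = 1%:M /\ adj (g t) *m g t = 1%:M].
Proof.
move=> c0 aF F3.
pose a t := c^-1 * sin (c * t) + 0 * cos (c * t).
pose b t := c^-2 + (0 * sin (c * t) + - c^-2 * cos (c * t)).
exists a, b => g.
have sa : smooth a by apply: smooth_trig.
have sb : smooth b by apply: smoothD; [exact: smooth_cst|exact: smooth_trig].
have da : derive1 a 0 = 1.
  by rewrite derive1_trig !mulr0 sin0 cos0 !mulr0 mulr1 add0r divff.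
have db : derive1 b 0 = 0.
  rewrite (smooth_derive1D 0 (smooth_cst _) (smooth_trig 0 (- c^-2) c)).
  by rewrite derive1_cst derive1_trig !mulr0 sin0 !mulr0 !mul0r !addr0.
have s1 : smooth_curve (fun t => 1%:M + real_quat (a t) *: F).
  by apply: smooth_curveD; [exact: smooth_curve_cst|exact: smooth_curveZ].
have sF2 : smooth_curve (fun t => real_quat (b t) *: (F *m F)) by exact: smooth_curveZ.
split.
- by apply: smooth_curveD.
- rewrite /g /a /b mulr0 sin0 cos0 !mulr0 !mul0r !addr0 add0r mulr1 subrr.
  by rewrite rmorph0 !scale0r !addr0.
- have sI : smooth_curve (fun=> 1%:M : 'M[H]_n) by exact: smooth_curve_cst.
  rewrite (velocityD 0 s1 sF2) (velocityD 0 sI (smooth_curveZ F sa)).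
  rewrite velocity_cst add0r (velocityZ _ _ sa) (velocityZ _ _ sb) da db.
  by rewrite rmorph0 scale0r addr0 rmorph1 scale1r.
move=> t.
have adjg : adj (g t) = 1%:M - real_quat (a t) *: F + real_quat (b t) *: (F *m F).
  rewrite /g !adjD adj1 !adj_scaleq adjM aF mulmxN mulNmx opprK.
  by rewrite scalerN.
have F4 : F *m F *m (F *m F) = - (real_quat (c ^+ 2) *: (F *m F)).
  by rewrite mulmxA F3 mulNmx -scalemxAl.
(* [g = U + V] with hermitian [U = 1 + b F^2] and skew-hermitian [V = a F] that commute, so both
   products equal [U^2 - V^2]. This is [1] plus [2 b - b^2 c^2 - a^2] times [F^2]. *)
have [e1 e2] : g t *m adj (g t) =
    (1%:M + real_quat (b t) *: (F *m F)) *m (1%:M + real_quat (b t) *: (F *m F))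
    - real_quat (a t) *: F *m (real_quat (a t) *: F) /\
    adj (g t) *m g t = g t *m adj (g t).
  have cFF : (1%:M + real_quat (b t) *: (F *m F)) *m (real_quat (a t) *: F) =
     (real_quat (a t) *: F) *m (1%:M + real_quat (b t) *: (F *m F)).
    rewrite mulmxDl mulmxDr mul1mx mulmx1 -!scalemxAl !scaleq_mull !mulmxA.
    by rewrite !scalerA real_quatC.
  rewrite adjg /g [1%:M + real_quat (a t) *: F + _]addrAC.
  rewrite [1%:M - real_quat (a t) *: F + _]addrAC.
  move: (1%:M + real_quat (b t) *: (F *m F)) cFF => U.
  move: (real_quat (a t) *: F) => V UV.
  have E : (U + V) *m (U - V) = U *m U - V *m V.
    by rewrite mulmxBr !mulmxDl UV opprD addrA addrK.
  split; first exact: E.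
  by rewrite E mulmxBl !mulmxDr UV opprD addrA addrK.
suff e3 : g t *m adj (g t) = 1%:M by rewrite e2.
rewrite e1 mulmxDl !mulmxDr !mul1mx !mulmx1 -!scalemxAl !scaleq_mull F4.
rewrite !scalerN !scalerA -!rmorphM /=.
set Q := F *m F.
have rqB (x y : R) : real_quat (x - y) = real_quat x - real_quat y by exact: raddfB.
have rqD (x y : R) : real_quat (x + y) = real_quat x + real_quat y by exact: raddfD.
rewrite -addrA -addrA -!scalerBl -!rqB -scalerDl -rqD addrA.
have -> : b t + (b t - b t * b t * c ^+ 2) - a t * a t = 0.
  rewrite /a /b; have := cos2Dsin2 (c * t).
  set S := sin _; set K := cos _ => SK.
  have -> : c^-2 + (0 * S + - c^-2 * K) = c^-2 * (1 - K) by ring.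
  have -> : c^-1 * S + 0 * K = c^-1 * S by ring.
  have -> : c^-1 * S * (c^-1 * S) = c^-2 * (1 - K ^+ 2).
    by rewrite -SK; field.
  by field.
by rewrite rmorph0 scale0r addr0.
Qed.

End Curves.

#[global] Opaque smooth_curve.

(** * Curves in block unitary groups with prescribed velocity *)

Section KCurves.
Variables (R : realType) (n : nat).
Local Notation H := (quat R).
Local Notation C := (R[i]).
Implicit Types (r : rel 'I_n) (X F : 'M[C]_n).

Lemma iotaZ m p (z : C) (A : 'M[C]_(m, p)) :
  iota (z *: A) = complex_quat z *: iota A.
Proof. by apply/matrixP => i j; rewrite !mxqE rmorphM. Qed.

Definition Kcurve r X := exists g : R -> 'M[C]_n,
  [/\ smooth_curve (fun t => iota (g t)), forall t, Kgrp r (g t), g 0 = 1%:M &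
      velocity (fun t => iota (g t)) 0 = iota X].

Lemma Kcurve0 r : Kcurve r 0.
Proof.
exists (fun=> 1%:M); split=> //; first exact: smooth_curve_cst.
  by move=> _; apply: Kgrp1.
by rewrite velocity_cst iota0.
Qed.

(** The product of two curves through [1] has the sum of their velocities there. *)
Lemma KcurveD r X Y : transitive r -> Kcurve r X -> Kcurve r Y -> Kcurve r (X + Y).
Proof.
move=> tr [g [sg Kg g0 vg]] [h [sh Kh h0 vh]].
have E : (fun t => iota (g t *m h t)) = fun t => iota (g t) *m iota (h t).
  by apply/funext => t; rewrite iotaM.
exists (fun t => g t *m h t); rewrite E; split.
- exact: smooth_curveM sg sh.
- by move=> t; apply: KgrpM.
- by rewrite g0 h0 mulmx1.
- by rewrite (velocityM _ sg sh) vg vh g0 h0 iota1 mulmx1 mul1mx iotaD.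
Qed.

Lemma Kcurve_exp r F (c : R) : transitive r -> supp r F -> F ^t* = - F ->
  F *m F *m F = - ((c ^+ 2)%:C%C *: F) -> Kcurve r F.
Proof.
move=> tr sF aF F3; have [c0|c0] := eqVneq c 0.
  (* Here [F^3 = 0]; a skew-hermitian matrix with this property is zero, as first [F^2] and then [F]
     has vanishing norm. *)
  suff -> : F = 0 by apply: Kcurve0.
  have F30 : F *m F *m F = 0 by rewrite F3 c0 expr0n /= scale0r oppr0.
  have sq0 (X : 'M[C]_n) : X ^t* *m X = 0 -> X = 0.
    move=> X0; apply: (@iota_inj R); rewrite iota0; apply: q1_tr_adj_eq0.
    by rewrite adj_iota -iotaM X0 iota0 mxtrace0.
  apply: (sq0); rewrite aF mulNmx; apply/eqP; rewrite oppr_eq0; apply/eqP.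
  by apply: sq0; rewrite tmxCM aF !(mulmxN, mulNmx) !opprK mulmxA F30 mul0mx.
have [||a [b [sg g0 vg ug]]] := @exp_curve R n (iota F) c c0.
- by rewrite adj_iota aF iotaN.
- by rewrite -!iotaM F3 iotaN iotaZ.
pose g t : 'M[C]_n := 1%:M + (a t)%:C%C *: F + (b t)%:C%C *: (F *m F).
have gE : (fun t => iota (g t)) = fun t => 1%:M + real_quat (a t) *: iota F +
    real_quat (b t) *: (iota F *m iota F).
  by apply/funext => t; rewrite /g !iotaD iota1 !iotaZ iotaM.
exists g; rewrite gE; split=> //.
  move=> t; split.
    apply/unitarymxP; apply: (@iota_inj R); rewrite iotaM -adj_iota iota1.
    by have [+ _] := ug t; rewrite -[X in X *m adj X](congr1 (@^~ t) gE).
  rewrite /g addrAC [1%:M + _]addrC addrK.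
  apply: suppD => i j rij; rewrite mxE ?sF ?mulr0 //.
  by rewrite (suppM tr sF sF) ?mulr0.
apply: (@iota_inj R); rewrite iota1 -g0.
by have := congr1 (@^~ 0) gE.
Qed.

(* [X] is half the sum of the [X_ij E_ij - conj X_ij E_ji]. *)
Lemma Kcurve_skew r X : symmetric r -> transitive r -> supp r X -> X ^t* = - X ->
  Kcurve r X.
Proof.
move=> sr tr sX aX.
pose F (z : C) i j : 'M[C]_n := z *: delta_mx i j - z^* *: delta_mx j i.
have dJ i j : (delta_mx i j : 'M[C]_n) ^t* = delta_mx j i.
  by rewrite trmx_delta map_delta_mx.
have FJ z i j : (F z i j) ^t* = - F z i j.
  by rewrite /F tmxCB !tmxCZ conjCK !dJ opprB.
have normE (z : C) : exists c : R, (c ^+ 2)%:C%C = z * z^*.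
  exists (Num.sqrt (complex.Re z ^+ 2 + complex.Im z ^+ 2)).
  by rewrite sqr_sqrtr ?addr_ge0 ?sqr_ge0 // add_Re2_Im2 normCK.
(* These elementary matrices satisfy the cubic relation of [Kcurve_exp]: [c] is the modulus of [z]
   off the diagonal, and that of [z - z^*] on it. *)
have KF z i j : r i j -> Kcurve r (F z i j).
  move=> rij; have sF : supp r (F z i j).
    move=> k l rkl; rewrite !mxqE.
    have [/andP[/eqP ki /eqP lj]|_] := boolP ((k == i) && (l == j)).
      by rewrite ki lj rij in rkl.
    have [/andP[/eqP kj /eqP li]|_] := boolP ((k == j) && (l == i)).
      by rewrite kj li sr rij in rkl.
    by rewrite !mulr0 subr0.
  have [ij|ij] := eqVneq i j.
    have [c cE] := normE (z - z^*).
    apply: (@Kcurve_exp _ _ c) => //.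
    have -> : F z i j = (z - z^*) *: delta_mx j j by rewrite /F ij -scalerBl.
    rewrite -!scalemxAr -!scalemxAl !mul_delta_mx !scalerA cE rmorphB /= conjCK.
    by rewrite -scaleNr; congr (_ *: _); rewrite /=; ring.
  have [c cE] := normE z.
  apply: (@Kcurve_exp _ _ c) => //.
  have F2 : F z i j *m F z i j =
      - (z * z^*) *: (delta_mx i i + delta_mx j j).
    rewrite /F mulmxBl !mulmxBr -!scalemxAl -!scalemxAr !mul_delta_mx.
    rewrite !mul_delta_mx_0 // 1?eq_sym // !scaler0 !scalerA sub0r subr0.
    by rewrite [z^* * z]mulrC -opprD -scalerDr scaleNr.
  rewrite F2 cE scaleNr mulNmx -scalemxAl; congr (- (_ *: _)).
  rewrite /F mulmxDl !mulmxBr -!scalemxAr !mul_delta_mx.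
  by rewrite !mul_delta_mx_0 // 1?eq_sym // !scaler0 subr0 sub0r.
have -> : X = \sum_i \sum_j F (2^-1 * X i j) i j.
  under eq_bigr do rewrite sumrB; rewrite sumrB [X in _ - X]exchange_big /=.
  have -> : \sum_i \sum_j (2^-1 * X i j) *: delta_mx i j = 2^-1 *: X.
    rewrite [in RHS](matrix_sum_delta X) scaler_sumr; apply: eq_bigr => i _.
    by rewrite scaler_sumr; apply: eq_bigr => j _; rewrite scalerA.
  have -> : \sum_j \sum_i (2^-1 * X i j)^* *: delta_mx j i = 2^-1 *: X ^t*.
    rewrite [in RHS](matrix_sum_delta (X ^t*)) scaler_sumr; apply: eq_bigr => i _.
    rewrite scaler_sumr; apply: eq_bigr => j _; rewrite scalerA tmxCE rmorphM.
    by rewrite fmorphV /= conjC_nat.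
  by rewrite aX scalerN opprK -scalerDl -{1 2}[2^-1]mul1r -splitr scale1r.
have KS (I : Type) (s : seq I) (G : I -> 'M[C]_n) :
    (forall i, Kcurve r (G i)) -> Kcurve r (\sum_(i <- s) G i).
  move=> KG; elim/big_ind: _ => //; first exact: Kcurve0.
  by move=> A B; apply: KcurveD.
apply: (KS) => i; apply: (KS) => j; have [/KF//|/sX ->] := boolP (r i j).
by rewrite mulr0 /F rmorph0 !scale0r subr0; apply: Kcurve0.
Qed.

End KCurves.

(** * Dimensions and ranks *)

Section Dimension.
Variables (R : realType) (n : nat).
Local Notation H := (quat R).
Local Notation C := (R[i]).

(** The coordinates of one basis in the other form a row free matrix. This makes [dim] independent
    of the basis. *)
Lemma has_dim_leq (S : set 'M[H]_n) d d' : has_dim S d -> has_dim S d' -> (d <= d')%N.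
Proof.
move=> [e [fe Se]] [e' [_ Se']].
have eS i : S (e i).
  rewrite Se; exists (fun j => (j == i)%:R) => //.
  rewrite (bigD1 i) //= big1 => [|j /negbTE->]; rewrite scaleqE ?eqxx.
    by rewrite rmorph1 scale1r addr0.
  by rewrite rmorph0 scale0r.
have /choice[A eA] i : exists a : 'I_d' -> R, e i = \sum_j scaleq (a j) (e' j).
  by have := eS i; rewrite Se' => -[a _ <-]; exists a.
pose M : 'M[R]_(d, d') := \matrix_(i, j) A i j.
suff : row_free M by move=> /eqP <-; exact: rank_leq_col.
apply: inj_row_free => u uM.
have u0 : \sum_i scaleq (u 0 i) (e i) = 0.
  transitivity (\sum_j scaleq ((u *m M) 0 j) (e' j)); last first.
    by rewrite uM big1 // => j _; rewrite mxE scaleqE rmorph0 scale0r.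
  under eq_bigr do rewrite eA scaleqE scaler_sumr.
  rewrite exchange_big; apply: eq_bigr => j _; rewrite mxE scaleqE rmorph_sum.
  rewrite scaler_suml; apply: eq_bigr => i _.
  by rewrite scaleqE scalerA mxE rmorphM.
by apply/rowP => i; rewrite (fe (fun i => u 0 i)) // mxE.
Qed.

Lemma dimE (S : set 'M[H]_n) d : has_dim S d -> dim S = d.
Proof.
move=> Sd; have Sd' : has_dim S (dim S).
  by apply: (@xgetPex _ 0%N [set d | has_dim S d]); exists d.
by apply/eqP; rewrite eqn_leq !(@has_dim_leq S).
Qed.

Lemma has_dim_lin (S : set 'M[H]_n) d (L : 'rV[R]_d -> 'M[H]_n) :
  (forall a b, L (a + b) = L a + L b) ->
  (forall k a, L (k *: a) = real_quat k *: L a) ->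
  (forall a, L a = 0 -> a = 0) -> S = range L -> has_dim S d.
Proof.
move=> LD LZ L0 SL.
have L00 : L 0 = 0 by rewrite -(scale0r 0) LZ rmorph0 scale0r.
have LS c : \sum_i scaleq (c i) (L (delta_mx 0 i)) = L (\row_i c i).
  rewrite [\row_i c i]row_sum_delta (big_morph L LD L00).
  by apply: eq_bigr => i _; rewrite LZ mxE.
exists (fun i => L (delta_mx 0 i)); split=> [c|].
  by rewrite LS => /L0 /rowP c0 i; have := c0 i; rewrite !mxqE.
rewrite SL; apply/seteqP; split=> [_ [a _ <-]|_ [c _ <-]].
  exists (fun i => a 0 i) => //; rewrite LS; congr L.
  by apply/rowP => i; rewrite mxE.
by exists (\row_i c i) => //; rewrite LS.
Qed.

(* A skew-hermitian matrix is determined by the real parts above the diagonal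
   and the imaginary parts on and below it. *)
Lemma skew_coord (s : rel 'I_n) : symmetric s ->
  exists L : 'rV[R]_(cardr s) -> 'M[C]_n,
  [/\ forall a b, L (a + b) = L a + L b,
      forall k a, L (k *: a) = k%:C%C *: L a,
      forall a, L a = 0 -> a = 0 &
      forall X, supp s X /\ X ^t* = - X <-> exists a, X = L a].
Proof.
move=> ss; pose I := {p : 'I_n * 'I_n | s p.1 p.2}.
have <- : #|{: I}| = cardr s by rewrite card_sig.
pose G (a : 'rV[R]_#|{: I}|) (i j : 'I_n) : R :=
  if (insub (i, j) : option I) is Some q then a 0 (enum_rank q) else 0.
have GD a b i j : G (a + b) i j = G a i j + G b i j.
  by rewrite /G; case: insub => [q|]; rewrite ?mxE ?addr0.
have GZ k a i j : G (k *: a) i j = k * G a i j.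
  by rewrite /G; case: insub => [q|]; rewrite ?mxE ?mulr0.
have G0 a i j : ~~ s i j -> G a i j = 0.
  by move=> /negbTE sij; rewrite /G insubF.
pose L a : 'M[C]_n := \matrix_(i, j)
  (if (i < j)%N then (G a i j +i* G a j i)%C
   else if (j < i)%N then (- G a j i +i* G a i j)%C else (0 +i* G a i j)%C).
exists L; split.
- move=> a b; apply/matrixP => i j; rewrite !mxqE !GD.
  by case: ifP => _; [|case: ifP => _]; apply/eqP; rewrite eq_complex /= ?opprD ?addr0 ?eqxx.
- move=> k a; apply/matrixP => i j; rewrite !mxqE !GZ.
  by case: ifP => _; [|case: ifP => _]; apply/eqP; rewrite eq_complex /=;
    apply/andP; split; apply/eqP; ring.
- move=> a La0; suff Ga0 i j : G a i j = 0.
    apply/rowP => k; rewrite mxE; have := Ga0 (val (enum_val k)).1 (val (enum_val k)).2.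
    by rewrite /G -surjective_pairing valK enum_valK.
  have /matrixP/(_ j i)/eqP := La0; have /matrixP/(_ i j)/eqP := La0; rewrite !mxqE.
  case: (ltngtP i j) => _; rewrite eq_complex /=.
  - by move=> /andP[/eqP].
  - by move=> /andP[_ /eqP].
  - by rewrite eqxx => /eqP.
move=> X; split=> [[sX aX]|[a ->]].
  pose a : 'rV[R]_#|{: I}| := \row_(k < #|{: I}|) (let p := sval (enum_val k : I) in
    if (p.1 < p.2)%N then complex.Re (X p.1 p.2) else complex.Im (X p.1 p.2)).
  have GE i j : G a i j = if (i < j)%N then complex.Re (X i j) else complex.Im (X i j).
    have [sij|sij] := boolP (s i j); last by rewrite G0 // sX //; case: ifP.
    by rewrite /G (@insubT _ (fun p : 'I_n * 'I_n => s p.1 p.2) I (i, j) sij) mxE enum_rankK.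
  exists a; apply/matrixP => i j; rewrite mxE !GE.
  have : X j i = - (X i j)^* by have /matrixP/(_ j i) := aX; rewrite tmxCE mxE => ->; rewrite opprK.
  case: (ltngtP i j) => [_|_|/val_inj ->].
  - by case: (X i j) => x y ->; rewrite /= opprK.
  - by case: (X i j) => x y -> /=; rewrite !opprK.
  case: (X j j) => x y [/= xE _]; congr (_ +i* _)%C.
  by lra.
split.
  move=> i j sij; have sji : ~~ s j i by rewrite ss.
  by rewrite mxE !G0 // oppr0; case: ifP => // _; case: ifP.
apply/matrixP => i j; rewrite tmxCE !mxqE.
case: (ltngtP i j) => [_|_|/val_inj ->]; apply/eqP; rewrite eq_complex /=.
- by rewrite !eqxx.
- by rewrite opprK !eqxx.
- by rewrite oppr0 !eqxx.
Qed.

End Dimension.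

(** * The circle as the quotient of the line by the integers *)

Section CircleMap.
Variable R : realType.
Local Notation C := (R[i]).
Implicit Types (x y : R).

Definition circ x : C := (cos (pi *+ 2 * x) +i* sin (pi *+ 2 * x))%C.

Lemma circD x y : circ (x + y) = circ x * circ y.
Proof.
apply/eqP; rewrite eq_complex /= mulrDr cosD sinD eqxx /=.
by rewrite addrC [sin _ * _]mulrC eqxx.
Qed.

Lemma circ0 : circ 0 = 1.
Proof. by rewrite /circ mulr0 cos0 sin0. Qed.

Lemma circ_unit x : circ x * (circ x)^* = 1.
Proof.
apply/eqP; rewrite eq_complex /= !mulrN opprK -!expr2 cos2Dsin2 eqxx /=.
by rewrite mulrC addNr.
Qed.

Lemma circ1 : circ 1 = 1.
Proof. by rewrite /circ mulr1 cos2pi sin2pi. Qed.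

Lemma circN x : circ (- x) * circ x = 1.
Proof. by rewrite -circD addNr circ0. Qed.

Lemma circ_int (z : int) : circ z%:~R = 1.
Proof.
have nat m : circ m%:R = 1.
  by elim: m => [|m IHm]; rewrite ?circ0 // -addn1 natrD circD IHm circ1 mulr1.
case: z => m; first exact: nat.
by have := circN m.+1%:R; rewrite nat mulr1 NegzE mulrNz.
Qed.

(** For the fractional part [y] of [x], [cos (2 pi y) = 1] forces [sin (pi y) = 0], whereas this
    sine is positive for [0 < y < 1]. *)
Lemma circ_eq1 x : circ x = 1 <-> exists z : int, x = z%:~R.
Proof.
split=> [cx|[z ->]]; last exact: circ_int.
exists (Num.floor x); pose y := x - (Num.floor x)%:~R.
have cy : circ y = 1.
  by have := cx; rewrite -{1}(subrK (Num.floor x)%:~R x) circD circ_int mulr1.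
have y0 : 0 <= y by rewrite subr_ge0 floor_le_tmp.
have y1 : y < 1 by rewrite ltrBlDl -intrD1 floorD1_gt.
apply/eqP; rewrite -subr_eq0 -/y; apply/eqP.
move: cy => /eqP; rewrite eq_complex /= => /andP[/eqP cy _].
have sy : sin (pi * y) = 0.
  move: cy; rewrite mulrnAl cos_mulr2n cos2sin2 => sy; apply/eqP.
  by rewrite -sqrf_eq0; apply/eqP; lra.
have [//|yN0] := eqVneq y 0.
suff : 0 < sin (pi * y) by rewrite sy ltxx.
apply: sin_gt0_pi.
apply/andP; split; first by rewrite mulr_gt0 ?pi_gt0 // lt_def yN0.
by rewrite -[ltRHS]mulr1 ltr_pM2l ?pi_gt0.
Qed.

Lemma circ_surj (z : C) : z * z^* = 1 -> exists x, circ x = z.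
Proof.
case: z => c s /eqP; rewrite eq_complex /= => /andP[/eqP cs _].
have cs2 : c ^+ 2 + s ^+ 2 = 1 by rewrite -cs; ring.
have c1 : -1 <= c <= 1.
  by have := sqr_ge0 s => s0; apply/andP; split; nra.
have pi2 : (pi : R) *+ 2 != 0 by rewrite mulrn_eq0 /= gt_eqF // pi_gt0.
have sa : sin (acos c) = `|s|.
  by rewrite sin_acos // -sqrtr_sqr; congr Num.sqrt; rewrite -cs2; ring.
have [s0|s0] := leP 0 s.
  exists (acos c / (pi *+ 2)); rewrite /circ mulrC divfK //.
  by rewrite acosK ?in_itv // sa ger0_norm.
exists (- acos c / (pi *+ 2)); rewrite /circ mulrC divfK //.
by rewrite cosN sinN acosK ?in_itv // sa ltr0_norm // opprK.
Qed.

End CircleMap.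

(** * Uniqueness of the dimension of a torus *)

Section TorusDim.
Variables (R : realType) (n : nat).
Local Notation H := (quat R).

(* The elements of order two of a torus of dimension [r] correspond to
   [{0, 1/2}^r], so their number determines [r]. *)
Lemma torus_dim_leq r r' (T : set 'M[H]_n) : is_torus r T -> is_torus r' T ->
  (r <= r')%N.
Proof.
move=> [f [_ fM f1 Tf]] [f' [_ fM' f1' Tf']].
pose h m (e : {ffun 'I_m -> bool}) : 'rV[R]_m := \row_j ((e j)%:R / 2).
have h2 m (e : {ffun 'I_m -> bool}) j : (h m e + h m e) 0 j = (e j)%:R.
  by rewrite !mxE -splitr.
have sub m (g : 'rV[R]_m -> 'M[H]_n) : (forall x y, g (x + y) = g x *m g y) ->
    (forall x, g x = 1%:M <-> forall j, exists z : int, x 0 j = z%:~R) ->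
    forall x y, g x = g y -> forall j, exists z : int, (x - y) 0 j = z%:~R.
  move=> gM g1 x y gxy; apply/g1.
  have -> : g (x - y) = g y *m g (- y) by rewrite gM gxy.
  by rewrite -gM subrr; apply/g1 => j; exists 0; rewrite mxE.
have /choice[k kP] (e : {ffun 'I_r -> bool}) :
    exists e' : {ffun 'I_r' -> bool}, f (h _ e) = f' (h _ e').
  have : T (f (h _ e)) by rewrite Tf; exists (h _ e).
  rewrite Tf' => -[x _ fx].
  have fxx : f' (x + x) = 1%:M.
    rewrite fM' fx -fM; apply/f1 => j; rewrite h2.
    by exists (e j)%:Z; rewrite pmulrn.
  have /choice[z zP] := (f1' _).1 fxx.
  (* [z] is [2 x], so [x] differs from half the parity of [z] by integers. *)
  pose e' : {ffun 'I_r' -> bool} := [ffun j => (z j %% 2)%Z == 1].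
  exists e'; rewrite -fx -[x in LHS](subrK (h _ e')) fM'.
  rewrite (_ : f' (x - _) = 1%:M) ?mul1mx //; apply/f1' => j.
  rewrite !mxE ffunE; exists (z j %/ 2)%Z.
  have zE : z j = (z j %/ 2)%Z * 2 + ((z j %% 2)%Z == 1)%:Z by lia.
  have x2 : x 0 j = (z j)%:~R / 2.
    by have := zP j; rewrite mxE => <-; rewrite mulrDl -splitr.
  rewrite x2 {1}zE rmorphD rmorphM /= mulrDl mulfK // addrK //.
have kI : injective k.
  move=> e1 e2 k12; apply/ffunP => j.
  have fe : f (h _ e1) = f (h _ e2) by rewrite !kP k12.
  have [z] := sub _ _ fM f1 _ _ fe j; rewrite !mxE -mulrBl => ez.
  have {}ez : (e1 j)%:R - (e2 j)%:R = z%:~R * 2 :> R by rewrite -ez divfK.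
  have : ((e1 j)%:Z - (e2 j)%:Z) = z * 2.
    by apply: (@intr_inj R); rewrite rmorphB rmorphM /= -ez.
  by case: (e1 j); case: (e2 j) => //=; lia.
have := leq_card k kI; rewrite !card_ffun card_bool !card_ord.
by rewrite leq_exp2l.
Qed.

Lemma torus_dim_uniq r r' (T : set 'M[H]_n) : is_torus r T -> is_torus r' T ->
  r = r'.
Proof. by move=> tr tr'; apply/eqP; rewrite eqn_leq !(@torus_dim_leq _ _ T). Qed.

End TorusDim.

(** * Maximal tori of block unitary groups *)

Section Rank.
Variables (R : realType) (n : nat).
Local Notation H := (quat R).
Local Notation C := (R[i]).
Variables (r : rel 'I_n).
Hypotheses (rs : symmetric r) (rt : transitive r).

Definition diag_torus (A : 'M[C]_n) : set 'M[H]_n :=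
  [set iota (A *m D *m A ^t*) | D in [set D | Kgrp r D /\ is_diag_mx D]].

(** The coordinates counted are those not fixed by definition in [Kgrp r]; each gives a circle, so
    this is the rank of that group. *)
Definition dsize := #|{: {i : 'I_n | r i i}}|.

(** The default value [1] reflects that [Kgrp r] fixes the remaining coordinates. *)
Definition circ_row (x : 'rV[R]_dsize) (i : 'I_n) : C :=
  if (insub i : option {i : 'I_n | r i i}) is Some q
  then circ (x 0 (enum_rank q)) else 1.

Lemma circ_rowD x y i : circ_row (x + y) i = circ_row x i * circ_row y i.
Proof. by rewrite /circ_row; case: insub => [q|]; rewrite ?mulr1 // mxE circD. Qed.

Lemma continuous_comp2 m (f : 'rV[R]_m -> R) (g : R -> R) :
  continuous f -> continuous g -> continuous (fun x => g (f x)).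
Proof.
by move=> cf cg x; apply: (@continuous_comp _ _ _ f g x); [exact: cf|exact: cg].
Qed.

Lemma continuous_sum_lin2 m (I : Type) (s : seq I) (a b : I -> R)
    (f g : I -> 'rV[R]_m -> R) :
  (forall i, continuous (f i)) -> (forall i, continuous (g i)) ->
  continuous (fun x => \sum_(i <- s) (a i * f i x + b i * g i x)).
Proof.
move=> cf cg; elim: s => [|i s IHs].
  by under eq_fun do rewrite big_nil; exact: cst_continuous.
under eq_fun do rewrite big_cons.
move=> x; apply: (@continuousD _ _ _ (fun x => a i * f i x + b i * g i x)); last exact: IHs.
apply: (@continuousD _ _ _ (fun x => a i * f i x) (fun x => b i * g i x)).
  exact: (continuous_comp2 (cf i) (@mulrl_continuous _ (a i))).
exact: (continuous_comp2 (cg i) (@mulrl_continuous _ (b i))).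
Qed.

Lemma continuous_circ_row i :
  continuous (fun x => complex.Re (circ_row x i)) /\
  continuous (fun x => complex.Im (circ_row x i)).
Proof.
rewrite /circ_row; case: insub => [q|]; last by split; exact: cst_continuous.
have cx : continuous (fun x : 'rV[R]_dsize => pi *+ 2 * x 0 (enum_rank q)).
  exact: (continuous_comp2 (@coord_continuous _ _ _ _ _) (@mulrl_continuous _ _)).
split=> /=.
  exact: continuous_comp2 cx (@continuous_cos R).
exact: continuous_comp2 cx (@continuous_sin R).
Qed.

Lemma is_torus_diag (A : 'M[C]_n) : A *m A ^t* = 1%:M -> is_torus dsize (diag_torus A).
Proof.
move=> AA; have AA' := mulmx1C AA.
pose f x : 'M[C]_n := A *m diag_mx (\row_i circ_row x i) *m A ^t*.
exists (fun x => iota (f x)).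
have fE x i j : f x i j = \sum_k A i k * (A j k)^* * circ_row x k.
  rewrite /f -mulmxA mxE; apply: eq_bigr => k _; rewrite mul_diag_mx !mxqE.
  by rewrite mulrA mulrAC.
split.
- move=> i j; split.
  + rewrite (_ : (fun _ => _) = fun x => \sum_k
      (complex.Re (A i k * (A j k)^*) * complex.Re (circ_row x k) +
       - complex.Im (A i k * (A j k)^*) * complex.Im (circ_row x k))); last first.
      apply/funext => x; rewrite iotaE fE /= raddf_sum; apply: eq_bigr => k _.
      by case: (A i k * _) (circ_row x k) => a b [c d] /=; rewrite mulNr.
    by apply: continuous_sum_lin2 => k; have [] := continuous_circ_row k.
  + rewrite (_ : (fun _ => _) = fun x => \sum_k
      (complex.Re (A i k * (A j k)^*) * complex.Im (circ_row x k) +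
       complex.Im (A i k * (A j k)^*) * complex.Re (circ_row x k))); last first.
      apply/funext => x; rewrite iotaE fE /= raddf_sum; apply: eq_bigr => k _.
      by case: (A i k * _) (circ_row x k) => a b [c d].
    by apply: continuous_sum_lin2 => k; have [] := continuous_circ_row k.
  + rewrite (_ : (fun _ => _) = fun=> 0); first exact: cst_continuous.
    by apply/funext => x; rewrite iotaE.
  + rewrite (_ : (fun _ => _) = fun=> 0); first exact: cst_continuous.
    by apply/funext => x; rewrite iotaE.
- move=> x y; rewrite -iotaM /f -!mulmxA (mulmxA (A ^t*)) AA' mul1mx.
  rewrite (mulmxA (diag_mx _) (diag_mx _)) mulmx_diag.
  congr (iota (_ *m (diag_mx _ *m _))).
  by apply/rowP => i; rewrite !mxqE circ_rowD.
- move=> x; rewrite -(iota1 _ n); split=> [/iota_inj fx j|xz].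
    have : diag_mx (\row_i circ_row x i) = 1%:M.
      rewrite -[LHS]mul1mx -AA' -[LHS]mulmx1 -AA' -!mulmxA.
      by rewrite [X in A ^t* *m X](_ : _ = A); [|rewrite !mulmxA -/(f x) fx mul1mx].
    move/matrixP/(_ (val (enum_val j)) (val (enum_val j))).
    rewrite !mxqE eqxx !mulr1n /circ_row valK enum_valK => /circ_eq1.
    exact.
  congr iota; rewrite /f (_ : diag_mx _ = 1%:M) ?mulmx1 //.
  apply/matrixP => i j; rewrite !mxqE; congr (_ *+ _).
  by rewrite /circ_row; case: insub => // q; apply/circ_eq1.
apply/seteqP; split=> [_ [D [KD dD] <-]|_ [x _ <-]].
  have DE i j : i != j -> D i j = 0 by have /is_diag_mxP := dD; apply.
  have /choice[x xP] (k : 'I_dsize) :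
      exists x : R, circ x = D (val (enum_val k)) (val (enum_val k)).
    apply: circ_surj; have /matrixP := Kgrp_mulVmx KD.
    move=> /(_ (val (enum_val k)) (val (enum_val k))).
    rewrite !mxqE eqxx (bigD1 (val (enum_val k))) //= big1 ?addr0 => [|i ik].
      by rewrite !mxqE.
    by rewrite DE ?mul0r // eq_sym.
  exists (\row_k x k) => //; congr (iota (_ *m _ *m _)).
  apply/matrixP => i j; rewrite !mxqE; have [<-|ij] := eqVneq i j; last by rewrite DE.
  rewrite mulr1n /circ_row; case: insubP => [q _ qi|rii].
    by rewrite mxE xP enum_rankK qi.
  by rewrite (Kgrp_off KD) // eqxx.
exists (diag_mx (\row_i circ_row x i)) => //; split; last exact: diag_mx_is_diag.
apply: KgrpE => [|i j rij].
  apply/unitarymxP/matrixP => i j; rewrite mul_diag_mx !mxqE eq_sym rmorphMn /=.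
  have [->|] := eqVneq; last by rewrite mulr0.
  rewrite /circ_row; case: insub => [q|]; rewrite mulr1n ?circ_unit //.
  by rewrite conjC1 mulr1.
rewrite !mxqE; have [ij|//] := eqVneq i j; rewrite mulr1n /circ_row.
by case: insubP => // q rii; rewrite -ij rii in rij.
Qed.

(* The squares lie in the torus again, so a torus in [K] lies in the identity
   component. *)
Lemma rk_Kgrp (K : set 'M[H]_n) (W : 'M[C]_n) : W *m W ^t* = 1%:M ->
  (forall X, Kgrp r X -> K (iota (W *m X *m W ^t*))) ->
  (forall t, K t -> exists2 X, Kgrp r X & t *m t = iota (W *m X *m W ^t*)) ->
  rk K = dsize.
Proof.
move=> WW K1 K2; have WW' := mulmx1C WW.
have conjM (X Y : 'M[C]_n) :
    (W *m X *m W ^t*) *m (W *m Y *m W ^t*) = W *m (X *m Y) *m W ^t*.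
  by rewrite -!mulmxA (mulmxA (W ^t*)) WW' mul1mx.
have conjI (X Y : 'M[C]_n) : W *m X *m W ^t* = W *m Y *m W ^t* -> X = Y.
  move=> /(congr1 (fun Z => W ^t* *m Z *m W)).
  by rewrite -!mulmxA WW' !mulmx1 !mulmxA WW' !mul1mx.
have torus_sub m T : is_torus m T -> T `<=` K ->
    exists2 V, Kgrp r V & T `<=` diag_torus (W *m V ^t*).
  move=> [f [_ fM _ Tf]] TK.
  have TC t : T t -> exists2 X, Kgrp r X & t = iota (W *m X *m W ^t*).
    rewrite Tf => -[x _ <-]; have /K2 [X KX tX] : K (f (2^-1 *: x)).
      by apply: TK; rewrite Tf; exists (2^-1 *: x).
    exists X => //; rewrite -tX -fM -scalerDl.
    by rewrite -{1 2}[2^-1]mul1r -splitr scale1r.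
  have [||V KV dV] := @diag_conj C n r
    (fun X => Kgrp r X /\ T (iota (W *m X *m W ^t*))) rs rt.
  - by move=> X [].
  - move=> X Y [_ TX] [_ TY]; apply: conjI; apply: (@iota_inj R).
    rewrite -!conjM (iotaM (W *m X *m _)) (iotaM (W *m Y *m _)).
    move: TX TY; rewrite Tf => -[x _ <-] [y _ <-].
    by rewrite -!fM addrC.
  exists V => // t Tt; have [X KX tX] := TC t Tt.
  exists (V *m X *m V ^t*).
    split; last by apply: dV; rewrite -tX.
    by apply: KgrpM => //; [apply: KgrpM|apply: KgrpV].
  rewrite tX tmxCM trmxCK; congr iota.
  by rewrite -!mulmxA (mulmxA (V ^t*)) (Kgrp_mulmxV KV) mul1mx (mulmxA (V ^t*) V)
    (Kgrp_mulmxV KV) mul1mx.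
have torus_in V : Kgrp r V -> diag_torus (W *m V ^t*) `<=` K.
  move=> KV _ [D [KD dD] <-].
  have -> : W *m V ^t* *m D *m (W *m V ^t*) ^t* = W *m (V ^t* *m D *m V) *m W ^t*.
    by rewrite tmxCM trmxCK !mulmxA.
  by apply: K1; apply: KgrpM => //; apply: KgrpM => //; apply: KgrpV.
have torusW V : Kgrp r V -> is_torus dsize (diag_torus (W *m V ^t*)).
  move=> KV; apply: is_torus_diag.
  by rewrite tmxCM trmxCK -mulmxA (mulmxA (V ^t*)) (Kgrp_mulmxV KV) mul1mx.
have ex_max : is_maximal_torus K dsize (diag_torus W).
  have W1 : W = W *m (1%:M) ^t* by rewrite tmxC1 mulmx1.
  have K11 : Kgrp r (1%:M : 'M[C]_n) by exact: Kgrp1.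
  split; first by rewrite W1; apply: torusW.
    by rewrite W1; apply: torus_in.
  move=> m T Tt TK DT; have [V KV TV] := torus_sub _ _ Tt TK.
  apply/seteqP; split=> // t tT.
  have [X KX tX] : exists2 X, Kgrp r X & t = iota (W *m X *m W ^t*).
    have [D [KD _] <-] := TV t tT.
    exists (V ^t* *m D *m V); last by rewrite tmxCM trmxCK !mulmxA.
    by apply: KgrpM => //; apply: KgrpM => //; apply: KgrpV.
  exists X => //; split=> //; apply/is_diag_mxP => i j ij; have {}ij : i != j by [].
  have [rij|/(Kgrp_off KX) ->] := boolP (r i j); last first.
    by rewrite (negbTE ij).
  have rii : r i i by apply: (rt rij); rewrite rs.
  (* A sign change at [i] belongs to the diagonal torus. Commuting with it kills the entry [X i j],
     so the diagonal torus is maximal. *)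
  pose D : 'M[C]_n := diag_mx (\row_k (if k == i then -1 else 1)).
  have DK : Kgrp r D.
    apply: KgrpE => [|k l rkl].
      apply/unitarymxP/matrixP => k l; rewrite mul_diag_mx !mxqE [l == k]eq_sym.
      rewrite rmorphMn /=; have [->|] := eqVneq k l; last by rewrite mulr0.
      by case: ifP => _; rewrite mulr1n ?rmorphN /= ?rmorph1 ?mulrNN mulr1.
    rewrite !mxqE; have [kl|//] := eqVneq k l; rewrite -kl in rkl *; rewrite mulr1n.
    by case: (k =P i) => // ki; rewrite ki rii in rkl.
  have TD : T (iota (W *m D *m W ^t*)).
    by apply: DT; exists D => //; split => //; apply: diag_mx_is_diag.
  have comm : X *m D = D *m X.
    apply: conjI; apply: (@iota_inj R).
    rewrite -!conjM (iotaM (W *m X *m _)) (iotaM (W *m D *m _)) -tX.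
    case: Tt TD tT => f [_ fM _ ->] [x _ <-] [y _ <-].
    by rewrite -!fM addrC.
  have /matrixP/(_ i j) := comm; rewrite mul_diag_mx mul_mx_diag !mxqE eqxx.
  rewrite [j == i]eq_sym (negbTE ij) mulr1 mulN1r => /eqP.
  by rewrite -subr_eq0 opprK -mulr2n mulrn_eq0 => /eqP.
have [T [Tt TK Tmax]] : exists T, is_maximal_torus K (rk K) T.
  apply: (@xgetPex _ 0%N [set m | exists T, is_maximal_torus K m T]).
  by exists dsize, (diag_torus W).
have [V KV TV] := torus_sub _ _ Tt TK.
(* An arbitrary maximal torus lies in a conjugate of the diagonal one and is therefore equal to it,
   so the choice made in [rk] does not matter. *)
have E := Tmax _ _ (torusW V KV) (torus_in V KV) TV.
apply: (torus_dim_uniq Tt); rewrite -E.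
exact: torusW.
Qed.

End Rank.

(** * Orbits of points with independent moments *)

Section ImaginaryQuaternions.
Variable R : realType.
Local Notation H := (quat R).
Implicit Types p q h m : H.

Lemma conjq_self q : conjq q = q -> q = real_quat (q1 q).
Proof.
by case: q => a b c d [hb hc hd]; apply: quat_eqP; split; rewrite //=; lra.
Qed.

Lemma conjq_anti q : conjq q = - q -> q1 q = 0.
Proof. by case: q => a b c d [ha]; rewrite /=; lra. Qed.

(** A quaternion commutes with a nonzero imaginary one only if its imaginary part is parallel to it.
    Being parallel to both [p] and [p'], whose cross product [(n1, n2, n3)] is not zero, the
    imaginary part of [q] vanishes. *)
Lemma commute_two_imag p p' q : conjq p = - p -> conjq p' = - p' ->
  p * p' != p' * p -> q * p = p * q -> q * p' = p' * q -> q = real_quat (q1 q).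
Proof.
move=> /conjq_anti p0 /conjq_anti p'0 /eqP npp'.
case: p p0 npp' => _ a b c /= ->; case: p' p'0 => _ a' b' c' /= -> npp'.
case: q => x u v w [_ e1 e2 e3] [_ e1' e2' e3'].
have c1 : v * c - w * b = 0 by lra.
have c2 : w * a - u * c = 0 by lra.
have c3 : u * b - v * a = 0 by lra.
have c1' : v * c' - w * b' = 0 by lra.
have c2' : w * a' - u * c' = 0 by lra.
have c3' : u * b' - v * a' = 0 by lra.
pose n1 := b * c' - c * b'; pose n2 := c * a' - a * c'; pose n3 := a * b' - b * a'.
have nN0 : [|| n1 != 0, n2 != 0 | n3 != 0].
  apply: contraT; rewrite !negb_or !negbK => /and3P[/eqP n10 /eqP n20 /eqP n30].
  by case: npp'; apply: quat_eqP; split; rewrite /=; move: n10 n20 n30; rewrite /n1 /n2 /n3; lra.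
have un1 : u * n1 = 0.
  have -> : u * n1 = a * (v * c' - w * b') + (u * b - v * a) * c' + (w * a - u * c) * b'.
    by rewrite /n1; ring.
  by rewrite c1' c3 c2; ring.
have un2 : u * n2 = 0.
  have -> : u * n2 = - a * (u * c' - w * a') - (w * a - u * c) * a' by rewrite /n2; ring.
  by rewrite c2 -[u * c' - _]opprB c2'; ring.
have un3 : u * n3 = 0.
  have -> : u * n3 = a * (u * b' - v * a') - (u * b - v * a) * a' by rewrite /n3; ring.
  by rewrite c3 c3'; ring.
have vn1 : v * n1 = 0.
  have -> : v * n1 = b * (v * c' - w * b') - (v * c - w * b) * b' by rewrite /n1; ring.
  by rewrite c1 c1'; ring.
have vn2 : v * n2 = 0.
  have -> : v * n2 = b * (w * a' - u * c') + (v * c - w * b) * a' + (u * b - v * a) * c'.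
    by rewrite /n2; ring.
  by rewrite c1 c2' c3; ring.
have vn3 : v * n3 = 0.
  have -> : v * n3 = b * (u * b' - v * a') - (u * b - v * a) * b' by rewrite /n3; ring.
  by rewrite c3 c3'; ring.
have wn1 : w * n1 = 0.
  have -> : w * n1 = c * (v * c' - w * b') - (v * c - w * b) * c' by rewrite /n1; ring.
  by rewrite c1 c1'; ring.
have wn2 : w * n2 = 0.
  have -> : w * n2 = c * (w * a' - u * c') - (w * a - u * c) * c' by rewrite /n2; ring.
  by rewrite c2 c2'; ring.
have wn3 : w * n3 = 0.
  have -> : w * n3 = c * (u * b' - v * a') + (w * a - u * c) * b' + (v * c - w * b) * a'.
    by rewrite /n3; ring.
  by rewrite c1 c2 c3'; ring.
have cancel y : y * n1 = 0 -> y * n2 = 0 -> y * n3 = 0 -> y = 0.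
  move=> y1 y2 y3; case/or3P: nN0 => N0; apply: (mulIf N0); rewrite mul0r //.
by apply: quat_eqP; split; rewrite //=; apply: cancel.
Qed.

(* [h] is found by expanding it in the basis [p, p', p x p'] of the imaginary
   quaternions: an infinitesimal change of a pair of independent vectors that
   preserves their Gram matrix is an infinitesimal rotation. *)
Lemma gram_rotation p p' m m' : conjq p = - p -> conjq p' = - p' ->
  p * p' != p' * p -> conjq m = - m -> conjq m' = - m' ->
  q1 (m * p) = 0 -> q1 (m' * p') = 0 -> q1 (m * p' + p * m') = 0 ->
  exists2 h, conjq h = - h & m = p * h - h * p /\ m' = p' * h - h * p'.
Proof.
move=> /conjq_anti p0 /conjq_anti p'0 /eqP npp' /conjq_anti m0 /conjq_anti m'0.
case: p p0 npp' => _ a b c /= ->; case: p' p'0 => _ a' b' c' /= -> npp'.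
case: m m0 => _ x y z /= ->; case: m' m'0 => _ x' y' z' /= -> mp mp' mm'.
pose n1 := b * c' - c * b'; pose n2 := c * a' - a * c'; pose n3 := a * b' - b * a'.
have nN0 : n1 ^+ 2 + n2 ^+ 2 + n3 ^+ 2 != 0.
  apply/eqP => n0; case: npp'.
  have s1 := sqr_ge0 n1; have s2 := sqr_ge0 n2; have s3 := sqr_ge0 n3.
  have /eqP n10 : n1 == 0 by rewrite -sqrf_eq0; apply/eqP; lra.
  have /eqP n20 : n2 == 0 by rewrite -sqrf_eq0; apply/eqP; lra.
  have /eqP n30 : n3 == 0 by rewrite -sqrf_eq0; apply/eqP; lra.
  by apply: quat_eqP; split; rewrite /=; move: n10 n20 n30; rewrite /n1 /n2 /n3; lra.
pose N := n1 ^+ 2 + n2 ^+ 2 + n3 ^+ 2.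
(* With [n = p x p'] and [p h - h p = 2 p x h], the coefficients of [h] in the basis [p, p', n] are
   read off from [m' . n], [m . n] and [m . p']. The mixed Gram condition gives [m' . p = - ga]. *)
pose al := x' * n1 + y' * n2 + z' * n3.
pose be := - (x * n1 + y * n2 + z * n3).
pose ga := x * a' + y * b' + z * c'.
have N0 : 2 * N != 0 by rewrite mulf_neq0 ?pnatr_eq0.
exists (Quat 0 (- (al * a + be * a' + ga * n1) / (2 * N))
          (- (al * b + be * b' + ga * n2) / (2 * N))
          (- (al * c + be * c' + ga * n3) / (2 * N))).
  by apply: quat_eqP; split; rewrite //= oppr0.
have D1 : x * a + y * b + z * c = 0 by lra.
have D2 : x' * a' + y' * b' + z' * c' = 0 by lra.
have D3 : x' * a + y' * b + z' * c = - ga by rewrite /ga; lra.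
have N0' : N != 0 by [].
have D3' : x' * a + y' * b + z' * c + ga = 0 by rewrite D3 addNr.
(* Each component of the two equations, multiplied by [2 N], holds up to multiples of the Gram
   relations; [K] and [K'] are the multipliers. *)
have close (s t K : R) : 2 * N * s - 2 * N * t = K * (x * a + y * b + z * c) -> s = t.
  by rewrite D1 mulr0 -mulrBr => /eqP; rewrite mulf_eq0 (negbTE N0) /= subr_eq0 => /eqP.
have close' (s t K K' : R) : 2 * N * s - 2 * N * t =
    K * (x' * a + y' * b + z' * c + ga) + K' * (x' * a' + y' * b' + z' * c') -> s = t.
  rewrite D3' D2 !mulr0 addr0 -mulrBr => /eqP.
  by rewrite mulf_eq0 (negbTE N0) /= subr_eq0 => /eqP.
split; apply: quat_eqP; split; rewrite /=.
- by field.
- apply: (close _ _ (2 * (b' * n3 - c' * n2))).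
  by rewrite /al /be /ga /N /n1 /n2 /n3; field.
- apply: (close _ _ (2 * (c' * n1 - a' * n3))).
  by rewrite /al /be /ga /N /n1 /n2 /n3; field.
- apply: (close _ _ (2 * (a' * n2 - b' * n1))).
  by rewrite /al /be /ga /N /n1 /n2 /n3; field.
- by field.
- apply: (close' _ _ (2 * (b' * n3 - c' * n2)) (2 * (n2 * c - n3 * b))).
  by rewrite /al /be /ga /N /n1 /n2 /n3; field.
- apply: (close' _ _ (2 * (c' * n1 - a' * n3)) (2 * (n3 * a - n1 * c))).
  by rewrite /al /be /ga /N /n1 /n2 /n3; field.
- apply: (close' _ _ (2 * (a' * n2 - b' * n1)) (2 * (n1 * b - n2 * a))).
  by rewrite /al /be /ga /N /n1 /n2 /n3; field.
Qed.

Lemma imag_unit p : conjq p = - p -> p != 0 ->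
  exists c : R, conjq (real_quat c * p) * (real_quat c * p) = 1.
Proof.
move=> ap p0; exists (Num.sqrt (sqnorm p))^-1.
rewrite mul_conjq; have -> : sqnorm (real_quat (Num.sqrt (sqnorm p))^-1 * p) = 1.
  rewrite /sqnorm /= !mul0r !subr0 !addr0 !exprMn -!mulrDr.
  rewrite exprVn sqr_sqrtr ?sqnorm_ge0 // -/(sqnorm p) mulVf //.
  by rewrite sqnorm_eq0.
exact: rmorph1.
Qed.

(* [h] spans a line containing [p] and [p']. *)
Lemma commuting_unit p p' : conjq p = - p -> conjq p' = - p' -> p * p' = p' * p ->
  exists h, [/\ conjq h = - h, h * h = -1, h * p = p * h & h * p' = p' * h].
Proof.
have unit m : conjq m = - m -> m != 0 -> exists c : R,
    let h := real_quat c * m in conjq h = - h /\ h * h = -1.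
  move=> am m0; have [c cm] := imag_unit am m0; exists c => /=.
  have ah : conjq (real_quat c * m) = - (real_quat c * m).
    by rewrite conjqM conj_real_quat am mulNr -real_quatC.
  by split=> //; rewrite -[LHS]opprK -mulNr -ah cm.
move=> ap ap' pp'; have [p0|pN0] := eqVneq p 0; last first.
  have [c [ah hh]] := unit _ ap pN0; exists (real_quat c * p); split=> //.
    by rewrite mulrA -real_quatC.
  by rewrite -mulrA pp' !mulrA real_quatC.
have [p'0|p'N0] := eqVneq p' 0; last first.
  have [c [ah hh]] := unit _ ap' p'N0; exists (real_quat c * p'); split=> //.
    by rewrite -mulrA -pp' !mulrA real_quatC.
  by rewrite mulrA -real_quatC.
exists (Quat 0 1 0 0); rewrite p0 p'0 !mulr0 !mul0r; split=> //.
  by apply: quat_eqP; split; rewrite //= oppr0.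
by apply: quat_eqP; split; rewrite /=; ring.
Qed.

End ImaginaryQuaternions.

(** * Quaternionic lines, unit vectors and their complex matrices *)

Section Lines.
Variables (R : realType) (n : nat).
Local Notation H := (quat R).
Local Notation C := (R[i]).
Implicit Types (v w z : 'cV[H]_n) (P : 'M[H]_n) (g : 'M[H]_n).

Definition Proj v : 'M[H]_n := v *m adj v.

Definition unitv v := adj v *m v = 1%:M.

Lemma adj_Proj v : adj (Proj v) = Proj v.
Proof. by rewrite /Proj adjM adjK. Qed.

Lemma Proj_mul v : unitv v -> Proj v *m v = v.
Proof. by move=> v1; rewrite /Proj -mulmxA v1 mulmx1. Qed.

Lemma mul_Proj v : unitv v -> adj v *m Proj v = adj v.
Proof. by move=> v1; rewrite /Proj mulmxA v1 mul1mx. Qed.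

Lemma Proj_idem v : unitv v -> Proj v *m Proj v = Proj v.
Proof. by move=> v1; rewrite {2}/Proj mulmxA Proj_mul. Qed.

Lemma act_Proj g v : act g (Proj v) = Proj (g *m v).
Proof. by rewrite /act adjqE /Proj adjM !mulmxA. Qed.

Lemma unitvM g v : adj g *m g = 1%:M -> unitv v -> unitv (g *m v).
Proof. by move=> gg v1; rewrite /unitv adjM -mulmxA (mulmxA (adj g)) gg mul1mx. Qed.

Lemma Proj_eq v w : unitv v -> unitv w -> Proj v = Proj w ->
  exists2 q : 'M[H]_1, w = v *m q & adj q *m q = 1%:M.
Proof.
move=> v1 w1 vw; exists (adj v *m w).
  by rewrite mulmxA -/(Proj v) vw Proj_mul.
by rewrite adjM adjK -mulmxA [v *m _]mulmxA -/(Proj v) vw Proj_mul.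
Qed.

Lemma Proj_mulr v (q : 'M[H]_1) : q *m adj q = 1%:M -> Proj (v *m q) = Proj v.
Proof. by move=> qq; rewrite /Proj adjM mulmxA -(mulmxA v) qq mulmx1. Qed.

Lemma mxtrace_Proj v : unitv v -> \tr (Proj v) = 1.
Proof.
move=> v1; transitivity ((adj v *m v) 0 0); last by rewrite v1 mxE.
rewrite [RHS]mxE; apply: eq_bigr => i _; rewrite mxE big_ord1 !mxqE.
by rewrite mulq_conj mul_conjq.
Qed.

Lemma HP_Proj v : unitv v -> HP R n (Proj v).
Proof.
by move=> v1; split; [rewrite adjqE; exact: adj_Proj|exact: Proj_idem|exact: mxtrace_Proj].
Qed.

(** Some diagonal entry [P j j], which is the squared norm of row [j], is not zero, and the
    normalized column [j] is the vector. The difference of [P] and its projection is a hermitian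
    idempotent of trace zero. *)
Lemma HP_exists_unit P : HP R n P -> exists2 v, unitv v & P = Proj v.
Proof.
move=> [aP PP tP]; rewrite adjqE in aP.
have Pjj j : P j j = real_quat (\sum_l sqnorm (P j l)).
  rewrite -{1}PP mxE rmorph_sum; apply: eq_bigr => l _.
  by rewrite -{2}aP adjE mulq_conj.
have [j j0] : exists j, \sum_l sqnorm (P j l) != 0.
  apply: contrapT => /forallNP j0; have := oner_neq0 H; rewrite -tP /mxtrace.
  rewrite big1 ?eqxx // => j _; rewrite Pjj.
  by have /negP := j0 j; rewrite negbK => /eqP ->; rewrite rmorph0.
set s := \sum_l _ in j0.
have s_ge0 : 0 <= s by apply: sumr_ge0 => l _; exact: sqnorm_ge0.
pose c := (Num.sqrt s)^-1.
pose v : 'cV[H]_n := real_quat c *: (P *m delta_mx j 0).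
have v1 : unitv v.
  rewrite /unitv /v adj_scaleq scaleq_mull -scalemxAl scalerA -rmorphM /=.
  rewrite adjM aP mulmxA -(mulmxA _ P P) PP -mulmxA -colE.
  have -> : adj (delta_mx j 0) *m col j P = (P j j)%:M.
    apply/matrixP => a b; rewrite !ord1 !mxqE (bigD1 j) //= big1 => [|l /negbTE lj].
      by rewrite !mxqE !eqxx /= conjq1 mul1r addr0.
    by rewrite !mxqE lj raddf0 mul0r.
  rewrite Pjj -/s -[X in _ *: X]scalemx1 scalerA -rmorphM /=.
  by rewrite /c -expr2 exprVn sqr_sqrtr // mulVf // rmorph1 scale1r.
exists v => //.
have Pv : P *m v = v by rewrite /v scaleq_mull mulmxA PP.
have vP : adj v *m P = adj v by rewrite -{2}Pv adjM aP.
apply/eqP; rewrite -subr_eq0; apply/eqP; apply: q1_tr_adj_eq0.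
have -> : adj (P - Proj v) *m (P - Proj v) = P - Proj v.
  rewrite adjB aP adj_Proj mulmxBl !mulmxBr PP Proj_idem //.
  by rewrite {1}/Proj mulmxA Pv {2}/Proj -mulmxA vP -/(Proj v) subrr subr0.
by rewrite [\tr _]raddfB /= mxtrace_Proj // tP subrr.
Qed.

(* The rows of the two columns are the coordinates of [v] in [C + C j]. *)
Definition cplx v : 'M[C]_(n, 1 + 1) := row_mx (Cpart v) (Jpart v).

Definition iC : C := (0 +i* 1)%C.

Lemma iC_conj : iC^* = - iC.
Proof. by apply/eqP; rewrite eq_complex /= oppr0 !eqxx. Qed.

Lemma iC_neq0 : iC != 0.
Proof. by rewrite eq_complex /= oner_eq0 andbF. Qed.

Lemma cplx_iota (X : 'M[C]_n) v : cplx (iota X *m v) = X *m cplx v.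
Proof. by rewrite /cplx Cpart_iotaM Jpart_iotaM mul_mx_row. Qed.

Lemma cplx0 : cplx 0 = 0.
Proof. by rewrite /cplx (raddf0 (@Cpart R n 1)) (raddf0 (@Jpart R n 1)) row_mx0. Qed.

Lemma cplx_inj : injective cplx.
Proof. by move=> v w /eq_row_mx[]; apply: Parts_eq. Qed.

(* [s = a + b^* ], [t = i a + (i b)^*], ... are the coordinates of the
   quaternions [v^* D z] and [v^* i D z]. *)
Lemma skew_entries (aa ab ba bb : C) (s t : H) :
  cpart t = aa + bb^* -> cpart s = iC * aa + (iC * bb)^* ->
  jpart s = iC * ab - (iC * ba)^* -> conjq s = s -> q1 t = 0 ->
  (block_mx aa%:M ab%:M ba%:M bb%:M : 'M[C]_(1 + 1)) ^t* =
  - (block_mx aa%:M ab%:M ba%:M bb%:M : 'M[C]_(1 + 1)).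
Proof.
move=> ct cs js s0 re0.
have js0 : jpart s = 0.
  have := congr1 (@jpart R) s0; rewrite jpart_conj => /eqP.
  by rewrite -subr_eq0 -opprD oppr_eq0 -mulr2n mulrn_eq0 => /eqP.
have abE : ab = - ba^*.
  move: js; rewrite js0 rmorphM /= iC_conj mulNr opprK -mulrDr => /esym/eqP.
  by rewrite mulf_eq0 (negbTE iC_neq0) /= addr_eq0 => /eqP.
have css : (cpart s)^* = cpart s by rewrite -cpart_conj s0.
have e1 : complex.Re aa = complex.Re bb.
  move: css; rewrite cs; case: (aa) (bb) => [x y] [x' y'].
  by move=> /eqP; rewrite eq_complex /= => /andP[_ /eqP]; lra.
have e2 : complex.Re aa + complex.Re bb = 0.
  move: re0; rewrite -[q1 t]/(complex.Re (cpart t)) ct.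
  by case: (aa) (bb) => [x y] [x' y'].
have aaJ : aa^* = - aa.
  move: e1 e2; case: (aa) (bb) => [x y] [x' y'] /= -> e.
  by apply/eqP; rewrite eq_complex /= eqxx andbT; apply/eqP; lra.
have bbJ : bb^* = - bb.
  move: e1 e2; case: (aa) (bb) => [x y] [x' y'] /= -> e.
  by apply/eqP; rewrite eq_complex /= eqxx andbT; apply/eqP; lra.
have baE : ba^* = - ab by rewrite abE opprK.
have abJ : ab^* = - ba by rewrite abE rmorphN /= conjCK.
have scalJ (x y : C) : x^* = - y -> ((x%:M : 'M[C]_1) ^t*) = - y%:M.
  by move=> xy; apply/matrixP => i j; rewrite !ord1 tmxCE !mxqE !mulr1n.
rewrite tr_block_mx map_block_mx opp_block_mx.
by congr block_mx; apply: scalJ.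
Qed.

(* [S = A^* D Z] for the complex [n x 2] matrices [A], [Z] of [v], [z]; its
   entries are read off the quaternions [v^* D z] and [v^* i D z]. *)
Lemma skew_cond v z (D : 'M[C]_n) :
  let s := adj v *m iota (iC *: D) *m z in
  adj s = s -> q1 ((adj v *m iota D *m z) 0 0) = 0 ->
  ((cplx v) ^t* *m D *m cplx z) ^t* = - ((cplx v) ^t* *m D *m cplx z).
Proof.
move=> s as_ re0.
set a := Cpart v; set b := Jpart v; set al := Cpart z; set be := Jpart z.
have bT (m : 'cV[C]_n) : map_mx Num.conj (b ^t* *m m) = b^T *m map_mx Num.conj m.
  rewrite map_mxM; congr (_ *m _); apply/matrixP => i j.
  by rewrite !mxqE /= conjCK.
have part (T : 'M[C]_n) (m : 'M[H]_1) : m = adj v *m iota T *m z ->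
    cpart (m 0 0) = (a ^t* *m (T *m al)) 0 0 + ((b ^t* *m (T *m be)) 0 0)^* /\
    jpart (m 0 0) = (a ^t* *m (T *m be)) 0 0 - ((b ^t* *m (T *m al)) 0 0)^*.
  move=> ->; rewrite -mulmxA; set y := iota T *m z.
  have := CpartM (adj v) y; have := JpartM (adj v) y.
  rewrite Cpart_adj Jpart_adj !mulNmx opprK -/a -/b -!bT.
  rewrite Cpart_iotaM Jpart_iotaM -/al -/be => /matrixP/(_ 0 0) eJ /matrixP/(_ 0 0) eC.
  move: eJ eC; rewrite JpartE => ->; rewrite CpartE => ->.
  by split; rewrite [LHS]mxE; congr (_ + _); rewrite mxE // mxE.
have Z (x m : 'cV[C]_n) :
    (x ^t* *m ((iC *: D) *m m)) 0 0 = iC * (x ^t* *m (D *m m)) 0 0.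
  by rewrite -scalemxAl -scalemxAr mxE.
have SE : (cplx v) ^t* *m D *m cplx z =
    block_mx ((a ^t* *m (D *m al)) 0 0)%:M ((a ^t* *m (D *m be)) 0 0)%:M
      ((b ^t* *m (D *m al)) 0 0)%:M ((b ^t* *m (D *m be)) 0 0)%:M.
  rewrite /cplx tr_row_mx map_col_mx -mulmxA mul_mx_row mul_col_row.
  by congr block_mx; rewrite [LHS]mx11_scalar.
have [c1 _] := part D _ (erefl _); have [c2 j2] := part (iC *: D) s (erefl _).
rewrite SE; apply: (@skew_entries _ _ _ _ (s 0 0) _ c1 _ _ _ re0).
- by rewrite c2 (Z a al) (Z b be).
- by rewrite j2 (Z a be) (Z b al).
- by rewrite -adjE as_.
Qed.

End Lines.

(** * Moments and nondegenerate vectors *)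

Section Blocks.
Variables (R : realType) (n k : nat).
Local Notation H := (quat R).
Local Notation C := (R[i]).
Implicit Types (v w z : 'cV[H]_n) (b : bool) (X : 'M[C]_n).

Definition blk : rel 'I_n := [rel i j : 'I_n | (i < k)%N == (j < k)%N].

Lemma blk_sym : symmetric blk.
Proof. by move=> i j; rewrite /blk /= eq_sym. Qed.

Lemma blk_neq i j : ~~ blk i j -> (i == j) = false.
Proof. by apply: contraNF => /eqP ->; rewrite /blk /=. Qed.

Lemma blk_trans : transitive blk.
Proof. by move=> j i l; rewrite /blk /= => /eqP -> /eqP ->. Qed.

Definition proj (c : pred 'I_n) : 'M[C]_n := diag_mx (\row_i (c i)%:R).

Lemma proj_mul c m (X : 'M[C]_(n, m)) i j : (proj c *m X) i j = (c i)%:R * X i j.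
Proof. by rewrite mul_diag_mx !mxqE. Qed.

Lemma mul_proj c m (X : 'M[C]_(m, n)) i j : (X *m proj c) i j = X i j * (c j)%:R.
Proof. by rewrite mul_mx_diag !mxqE. Qed.

Lemma proj_adj c : (proj c) ^t* = proj c.
Proof.
apply/matrixP => i j; rewrite tmxCE !mxqE rmorphMn /= conjC_nat eq_sym.
by case: eqP => [->|].
Qed.

Definition D b := proj (fun i : 'I_n => (i < k)%N == b).

Lemma D_adj b : (D b) ^t* = D b. Proof. exact: proj_adj. Qed.

Lemma D_sum : D true + D false = 1%:M.
Proof.
apply/matrixP => i j; rewrite !mxqE -mulrnDl -natrD.
by case: ltnP.
Qed.

Lemma D_idem b : D b *m D b = D b.
Proof.
apply/matrixP => i j; rewrite proj_mul !mxqE.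
by case: (_ == b); rewrite ?mul1r // mul0r mul0rn.
Qed.

Lemma D_suppC b X : supp blk X -> D b *m X = X *m D b.
Proof.
move=> sX; apply/matrixP => i j; rewrite proj_mul mul_proj mulrC.
have [|/sX ->] := boolP (blk i j); last by rewrite !mul0r.
by rewrite /blk /= => /eqP ->.
Qed.

Lemma D_KgrpC b X : Kgrp blk X -> D b *m X = X *m D b.
Proof.
move=> [_ /(D_suppC b)]; rewrite mulmxBl mulmxBr mulmx1 mul1mx.
by move/addIr.
Qed.

(* The [U(k) x U(n-k)]-equivariant map [v |-> v^* i D_b v] to the imaginary
   quaternions; [Sp(1)] acts on its values by rotations. *)
Definition moment b v : 'M[H]_1 := adj v *m iota (iC R *: D b) *m v.

Lemma iDC b X : D b *m X = X *m D b -> (iC R *: D b) *m X = X *m (iC R *: D b).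
Proof. by move=> DX; rewrite -scalemxAl DX scalemxAr. Qed.

Lemma adj_iD b : adj (iota (iC R *: D b)) = - iota (iC R *: D b).
Proof. by rewrite adj_iota tmxCZ iC_conj D_adj scaleNr iotaN. Qed.

Lemma adj_moment b v : adj (moment b v) = - moment b v.
Proof. by rewrite /moment !adjM adjK adj_iD mulNmx mulmxN mulmxA. Qed.

Lemma moment_unitary b v X : Kgrp blk X -> moment b (iota X *m v) = moment b v.
Proof.
move=> KX; rewrite /moment adjM -!mulmxA; congr (_ *m _); rewrite !mulmxA.
congr (_ *m _); rewrite adj_iota -!iotaM; congr iota.
by rewrite -mulmxA iDC ?D_KgrpC // mulmxA (Kgrp_mulmxV KX) mul1mx.
Qed.

Lemma mx11M (x y : 'M[H]_1) : (x *m y) 0 0 = x 0 0 * y 0 0.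
Proof. by rewrite mxE big_ord1. Qed.

Lemma mx11_eq (x y : 'M[H]_1) : x 0 0 = y 0 0 -> x = y.
Proof. by move=> xy; rewrite [x]mx11_scalar [y]mx11_scalar xy. Qed.

Lemma unitq_sym (q : 'M[H]_1) : adj q *m q = 1%:M -> q *m adj q = 1%:M.
Proof.
move=> qq; apply: mx11_eq; rewrite -qq !mxqE !big_ord1 !mxqE.
by rewrite mulq_conj mul_conjq.
Qed.

Lemma moment_conj b v : conjq (moment b v 0 0) = - moment b v 0 0.
Proof. by rewrite -adjE adj_moment mxE. Qed.

(* The complex [n x 2] matrix of [v] has rank 2 in each block, and the two moments
   are linearly independent. *)
Definition nondeg v :=
  (forall b, exists2 B : 'M[C]_(1 + 1, n), B *m D b = B & B *m cplx v = 1%:M) /\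
  moment true v *m moment false v <> moment false v *m moment true v.

Lemma nondeg_unitary v X : Kgrp blk X -> nondeg v -> nondeg (iota X *m v).
Proof.
move=> KX [hB pp]; split; last by rewrite !moment_unitary.
move=> b; have [B BD Bv] := hB b; exists (B *m X ^t*).
  by rewrite -mulmxA -(D_KgrpC b (KgrpV blk_sym KX)) mulmxA BD.
by rewrite cplx_iota mulmxA -(mulmxA B) (Kgrp_mulmxV KX) mulmx1.
Qed.

Lemma nondeg_commute v (q : 'M[H]_1) : nondeg v ->
  (forall b, q *m moment b v = moment b v *m q) -> exists c : R, q = (real_quat c)%:M.
Proof.
move=> [_ pp] qp; exists (q1 (q 0 0)); apply: mx11_eq; rewrite mxE eqxx mulr1n.
apply: (@commute_two_imag R (moment true v 0 0) (moment false v 0 0)).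
- exact: moment_conj.
- exact: moment_conj.
- apply/eqP => e; apply: pp; apply: mx11_eq.
  rewrite [LHS](mx11M (moment true v) (moment false v)).
  by rewrite [RHS](mx11M (moment false v) (moment true v)).
- by rewrite -(mx11M q) -(mx11M (moment true v)) qp.
- by rewrite -(mx11M q) -(mx11M (moment false v)) qp.
Qed.

(* [X = sum_b (Z B - B^* Z^* - B^* (A^* Z) B)] with [B] a left inverse of the
   block [A] of [v] and [Z] the block of [z]. *)
Lemma solve_skew v z (B : bool -> 'M[C]_(1 + 1, n)) :
  (forall b, B b *m D b = B b) -> (forall b, B b *m cplx v = 1%:M) ->
  (forall b, let s := adj v *m iota (iC R *: D b) *m z in adj s = s) ->
  (forall b, q1 ((adj v *m iota (D b) *m z) 0 0) = 0) ->
  exists X, [/\ supp blk X, X ^t* = - X, iota X *m v = z &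
    forall Q : 'M[C]_n, Q *m D true = D true *m Q -> Q *m cplx z = cplx z ->
      (forall b, Q *m (B b) ^t* = (B b) ^t*) -> Q *m X = X].
Proof.
move=> BD Bv sz rz.
have [A AE] : {A | A = cplx v} by exists (cplx v).
have [Z ZE] : {Z | Z = cplx z} by exists (cplx z).
rewrite -ZE -AE in Bv *.
have [S SE SJ] : exists2 S, forall b, S b = A ^t* *m D b *m Z &
    forall b, (S b) ^t* = - S b.
  by exists (fun b => A ^t* *m D b *m Z) => // b; rewrite AE ZE; exact: skew_cond.
have [U UE] : {U | forall b, U b = D b *m Z *m B b} by exists (fun b => D b *m Z *m B b).
have UJ b : (U b) ^t* = (B b) ^t* *m (Z ^t* *m D b).
  by rewrite UE (tmxCM _ (B b)) (tmxCM (D b)) D_adj.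
have [V VE] : {V | forall b, V b = (B b) ^t* *m S b *m B b}.
  exact: (exist _ (fun b => (B b) ^t* *m S b *m B b) (fun=> erefl)).
have VJ b : (V b) ^t* = - V b.
  by rewrite VE (tmxCM _ (B b)) (tmxCM _ (S b)) SJ trmxCK mulNmx mulmxN mulmxA.
pose Y b := U b - (U b) ^t* - V b.
have SJ' b : Z ^t* *m D b *m A = - S b.
  by rewrite -SJ SE !tmxCM trmxCK D_adj mulmxA.
(* The term [- U^*] contributes [B^* S] because [S] is skew-hermitian, and [V] cancels it. *)
have YA b : Y b *m A = D b *m Z.
  rewrite /Y !mulmxBl UJ UE VE -!mulmxA Bv !mulmx1 (mulmxA (Z ^t*)) SJ' mulmxN opprK.
  by rewrite addrK.
have YJ b : (Y b) ^t* = - Y b.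
  by rewrite /Y !tmxCB trmxCK VJ opprB [RHS]addrC opprB opprK.
have DB b : D b *m (B b) ^t* = (B b) ^t* by rewrite -{2}BD tmxCM D_adj.
have DYD b : D b *m Y b *m D b = Y b.
  have DU : D b *m U b = U b by rewrite UE !mulmxA D_idem.
  have UD : U b *m D b = U b by rewrite UE -mulmxA BD.
  have DV : D b *m V b = V b by rewrite VE !mulmxA DB.
  have VD : V b *m D b = V b by rewrite VE -mulmxA BD.
  have DUJ : D b *m (U b) ^t* = (U b) ^t* by rewrite -{2}UD tmxCM D_adj.
  have UDJ : (U b) ^t* *m D b = (U b) ^t* by rewrite -{2}DU tmxCM D_adj.
  by rewrite /Y !mulmxBr !mulmxBl DU UD DV VD DUJ UDJ.
have sY b : supp blk (Y b).
  move=> i j; rewrite /blk /= -DYD mul_proj proj_mul.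
  by case: (i < k)%N; case: (j < k)%N; case: (b) => //= _; rewrite ?mul0r ?mulr0.
exists (Y true + Y false); split.
- by apply: suppD; apply: sY.
- by rewrite tmxCD (YJ true) (YJ false) -opprD.
- apply: cplx_inj; rewrite cplx_iota -AE -ZE mulmxDl !YA -mulmxDl D_sum.
  by rewrite mul1mx.
(* This last property confines [X] to the range of a projection [Q], which will be the one onto the
   slice coordinates. *)
move=> Q QD Qz QB.
have QDb b : Q *m D b = D b *m Q.
  case: b => //; have -> : D false = 1%:M - D true by rewrite -D_sum addrC addKr.
  by rewrite mulmxBl mulmxBr mulmx1 mul1mx QD.
have QY b : Q *m Y b = Y b.
  by rewrite /Y !mulmxBr UJ UE VE !mulmxA QDb QB -(mulmxA (D b) Q) Qz.
by rewrite mulmxDr !QY.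
Qed.

Lemma bracket_Proj v X : X ^t* = - X ->
  bracket (iota X) (Proj v) = (iota X *m v) *m adj v + v *m adj (iota X *m v).
Proof.
by move=> XJ; rewrite /bracket /Proj adjM adj_iota XJ iotaN mulmxN -!mulmxA mulmxN.
Qed.

(** An infinitesimal stabilizer maps [v] to [v q] with [q] imaginary and commuting with both
    moments. Such a [q] is also real, hence zero. *)
Lemma nondeg_stab_lie v X : nondeg v -> unitv v -> supp blk X -> X ^t* = - X ->
  bracket (iota X) (Proj v) = 0 -> iota X *m v = 0.
Proof.
move=> nd v1 sX XJ /subr0_eq XP.
pose q : 'M[H]_1 := adj v *m (iota X *m v).
have Xv : iota X *m v = v *m q.
  rewrite /q !mulmxA -[v *m adj v]/(Proj v) -XP /Proj -!mulmxA v1 mulmx1.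
  by [].
have aX : adj (iota X) = - iota X by rewrite adj_iota XJ iotaN.
have aq : adj q = - q by rewrite /q !adjM adjK aX mulmxN mulNmx mulmxA.
have qp b : q *m moment b v = moment b v *m q.
  have e : adj (moment b v *m q) = moment b v *m q.
    have -> : moment b v *m q = adj v *m (iota (iC R *: D b) *m (iota X *m v)).
      by rewrite /moment -!mulmxA -Xv.
    rewrite !adjM aX adjK adj_iD !(mulmxN, mulNmx) opprK -!mulmxA; congr (_ *m _).
    rewrite (mulmxA (iota X)) (mulmxA (iota (iC R *: D b))) -!iotaM.
    by rewrite iDC // D_suppC.
  by rewrite -e adjM aq adj_moment mulNmx mulmxN opprK.
have [c qc] := nondeg_commute nd qp.
rewrite Xv qc; move: aq; rewrite qc adj_scalar conj_real_quat => /matrixP/(_ 0 0).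
rewrite !mxqE eqxx !mulr1n => /(congr1 (@q1 R)) /= e.
have -> : c = 0 by lra.
rewrite (_ : (real_quat 0)%:M = 0) ?mulmx0 //.
by apply/matrixP => i j; rewrite !mxqE mul0rn.
Qed.

Lemma nondeg_isotropy v X : nondeg v -> unitv v -> Kgrp blk X ->
  act (iota X) (Proj v) = Proj v -> iota X *m v = v \/ iota X *m v = - v.
Proof.
move=> nd v1 KX; rewrite act_Proj => gv.
have Xu : adj (iota X) *m iota X = 1%:M.
  by rewrite adj_iota -iotaM (Kgrp_mulmxV KX) iota1.
have [q Xv qq] := Proj_eq v1 (unitvM Xu v1) (esym gv).
have qp b : q *m moment b v = moment b v *m q.
  have qpq : adj q *m moment b v *m q = moment b v.
    by rewrite -[RHS](moment_unitary b v KX) Xv /moment adjM !mulmxA.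
  by rewrite -{1}qpq !mulmxA (unitq_sym qq) mul1mx.
have [c qc] := nondeg_commute nd qp.
move: qq; rewrite qc adj_scalar conj_real_quat => /matrixP/(_ 0 0).
rewrite mx11M !mxqE eqxx !mulr1n -rmorphM => /(congr1 (@q1 R)) /= /eqP.
rewrite -expr2 sqrf_eq1 Xv qc => /orP[]/eqP ->.
  by left; rewrite rmorph1 mulmx1.
by right; rewrite rmorphN1 raddfN /= mulmxN mulmx1.
Qed.

End Blocks.

(** * Velocities of curves in an orbit *)

Section Tangents.
Variables (R : realType) (n k : nat).
Local Notation H := (quat R).
Local Notation C := (R[i]).
Implicit Types (v w z : 'cV[H]_n) (b : bool) (X : 'M[C]_n).
Local Notation G := (UU R n k).
Local Notation blk := (@blk n k).

Lemma UUP (g : 'M[H]_n) : G g <-> exists2 X, Kgrp blk X & g = iota X.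
Proof.
split=> [[[X uX <-] g0]|[X KX ->]].
  exists X; last by rewrite iota.unlock.
  apply: KgrpE => // i j rij.
  have := g0 i j rij; rewrite mxE => /(congr1 (@cpart R)).
  rewrite cpart_complex => ->; case: (i =P j) rij => // ->.
  by rewrite /blk /= eqxx.
split; first by exists X; [case: KX | rewrite iota.unlock].
move=> i j ij; rewrite iotaE (Kgrp_off KX) //; case: (i =P j) ij => [->|_ _].
  by rewrite eqxx.
exact: rmorph0.
Qed.

Lemma HP_velocity (g : R -> 'M[H]_n) t : smooth_curve g -> (forall t, HP R n (g t)) ->
  adj (velocity g t) = velocity g t /\
  velocity g t *m g t + g t *m velocity g t = velocity g t.
Proof.
move=> sg HPg; split.
  rewrite -(velocity_adj _ sg) (_ : (fun u => adj (g u)) = g) //.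
  by apply/funext => u; have [aP _ _] := HPg u; rewrite -adjqE.
rewrite -(velocityM _ sg sg) (_ : (fun u => g u *m g u) = g) //.
by apply/funext => u; have [_ PP _] := HPg u; exact: PP.
Qed.

(** Sandwiching [E P + P E = E] between [v^*] and [v] doubles [v^* E v], which therefore
    vanishes. *)
Lemma tangent_Proj v (E : 'M[H]_n) : unitv v -> adj E = E ->
  E *m Proj v + Proj v *m E = E ->
  adj v *m (E *m v) = 0 /\ E = (E *m v) *m adj v + v *m adj (E *m v).
Proof.
move=> v1 aE EP; split; last first.
  by rewrite adjM aE -{1}EP /Proj !mulmxA.
have : adj v *m (E *m Proj v + Proj v *m E) *m v = adj v *m E *m v by rewrite EP.
rewrite mulmxDr mulmxDl (mulmxA (adj v) (Proj v)) mul_Proj //.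
rewrite -(mulmxA _ (E *m Proj v)) -(mulmxA E) Proj_mul // -[RHS]add0r.
exact: addIr.
Qed.

Lemma orbit_HP v P : unitv v -> orbit G (Proj v) P -> HP R n P.
Proof.
move=> v1 [g /UUP[X KX ->] <-]; rewrite act_Proj; apply: HP_Proj.
by apply: unitvM => //; rewrite adj_iota -iotaM (Kgrp_mulmxV KX) iota1.
Qed.

Lemma q1_tr_col (x : 'cV[H]_n) (y : 'rV[H]_n) :
  q1 (\tr (x *m y)) = q1 ((y *m x) 0 0).
Proof. by rewrite q1_mxtraceC trace_mx11. Qed.

Lemma q1_tr_const (g : R -> 'M[H]_n) (c : R) t : smooth_curve g ->
  (forall t, q1 (\tr (g t)) = c) -> q1 (\tr (velocity g t)) = 0.
Proof.
move=> sg gc; rewrite -(velocity_q1_tr _ sg).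
by under eq_fun do rewrite gc; rewrite derive1_cst.
Qed.

Lemma q1_tr_conj (U A : 'M[H]_n) : adj U *m U = 1%:M ->
  q1 (\tr (U *m A *m adj U)) = q1 (\tr A).
Proof. by move=> UU; rewrite q1_mxtraceC mulmxA UU mul1mx. Qed.

Lemma q1_tr_conj2 (U S S' P : 'M[H]_n) : adj U *m U = 1%:M ->
  S *m U = U *m S -> S' *m U = U *m S' ->
  q1 (\tr (S *m (U *m P *m adj U) *m (S' *m (U *m P *m adj U)))) =
  q1 (\tr (S *m P *m (S' *m P))).
Proof.
move=> UU SU S'U.
have e T : T *m U = U *m T ->
    T *m (U *m P *m adj U) = U *m (T *m P) *m adj U.
  by move=> TU; rewrite !mulmxA TU.
rewrite (e _ SU) (e _ S'U) -[RHS](q1_tr_conj _ UU).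
move: (S *m P) (S' *m P) => A B; rewrite -!mulmxA (mulmxA (adj U) U) UU mul1mx.
by rewrite !mulmxA.
Qed.

(** With [i D_b] and [i D_c] for [T] and [T'] this real trace is, up to sign, the scalar product of
    two moments, written in terms of [P] alone. *)
Lemma orbit_invariant v (T T' : 'M[C]_n) P :
  (forall X, Kgrp blk X -> T *m X = X *m T) ->
  (forall X, Kgrp blk X -> T' *m X = X *m T') -> orbit G (Proj v) P ->
  q1 (\tr (iota T *m P *m (iota T' *m P))) =
  q1 (\tr (iota T *m Proj v *m (iota T' *m Proj v))).
Proof.
move=> TX TX' [g /UUP[X KX ->] <-]; rewrite /act adjqE; apply: q1_tr_conj2.
- by rewrite adj_iota -iotaM (Kgrp_mulmxV KX) iota1.
- by rewrite -iotaM TX // iotaM.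
- by rewrite -iotaM TX' // iotaM.
Qed.

Lemma mul_tangent (T1 T2 : 'M[H]_n) v w :
  adj v *m (T1 *m (w *m adj v + v *m adj w) *m T2 *m v) =
  (adj v *m T1 *m w) *m (adj v *m T2 *m v) + (adj v *m T1 *m v) *m (adj w *m T2 *m v).
Proof.
by rewrite mulmxDr !mulmxDl mulmxDr; congr (_ + _); rewrite -!mulmxA.
Qed.

Lemma mx11B (x y : 'M[H]_1) : (x - y) 0 0 = x 0 0 - y 0 0.
Proof. by rewrite !mxE. Qed.

(** This is cyclicity of the real part. For [x = v^* i D_b w] the difference [x - conjq x] is the
    velocity of the moment. *)
Lemma q1_gram_variation (x x' p p' : H) :
  q1 (x * p' - p * conjq x') + q1 (x' * p - p' * conjq x) = 0 ->
  q1 ((x - conjq x) * p' + p * (x' - conjq x')) = 0.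
Proof. by move=> e; rewrite -[RHS]e /=; ring. Qed.

(* The Gram matrix of the two moments is constant on orbits, hence along [g] they
   vary by an infinitesimal rotation, and [solve_skew] applies. *)
Lemma orbit_velocity v (g : R -> 'M[H]_n) : nondeg k v -> unitv v -> smooth_curve g ->
  (forall t, orbit G (Proj v) (g t)) -> g 0 = Proj v ->
  exists X, [/\ supp blk X, X ^t* = - X & velocity g 0 = bracket (iota X) (Proj v)].
Proof.
move=> nd v1 sg og g0.
have [aE EP] := HP_velocity 0 sg (fun t => orbit_HP v1 (og t)).
have [E E0] : {E | E = velocity g 0} by exists (velocity g 0).
rewrite -E0 in aE EP *; rewrite g0 in EP.
have [vw EE] := tangent_Proj v1 aE EP.
have [w wE] : {w | w = E *m v} by exists (E *m v).
rewrite -wE in vw EE.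
pose T b : 'M[C]_n := iC R *: D R n k b.
have TX b X : Kgrp blk X -> T b *m X = X *m T b by move=> KX; apply/iDC/D_KgrpC.
pose a b : 'M[H]_1 := adj v *m iota (T b) *m w.
have wT b : adj w *m iota (T b) *m v = - adj (a b).
  by rewrite /a !adjM adjK adj_iD mulNmx mulmxN opprK mulmxA.
have [p pE] : {p : bool -> H | forall b, p b = moment k b v 0 0}.
  exact: (exist _ (fun b => moment k b v 0 0) (fun=> erefl)).
have [x xE] : {x : bool -> H | forall b, x b = a b 0 0}.
  exact: (exist _ (fun b => a b 0 0) (fun=> erefl)).
have xJ b : adj (a b) 0 0 = conjq (x b) by rewrite adjE xE.
have trE b c : q1 (\tr (iota (T b) *m E *m (iota (T c) *m Proj v))) =
    q1 (x b * p c - p b * conjq (x c)).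
  rewrite /Proj (mulmxA (iota (T c))) (mulmxA (iota (T b) *m E)).
  rewrite (mulmxA (iota (T b) *m E) (iota (T c))) q1_tr_col.
  rewrite {1}EE mul_tangent; congr q1; rewrite mxE wT mx11M.
  rewrite [X in _ + X]mx11M [(- adj (a c)) 0 0]mxE xJ mulrN.
  by rewrite (xE b) (pE b) (pE c).
have inv b c : q1 ((x b - conjq (x b)) * p c + p b * (x c - conjq (x c))) = 0.
  have sc d : smooth_curve (fun t => iota (T d) *m g t).
    exact: smooth_curveM (smooth_curve_cst _) sg.
  have vc d : velocity (fun t => iota (T d) *m g t) 0 = iota (T d) *m E.
    by rewrite (velocityM _ (smooth_curve_cst _) sg) velocity_cst mul0mx add0r E0.
  apply: q1_gram_variation; rewrite -!trE.
  have := q1_tr_const 0 (smooth_curveM (sc b) (sc c))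
    (fun t => orbit_invariant (TX b) (TX c) (og t)).
  rewrite (velocityM _ (sc b) (sc c)) !vc g0 mxtraceD q1D.
  by rewrite (q1_mxtraceC (iota (T b) *m Proj v) (iota (T c) *m E)).
(* The norms of the two blocks are invariants as well, through the real trace of [D_b P]. *)
have rD b : q1 ((adj v *m iota (D R n k b) *m w) 0 0) = 0.
  have sc : smooth_curve (fun t => iota (D R n k b) *m g t).
    exact: smooth_curveM (smooth_curve_cst _) sg.
  have cst t : q1 (\tr (iota (D R n k b) *m g t)) = q1 (\tr (iota (D R n k b) *m Proj v)).
    have [h /UUP[X KX ->] <-] := og t; rewrite /act adjqE !mulmxA -iotaM D_KgrpC //.
    rewrite iotaM -!mulmxA q1_mxtraceC -!mulmxA adj_iota -iotaM (Kgrp_mulmxV KX).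
    by rewrite iota1 mulmx1.
  have := q1_tr_const 0 sc cst.
  rewrite (velocityM _ (smooth_curve_cst _) sg) velocity_cst mul0mx add0r -E0 EE.
  rewrite mulmxDr raddfD q1D 2!mulmxA !q1_tr_col !mulmxA.
  have -> : q1 ((adj w *m iota (D R n k b) *m v) 0 0) =
      q1 ((adj v *m iota (D R n k b) *m w) 0 0).
    rewrite -[RHS]/(q1 (conjq _)) -adjE !adjM adjK adj_iota D_adj mulmxA.
    by [].
  by move=> e; lra.
have am b : conjq (x b - conjq (x b)) = - (x b - conjq (x b)).
  by rewrite raddfB /= conjqK opprB.
have pJ b : conjq (p b) = - p b by rewrite pE moment_conj.
have pp : p true * p false != p false * p true.
  apply/eqP; rewrite (pE true) (pE false) => e; case: nd => _; apply; apply: mx11_eq.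
  rewrite [LHS](mx11M (moment k true v) (moment k false v)).
  rewrite [RHS](mx11M (moment k false v) (moment k true v)).
  exact: e.
have half b : q1 ((x b - conjq (x b)) * p b) = 0.
  by have := inv b b; rewrite q1D [X in _ + X]q1_mulC => e; lra.
have [h ah [h1 h2]] := gram_rotation (pJ true) (pJ false) pp
  (am true) (am false) (half true) (half false) (inv true false).
have {h1 h2} hE b : x b - conjq (x b) = p b * h - h * p b by case: b.
have ahM : adj h%:M = - h%:M :> 'M[H]_1 by rewrite adj_scalar ah raddfN.
have [hB _] := nd; have [B1 B1D B1v] := hB true; have [B2 B2D B2v] := hB false.
(* Right multiplication of [v] by the imaginary [h] does not move the line. Subtracting [v h]
   removes the rotation of the moments, as [solve_skew] requires. *)
pose z := w - v *m h%:M.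
have [||||X [sX XJ Xz _]] := @solve_skew R n k v z (fun b => if b then B1 else B2).
- by case.
- by case.
- move=> b s; apply: mx11_eq; rewrite adjE.
  have -> : s 0 0 = x b - p b * h.
    rewrite /s /z mulmxBr mx11B (xE b) (pE b) mulmxA; congr (_ - _).
    by rewrite mx11M [h%:M 0 0]mxE mulr1n.
  rewrite raddfB /= conjqM ah pJ mulrNN.
  rewrite -[x b in RHS](subrK (conjq (x b))) hE addrAC.
  by rewrite [p b * h - _]addrC addrK addrC.
- move=> b; rewrite /z mulmxBr mx11B q1D rD add0r q1N mulmxA mx11M [h%:M 0 0]mxE mulr1n.
  set y := _ *m v.
  have ay : conjq (y 0 0) = y 0 0.
    by rewrite -adjE /y !adjM adjK adj_iota D_adj mulmxA.
  by rewrite (conjq_self ay) /= (conjq_anti ah); ring.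
exists X; split=> //; rewrite (bracket_Proj _ XJ) Xz EE /z.
rewrite adjB adjM ahM mulmxBl mulmxBr mulNmx mulmxN opprK !mulmxA.
by rewrite addrACA addNr addr0.
Qed.

End Tangents.

(** * Tangent spaces of orbits and of the projective space *)

Section TangentSpaces.
Variables (R : realType) (n k : nat).
Local Notation H := (quat R).
Local Notation C := (R[i]).
Implicit Types (v w y z : 'cV[H]_n) (b : bool) (X : 'M[C]_n).
Local Notation G := (UU R n k).
Local Notation blk := (@blk n k).

Lemma tangent_act (N : set 'M[H]_n) P (g : R -> 'M[H]_n) (F : 'M[H]_n) :
  smooth_curve g -> (forall t, N (act (g t) P)) -> g 0 = 1%:M -> velocity g 0 = F ->
  adj F = - F -> tangent N P (bracket F P).
Proof.
move=> sg Ng g0 vg aF; have sgP := smooth_curveM sg (smooth_curve_cst P).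
have E : (fun t => act (g t) P) = fun t => g t *m P *m adj (g t).
  by apply/funext => t; rewrite /act adjqE.
exists (fun t => act (g t) P); split.
- by rewrite E; exact: smooth_curveM sgP (smooth_curve_adj sg).
- exact: Ng.
- by rewrite g0 /act adjqE adj1 mul1mx mulmx1.
rewrite E (velocityM _ sgP (smooth_curve_adj sg)) (velocity_adj _ sg).
rewrite (velocityM _ sg (smooth_curve_cst P)) velocity_cst mulmx0 addr0 vg g0 adj1.
by rewrite mulmx1 mul1mx aF mulmxN.
Qed.

Lemma tangent_orbitE v : nondeg k v -> unitv v ->
  tangent (orbit G (Proj v)) (Proj v) =
  [set bracket (iota X) (Proj v) | X in [set X | supp blk X /\ X ^t* = - X]].
Proof.
move=> nd v1; apply/seteqP; split=> [_ [g [sg og g0 <-]]|_ [X [sX XJ] <-]].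
  by have [X [sX XJ ->]] := orbit_velocity nd v1 sg og g0; exists X.
have [g [sg Kg g0 vg]] := Kcurve_skew (@blk_sym n k) (@blk_trans n k) sX XJ.
apply: (tangent_act sg) => //.
- by move=> t; exists (iota (g t)) => //; apply/UUP; exists (g t).
- by rewrite g0 iota1.
- by rewrite adj_iota XJ iotaN.
Qed.

(** The differential of [v |-> v v^*] in the direction [y]. *)
Definition tvec v y : 'M[H]_n := y *m adj v + v *m adj y.

Lemma adj_tvec v y : adj (tvec v y) = tvec v y.
Proof. by rewrite /tvec adjD !adjM !adjK addrC. Qed.

Lemma tvec_mul v y : unitv v -> adj v *m y = 0 -> tvec v y *m v = y.
Proof.
move=> v1 vy; have yv : adj y *m v = 0 by rewrite -[v]adjK -adjM vy adj0.
by rewrite /tvec mulmxDl -!mulmxA v1 yv mulmx1 mulmx0 addr0.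
Qed.

Lemma tangent_HPE v : unitv v -> tangent (HP R n) (Proj v) =
  [set tvec v y | y in [set y | adj v *m y = 0]].
Proof.
move=> v1; apply/seteqP; split=> [_ [g [sg HPg g0 <-]]|_ [y /= vy <-]].
  have [aE EP] := HP_velocity 0 sg HPg; rewrite g0 in EP.
  have [vE EE] := tangent_Proj v1 aE EP.
  by exists (velocity g 0 *m v).
have yv : adj y *m v = 0 by rewrite -[v]adjK -adjM vy adj0.
have yyE : exists2 c : R, adj y *m y = (real_quat (c ^+ 2))%:M & c = 0 -> y = 0.
  have ss : (adj y *m y) 0 0 = real_quat (\sum_i sqnorm (y i 0)).
    rewrite mxE rmorph_sum; apply: eq_bigr => i _.
    by rewrite adjE mul_conjq.
  have s0 : 0 <= \sum_i sqnorm (y i 0) by apply: sumr_ge0 => i _; exact: sqnorm_ge0.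
  exists (Num.sqrt (\sum_i sqnorm (y i 0))).
    by rewrite sqr_sqrtr // -ss -mx11_scalar.
  move/eqP; rewrite sqrtr_eq0 => s0'; apply: q1_tr_adj_eq0.
  by rewrite trace_mx11 ss; apply/eqP; rewrite eq_le s0 s0'.
have [c yy c0] := yyE.
have [/c0 y0|cN0] := eqVneq c 0.
  exists (fun=> Proj v); split.
  - exact: smooth_curve_cst.
  - by move=> _; exact: HP_Proj.
  - by [].
  - by rewrite velocity_cst /tvec y0 adj0 mul0mx mulmx0 addr0.
(* The generator of the rotation of [v] towards [y]. As [c] is the norm of [y], it satisfies
   [F^3 = - c^2 F]. *)
pose F := y *m adj v - v *m adj y.
have aF : adj F = - F by rewrite /F adjB !adjM !adjK opprB.
have Fv : F *m v = y by rewrite /F mulmxBl -!mulmxA v1 yv mulmx1 mulmx0 subr0.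
have Fy : F *m y = - (real_quat (c ^+ 2) *: v).
  rewrite /F mulmxBl -!mulmxA vy mulmx0 sub0r yy; congr (- _).
  apply/matrixP => i j; rewrite !ord1 !mxE big_ord1 !mxE mulr1n.
  by rewrite real_quatC.
have F3 : F *m F *m F = - (real_quat (c ^+ 2) *: F).
  have FFy : F *m (F *m y) = - (real_quat (c ^+ 2) *: y).
    by rewrite Fy mulmxN scaleq_mull Fv.
  have FFv : F *m (F *m v) = - (real_quat (c ^+ 2) *: v) by rewrite Fv Fy.
  rewrite -mulmxA {3}/F 2!mulmxBr (mulmxA F y) (mulmxA F (F *m y)) FFy.
  rewrite (mulmxA F v) (mulmxA F (F *m v)) FFv !mulNmx -!scalemxAl opprK.
  by rewrite /F scalerBr opprB addrC.
have [a [b [sg g0 vg ug]]] := exp_curve cN0 aF F3.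
set g := (fun t => _) in sg g0 vg ug.
have -> : tvec v y = bracket F (Proj v).
  rewrite /bracket /Proj mulmxA Fv /F mulmxBr !mulmxA -(mulmxA v (adj v) y) vy.
  by rewrite mulmx0 mul0mx sub0r -(mulmxA v (adj v) v) v1 mulmx1 opprK.
apply: (tangent_act sg) => //.
move=> t; rewrite act_Proj; apply: HP_Proj; apply: unitvM => //.
by have [] := ug t.
Qed.

End TangentSpaces.

(** * Dimension of the quaternionic projective space *)

Section DimHP.
Variables (R : realType) (m : nat).
Local Notation n := m.+1.
Local Notation H := (quat R).
Implicit Types v y : 'cV[H]_n.

(** Real coordinates for the vectors whose entry [i0] vanishes. These form a complement of the line
    of [v] when [v i0 0] is not zero. *)
Definition fill (i0 : 'I_n) (a : 'rV[R]_(m * 4)) : 'cV[H]_n :=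
  \col_i if unlift i0 i is Some j then
    let M : 'M[R]_(m, 4) := vec_mx a in
    Quat (M j (inord 0)) (M j (inord 1)) (M j (inord 2)) (M j (inord 3)) else 0.

Lemma fillD i0 a b : fill i0 (a + b) = fill i0 a + fill i0 b.
Proof.
apply/colP => i; rewrite !mxE; case: unlift => [j|]; last by rewrite addr0.
by rewrite !linearD /= !mxE.
Qed.

Lemma fillZ i0 c a : fill i0 (c *: a) = real_quat c *: fill i0 a.
Proof.
apply/colP => i; rewrite !mxE; case: unlift => [j|]; last by rewrite mulr0.
by rewrite !linearZ /= !mxE; apply: quat_eqP; split; rewrite /=; ring.
Qed.

Lemma fill_eq0 i0 a : fill i0 a = 0 -> a = 0.
Proof.
move=> fa; apply: (can_inj vec_mxK); rewrite linear0; apply/matrixP => j l.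
have : fill i0 a (lift i0 j) 0 = 0 by rewrite fa mxE.
rewrite [fill _ _ _ _]mxE liftK => -[h0 h1 h2 h3]; rewrite [RHS]mxE.
have -> : vec_mx a j l = vec_mx a j (inord l) by rewrite inord_val.
by case: l => -[|[|[|[|//]]]] /=.
Qed.

Lemma fill_surj i0 (y : 'cV[H]_n) : y i0 0 = 0 -> exists a, y = fill i0 a.
Proof.
move=> y0; exists (mxvec (\matrix_(j < m, l < 4)
  let q := y (lift i0 j) 0 in nth 0 [:: q1 q; qi q; qj q; qk q] l)).
apply/colP => i; rewrite mxE; case: unliftP => [j ->|->//].
rewrite /= mxvecK !mxE !inordK //=.
by case: (y _ _).
Qed.

Lemma tvecD v y z : tvec v (y + z) = tvec v y + tvec v z.
Proof. by rewrite /tvec mulmxDl adjD mulmxDr addrACA. Qed.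

Lemma tvecZ v c y : tvec v (real_quat c *: y) = real_quat c *: tvec v y.
Proof. by rewrite /tvec -scalemxAl adj_scaleq scaleq_mull -scalerDr. Qed.

Lemma has_dim_tangent_HP v : unitv v -> has_dim (tangent (HP R n) (Proj v)) (m * 4).
Proof.
move=> v1; have [i0 vi0] : exists i0, v i0 0 != 0.
  apply: contrapT => /forallNP v0; have v00 : v = 0.
    by apply/colP => i; rewrite mxE; apply/eqP; have /negP := v0 i; rewrite negbK.
  have /matrixP/(_ 0 0) := v1; rewrite v00 mulmx0 !mxE eqxx => /esym/eqP.
  by rewrite oner_eq0.
pose pr y := y - v *m (adj v *m y).
have pr0 y : adj v *m pr y = 0 by rewrite /pr mulmxBr (mulmxA (adj v) v) v1 mul1mx subrr.
have prD y z : pr (y + z) = pr y + pr z.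
  by rewrite /pr !mulmxDr opprD addrACA.
have prZ c y : pr (real_quat c *: y) = real_quat c *: pr y.
  by rewrite /pr !scaleq_mull scalerBr.
apply: (@has_dim_lin R n _ (m * 4) (fun a => tvec v (pr (fill i0 a)))).
- by move=> a b; rewrite fillD prD tvecD.
- by move=> c a; rewrite fillZ prZ tvecZ.
- move=> a /(congr1 (mulmx^~ v)); rewrite tvec_mul // mul0mx => /subr0_eq fE.
  have /colP/(_ i0) := fE; rewrite [LHS]mxE unlift_none mxE big_ord1 => /esym.
  case/mulq_eq0 => [/eqP|q0]; first by rewrite (negbTE vi0).
  apply: (@fill_eq0 i0); rewrite fE (_ : adj v *m _ = 0) ?mulmx0 //.
  by apply/matrixP => i j; rewrite !ord1 q0 mxE.
rewrite tangent_HPE //; apply/seteqP; split=> [_ [w /= vw <-]|_ [a _ <-]].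
  have [u uv vu] := invq_exists vi0.
  (* [v q] has the same entry [i0] as [w], and [pr] sends [w - v q] back to [w]. *)
  pose q : 'M[H]_1 := (u * w i0 0)%:M.
  have [|a ya] := @fill_surj i0 (w - v *m q).
    by rewrite !mxE big_ord1 mxE eqxx mulr1n mulrA uv mul1r subrr.
  exists a => //; rewrite -ya /pr mulmxBr vw (mulmxA (adj v)) v1 mul1mx sub0r.
  by rewrite mulmxN opprK subrK.
by exists (pr (fill i0 a)).
Qed.

End DimHP.

(** * Failure of quaternion-coisotropy *)

Section Coisotropic.
Variables (R : realType) (n k : nat).
Local Notation H := (quat R).
Local Notation C := (R[i]).
Implicit Types (v w y z : 'cV[H]_n) (b : bool) (X : 'M[C]_n).
Local Notation G := (UU R n k).
Local Notation blk := (@blk n k).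

Lemma inner_tvec v y z : unitv v -> adj v *m y = 0 ->
  inner (tvec v y) (tvec v z) = q1 ((adj y *m z) 0 0) *+ 2.
Proof.
move=> v1 vy; have yv : adj y *m v = 0 by rewrite -[v]adjK -adjM vy adj0.
rewrite /inner adjqE adj_tvec {2}/tvec mulmxDr mxtraceD q1D.
rewrite (mulmxA (tvec v y) z) (mulmxA (tvec v y) v) tvec_mul // !q1_tr_col.
rewrite (mulmxA (adj v)).
have -> : adj v *m tvec v y = adj y.
  by rewrite -[LHS]adjK adjM adjK adj_tvec tvec_mul.
rewrite mulr2n; congr (_ + _).
by rewrite -[RHS]/(q1 (conjq _)) -adjE adjM adjK.
Qed.

Lemma q1_mx11Z c (x : 'M[H]_1) : q1 ((real_quat c *: x) 0 0) = c * q1 (x 0 0).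
Proof. by rewrite mxE /=; ring. Qed.

Lemma q1_mx11ZB c d (x y : 'M[H]_1) :
  q1 ((real_quat c *: x - real_quat d *: y) 0 0) = c * q1 (x 0 0) - d * q1 (y 0 0).
Proof. by rewrite mx11B q1D q1N !q1_mx11Z. Qed.

(** On horizontal lifts the element of [quatK] given by [q] acts as right multiplication by [q]. *)
Lemma quatK_tvec v y (q : 'M[H]_1) : unitv v -> adj v *m y = 0 -> adj q = - q ->
  bracket (tvec v y) (v *m q *m adj v) = tvec v (y *m q).
Proof.
move=> v1 vy aq; rewrite /bracket mulmxA (mulmxA _ v) tvec_mul //.
have -> : v *m q *m adj v *m tvec v y = - (v *m adj (y *m q)).
  rewrite -[tvec v y]adj_tvec -(mulmxA _ (adj v)) -adjM tvec_mul // adjM aq.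
  by rewrite mulNmx mulmxN opprK mulmxA.
by rewrite opprK.
Qed.

Lemma iD_mul b c : D R n k b *m (iC R *: D R n k c) =
  if b == c then iC R *: D R n k c else 0.
Proof.
rewrite -scalemxAr; have [<-|bc] := eqVneq b c; first by rewrite D_idem.
have -> : D R n k c = 1%:M - D R n k b.
  by rewrite -(D_sum R n k); case: b c bc => [] [] //= _; rewrite ?addrK // addrC addKr.
by rewrite mulmxBr mulmx1 D_idem subrr scaler0.
Qed.

(* The normal vectors [y0], [y1] are gradients of invariants of the action; the
   imaginary part of [y0^* y1] is a multiple of the commutator of the moments,
   so some [J] in [Q] maps [y0] to a vector that is not orthogonal to [y1]. *)
Lemma not_coisotropic v : nondeg k v -> unitv v ->
  ~ quaternion_coisotropic (orbit G (Proj v)).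
Proof.
move=> nd v1 coiso.
have [p pE] : {p : bool -> 'M[H]_1 | forall b, p b = moment k b v}.
  exact: (exist _ (fun b => moment k b v) (fun=> erefl)).
have [E EE] : {E : bool -> 'M[H]_n | forall b, E b = iota (D R n k b)}.
  exact: (exist _ (fun b => iota (D R n k b)) (fun=> erefl)).
have [T TE] : {T : bool -> 'M[H]_n | forall b, T b = iota (iC R *: D R n k b)}.
  exact: (exist _ (fun b => iota (iC R *: D R n k b)) (fun=> erefl)).
have EJ b : adj (E b) = E b by rewrite EE adj_iota D_adj.
have TJ b : adj (T b) = - T b by rewrite TE adj_iD.
have ET b c : E b *m T c = if b == c then T c else 0.
  by rewrite EE TE -iotaM iD_mul; case: eqP => // _; rewrite iota0.
have E1 : E true + E false = 1%:M by rewrite !EE -iotaD D_sum iota1.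
have pJ b : adj (p b) = - p b by rewrite pE adj_moment.
have pT b : adj v *m T b *m v = p b by rewrite pE TE.
have ppJ b c : adj (p b *m p c) = p c *m p b.
  by rewrite adjM !pJ mulNmx mulmxN opprK.
have [nu nuE] : {nu : bool -> R | forall b, adj v *m E b *m v = (real_quat (nu b))%:M}.
  exists (fun b => q1 ((adj v *m E b *m v) 0 0)) => b.
  rewrite [LHS]mx11_scalar; congr (_%:M); apply: conjq_self.
  by rewrite -adjE !adjM adjK EJ mulmxA.
have nu1 : nu true + nu false = 1.
  have : adj v *m (E true + E false) *m v = 1%:M by rewrite E1 mulmx1.
  rewrite mulmxDr mulmxDl !nuE => /matrixP/(_ 0 0).
  by rewrite !mxE eqxx !mulr1n => /(congr1 (@q1 R)).
have [y0 y0E] : {y0 | y0 = real_quat (nu false) *: (E true *m v) -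
  real_quat (nu true) *: (E false *m v)} by eexists.
have [s sD] : {s | s = p true *m p false + p false *m p true} by eexists.
have [y1 y1E] : {y1 | y1 = T true *m v *m p false + T false *m v *m p true - v *m s}.
  by eexists.
have vy0 : adj v *m y0 = 0.
  rewrite y0E mulmxBr !scaleq_mull !mulmxA !nuE; apply: mx11_eq.
  by rewrite !mxE eqxx !mulr1n -!rmorphM mulrC subrr.
have vy1 : adj v *m y1 = 0.
  by rewrite y1E mulmxBr mulmxDr !mulmxA !pT v1 mul1mx sD subrr.
have tv y : adj v *m y = 0 -> tangent (HP R n) (Proj v) (tvec v y).
  by move=> vy; rewrite tangent_HPE //; exists y.
have orth y : adj v *m y = 0 ->
    (forall X, supp blk X -> X ^t* = - X -> q1 ((adj y *m (iota X *m v)) 0 0) = 0) ->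
    normal (orbit G (Proj v)) (Proj v) (tvec v y).
  move=> vy yX; split; first exact: tv.
  move=> w; rewrite tangent_orbitE // => -[X [sX XJ] <-].
  by rewrite (bracket_Proj _ XJ) -/(tvec v _) inner_tvec // yX // mul0rn.
have aX X : X ^t* = - X -> adj (iota X) = - iota X.
  by move=> XJ; rewrite adj_iota XJ iotaN.
(* As [X] commutes with [D_b], the matrix [D_b X] is skew-hermitian and [i D_b X] is hermitian. So
   the first pairing is imaginary and the next one real, which is what makes [y0] and [y1]
   normal. *)
have qE b X : supp blk X -> X ^t* = - X -> q1 ((adj v *m E b *m (iota X *m v)) 0 0) = 0.
  move=> sX XJ; apply: conjq_anti; rewrite -adjE !adjM adjK EJ aX //.
  rewrite mulmxN mulNmx mxE; congr (- _); rewrite -!mulmxA.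
  by rewrite (mulmxA (E b)) (mulmxA (iota X)) EE -!iotaM D_suppC.
have qT b X : supp blk X -> X ^t* = - X ->
    exists c, adj v *m T b *m (iota X *m v) = (real_quat c)%:M.
  move=> sX XJ; exists (q1 ((adj v *m T b *m (iota X *m v)) 0 0)).
  rewrite [LHS]mx11_scalar; congr (_%:M); apply: conjq_self.
  rewrite -adjE !adjM adjK TJ aX // !(mulmxN, mulNmx) opprK -!mulmxA.
  by rewrite (mulmxA (T b)) (mulmxA (iota X)) TE -!iotaM iDC // D_suppC.
have q1real (q : 'M[H]_1) c : adj q = - q -> q1 ((q *m (real_quat c)%:M) 0 0) = 0.
  move=> aq; rewrite mx11M [X in _ * X]mxE eqxx mulr1n -real_quatC /=.
  have -> : q1 (q 0 0) = 0 by apply: conjq_anti; rewrite -adjE aq mxE.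
  by ring.
have n0 : normal (orbit G (Proj v)) (Proj v) (tvec v y0).
  apply: orth => // X sX XJ; rewrite y0E adjB !adj_scaleq !adjM !EJ mulmxBl.
  rewrite -(scalemxAl (real_quat (nu false))) -(scalemxAl (real_quat (nu true))).
  rewrite q1_mx11ZB (qE true X sX XJ) (qE false X sX XJ).
  by rewrite !mulr0 subrr.
have sJ : adj s = s.
  by rewrite sD adjD !ppJ addrC.
have [r sE] : exists r, s = (real_quat r)%:M.
  exists (q1 (s 0 0)); rewrite [LHS]mx11_scalar; congr (_%:M).
  by apply: conjq_self; rewrite -adjE sJ.
have n1 : normal (orbit G (Proj v)) (Proj v) (tvec v y1).
  apply: orth => // X sX XJ; rewrite y1E adjB adjD !adjM !TJ !pJ sJ.
  have [c1 e1] := qT true X sX XJ; have [c2 e2] := qT false X sX XJ.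
  have [q qE'] : {q | q = iota X *m v} by eexists.
  rewrite -qE' in e1 e2 *.
  have e3 : adj (adj v *m q) = - (adj v *m q).
    by rewrite qE' !adjM adjK (aX _ XJ) mulmxN mulNmx mulmxA.
  have -> : (- p false *m (adj v *m - T true) + - p true *m (adj v *m - T false)
      - s *m adj v) *m q = p false *m (adj v *m T true *m q) +
      p true *m (adj v *m T false *m q) - s *m (adj v *m q).
    rewrite mulmxBl mulmxDl; congr (_ - _); first congr (_ + _).
    - by rewrite !(mulmxN, mulNmx) opprK -!mulmxA.
    - by rewrite !(mulmxN, mulNmx) opprK -!mulmxA.
    - by rewrite -!mulmxA.
  have q0 : q1 ((adj v *m q) 0 0) = 0 by apply: conjq_anti; rewrite -adjE e3 mxE.
  rewrite e1 e2 mx11B q1D q1N sE mul_scalar_mx q1_mx11Z q0 mulr0 oppr0 addr0.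
  by rewrite mxE q1D (q1real (p false)) // (q1real (p true)) // addr0.
(* With the commutator itself as [q], the real part of [y1^* y0 q] is half the squared norm of [q],
   because [nu true + nu false = 1]. *)
have [q qD] : {q | q = p true *m p false - p false *m p true} by eexists.
have qJ : adj q = - q.
  rewrite qD [LHS]adjB [RHS]opprB; congr (_ - _).
  - exact: (ppJ true false).
  - exact: (ppJ false true).
have TEv b c : adj v *m T b *m (E c *m v) = if b == c then p b else 0.
  rewrite -mulmxA (mulmxA (T b)) -[T b *m E c]adjK adjM EJ TJ mulmxN ET eq_sym.
  case: eqP => [_|_]; last by rewrite oppr0 adj0 mul0mx mulmx0.
  by rewrite adjN TJ opprK mulmxA pT.
have y10 : adj y1 *m y0 = real_quat (nu false) *: (p false *m p true) -
    real_quat (nu true) *: (p true *m p false).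
  rewrite y1E adjB adjD !adjM !TJ !pJ sJ mulmxBl -(mulmxA s) vy0 mulmx0 subr0.
  have eT b : adj v *m T b *m y0 =
      if b then real_quat (nu false) *: p true else - (real_quat (nu true) *: p false).
    have h c d : adj v *m T b *m (real_quat c *: (E d *m v)) =
        real_quat c *: (if b == d then p b else 0) by rewrite scaleq_mull TEv.
    rewrite y0E mulmxBr (h _ true) (h _ false).
    by case: b {h} => /=; rewrite scaler0 ?subr0 ?sub0r.
  rewrite mulmxDl; congr (_ + _).
    rewrite !(mulmxN, mulNmx) opprK -!mulmxA (mulmxA (adj v)) (eT true).
    by rewrite scaleq_mull.
  rewrite !(mulmxN, mulNmx) opprK -!mulmxA (mulmxA (adj v)) (eT false) mulmxN.
  by rewrite scaleq_mull.
have JS : quatK (Proj v) (fun F : 'M[H]_n => bracket F (v *m q *m adj v)).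
  exists (v *m q *m adj v) => //; split.
  - by rewrite adjqE !adjM adjK qJ mulNmx mulmxN mulmxA.
  - by rewrite !mulmxA Proj_mul.
  - by rewrite -mulmxA mul_Proj.
have oP : orbit G (Proj v) (Proj v).
  exists 1%:M; last by rewrite /act adjqE adj1 mul1mx mulmx1.
  by apply/UUP; exists 1%:M; [exact: Kgrp1 | rewrite iota1].
have JT : tangent (orbit G (Proj v)) (Proj v) (bracket (tvec v y0) (v *m q *m adj v)).
  by apply: (coiso _ oP _ JS); exists (tvec v y0).
have := n1.2 _ JT; rewrite quatK_tvec // inner_tvec // mulmxA y10 => /eqP.
rewrite mulrn_eq0 /= => /eqP.
have pN b : q1 (p b 0 0) = 0 by apply: conjq_anti; rewrite -adjE pJ mxE.
have -> : q1 (((real_quat (nu false) *: (p false *m p true) -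
    real_quat (nu true) *: (p true *m p false)) *m q) 0 0) =
    (nu true + nu false) / 2 * sqnorm (q 0 0).
  rewrite (mx11M _ q) mx11B [X in (X - _) * _]mxE [X in (_ - X) * _]mxE qD.
  rewrite mx11B (mx11M (p true)) (mx11M (p false)).
  move: (p true 0 0) (p false 0 0) (pN true) (pN false) => P Q.
  by case: P Q => [a b c' d] [a' b' c'' d'] /= -> ->; rewrite /sqnorm /=; field.
rewrite nu1 mul1r => /eqP; rewrite mulf_eq0 invr_eq0 pnatr_eq0 /= sqnorm_eq0 => /eqP q0.
case: nd => _; apply; apply/eqP; rewrite -subr_eq0 -!pE -qD; apply/eqP.
by apply: mx11_eq; rewrite q0 mxE.
Qed.

End Coisotropic.

(** * Normal form and principal isotropy *)

Section Selections.
Variables (R : realType) (n : nat).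
Local Notation C := (R[i]).

Lemma projM (c c' : pred 'I_n) : proj R c *m proj R c' = proj R [predI c & c'].
Proof. by apply/matrixP => i j; rewrite proj_mul !mxqE /= mulrnAr -natrM mulnb. Qed.

Lemma eq_proj (c c' : pred 'I_n) : c =1 c' -> proj R c = proj R c'.
Proof. by move=> cc'; apply/matrixP => i j; rewrite !mxqE cc'. Qed.

Definition itv m off : pred 'I_n := [pred i : 'I_n | (off <= i < off + m)%N].

Definition selm m off : 'M[C]_(m, n) :=
  \matrix_(i < m, j < n) ((j : nat) == off + i)%N%:R.

Lemma selmK m off : (off + m <= n)%N -> selm m off *m (selm m off) ^t* = 1%:M.
Proof.
move=> le; apply/matrixP => i j; rewrite mxE.
have lti : (off + i < n)%N by rewrite (leq_trans _ le) // ltn_add2l.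
rewrite (bigD1 (Ordinal lti)) //= big1 ?addr0 => [|l li].
  by rewrite tmxCE !mxqE eqxx mul1r conjC_nat eqn_add2l.
by rewrite mxE (_ : (_ == _ :> nat) = false) ?mul0r //; apply/negbTE.
Qed.

Lemma mul_selm m off : (selm m off) ^t* *m selm m off = proj R (itv m off).
Proof.
apply/matrixP => i j; rewrite !mxqE.
under eq_bigr => l _ do rewrite tmxCE !mxqE conjC_nat -natrM mulnb.
have [|Ni] := boolP (itv m off i); last first.
  rewrite mul0rn big1 // => l _; case: eqP => //= il; case/negP: Ni.
  by rewrite /itv /= il leq_addr ltn_add2l ltn_ord.
rewrite /itv /= => /andP[le lt]; have lti : (i - off < m)%N by lia.
rewrite (bigD1 (Ordinal lti)) //= big1 ?addr0 => [|l li].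
  by rewrite subnKC // eqxx /= eq_sym.
case: eqP => //= il; case/eqP: li; apply/val_inj => /=; lia.
Qed.

Lemma selm_proj m off (c : pred 'I_n) : (forall i, itv m off i -> c i) ->
  selm m off *m proj R c = selm m off.
Proof.
move=> mc; apply/matrixP => i j; rewrite mul_proj mxE.
case: eqP => [ji|]; last by rewrite mul0r.
by rewrite mc ?mulr1 // /itv /= ji leq_addr ltn_add2l ltn_ord.
Qed.

Lemma card_itv m off : (off + m <= n)%N -> (\sum_(i < n) itv m off i)%N = m.
Proof.
move=> le; rewrite -(big_mkord xpredT (fun i => (off <= i < off + m)%N : nat)) /=.
rewrite (@big_cat_nat _ _ _ off) //=; last by lia.
rewrite (@big_cat_nat _ _ _ (off + m) off) //=; last by lia.
rewrite !big_nat big1 ?add0n; last by move=> i /andP[_ lt]; rewrite leqNgt lt.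
rewrite [X in (_ + X)%N]big1 ?addn0; last by move=> i /andP[le' _]; rewrite ltnNge le' andbF.
rewrite (eq_bigr (fun=> 1%N)) => [|i ->//].
by rewrite -big_nat sum_nat_const_nat muln1 addKn.
Qed.

End Selections.

(** * Vectors supported in two coordinates of each block *)

Section Slice.
Variables (R : realType) (n k : nat).
Hypotheses (hk : (2 <= k)%N) (hn : (k + 2 <= n)%N).
Local Notation H := (quat R).
Local Notation C := (R[i]).
Implicit Types (v w y z : 'cV[H]_n) (b : bool) (X : 'M[C]_n).
Local Notation G := (UU R n k).
Local Notation blk := (@blk n k).
Local Notation D := (D R n k).

(** The coordinates to which reflections in the two blocks can confine a vector. *)
Definition inS : pred 'I_n := [pred i : 'I_n | (i < 2)%N || (k <= i < k + 2)%N].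

Definition PiS : 'M[C]_n := proj R inS.

(** [Kgrp offS] is [U(k-2) x U(n-k-2)]; as the relation is not reflexive on the slice, this group
    fixes the slice coordinates. *)
Definition offS := [rel i j : 'I_n | [&& blk i j, ~~ inS i & ~~ inS j]].

Lemma offS_sym : symmetric offS.
Proof. by move=> i j; rewrite /offS /= -/(blk i j) -/(blk j i) blk_sym (andbC (~~ inS i)). Qed.

Lemma offS_trans : transitive offS.
Proof.
move=> j i l; rewrite /offS /= => /and3P[bij -> _] /and3P[bjl _ ->].
by have -> : blk i l by apply: blk_trans bij bjl.
Qed.

Lemma offS_blk : subrel offS blk. Proof. by move=> i j /and3P[]. Qed.

Definition sel b : 'M[C]_(1 + 1, n) := selm R n (1 + 1) (if b then 0 else k).

Lemma selK b : sel b *m (sel b) ^t* = 1%:M.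
Proof. by apply: selmK; case: b; lia. Qed.

Lemma mul_sel b : (sel b) ^t* *m sel b = D b *m PiS.
Proof.
rewrite mul_selm projM; apply: eq_proj => i; rewrite /itv /inS /=.
by case: b; rewrite /= !unfold_in /= ?eqb_id ?eqbF_neg; lia.
Qed.

Lemma sel_D b : sel b *m D b = sel b.
Proof.
apply: selm_proj => i; rewrite /itv /inS.
by case: b => /=; rewrite ?unfold_in /= ?eqb_id ?eqbF_neg; lia.
Qed.

Lemma sel_PiS b : sel b *m PiS = sel b.
Proof.
apply: selm_proj => i; rewrite /itv /inS.
by case: b => /=; rewrite ?unfold_in /= ?eqb_id ?eqbF_neg; lia.
Qed.

Lemma PiS_adj : PiS ^t* = PiS. Proof. exact: proj_adj. Qed.

Lemma PiS_idem : PiS *m PiS = PiS.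
Proof. by rewrite projM; apply: eq_proj => i /=; rewrite andbb. Qed.

Lemma D_PiS b : D b *m PiS = PiS *m D b.
Proof. by rewrite !projM; apply: eq_proj => i /=; rewrite andbC. Qed.

Lemma PiS_sum : PiS = (sel true) ^t* *m sel true + (sel false) ^t* *m sel false.
Proof. by rewrite !mul_sel -mulmxDl D_sum mul1mx. Qed.

Lemma supp_PiS : supp blk PiS.
Proof.
move=> i j; have [->|ij] := eqVneq i j; first by rewrite /blk /= eqxx.
by rewrite !mxqE (negbTE ij) mulr0n.
Qed.

Lemma supp_offSP X : supp offS X <-> [/\ supp blk X, X *m PiS = 0 & PiS *m X = 0].
Proof.
split=> [sX|[sX XP PX] i j].
  split; first exact: supp_sub offS_blk sX.
    apply/matrixP => i j; rewrite mul_proj mxE; case: (boolP (inS j)) => ij.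
      by rewrite sX ?mul0r // /offS /= ij !andbF.
    by rewrite mulr0.
  apply/matrixP => i j; rewrite proj_mul mxE; case: (boolP (inS i)) => ij.
    by rewrite sX ?mulr0 // /offS /= ij !andbF.
  by rewrite mul0r.
rewrite /offS /= !negb_and !negbK => /or3P[/sX//|iS|jS].
  by move/matrixP/(_ i j): PX; rewrite proj_mul mxE iS mul1r.
by move/matrixP/(_ i j): XP; rewrite mul_proj mxE jS mulr1.
Qed.

Lemma Kgrp_offSP X : Kgrp offS X <-> Kgrp blk X /\ X *m PiS = PiS.
Proof.
split=> [KX|[KX XP]].
  split; first exact: Kgrp_sub offS_blk KX.
  have [_ /supp_offSP[_ + _]] := KX; rewrite mulmxBl mul1mx => /subr0_eq.
  by [].
split; first by case: KX.
apply/supp_offSP; split; first by case: KX.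
  by rewrite mulmxBl mul1mx XP subrr.
have PX : X ^t* *m PiS = PiS by rewrite -{1}XP mulmxA (Kgrp_mulmxV KX) mul1mx.
have PX' : PiS *m X = PiS.
  by have /(congr1 (fun M : 'M[C]_n => M ^t* )) := PX; rewrite tmxCM PiS_adj trmxCK.
by rewrite mulmxBr mulmx1 PX' subrr.
Qed.

Definition suppS v := PiS *m cplx v = cplx v.

Lemma suppS_iota v X : Kgrp offS X -> suppS v -> iota X *m v = v.
Proof.
move=> /Kgrp_offSP[_ XP] vS; apply: cplx_inj.
by rewrite cplx_iota -vS mulmxA XP.
Qed.

Lemma suppS_nondeg v b : suppS v -> nondeg k v -> sel b *m cplx v \in unitmx.
Proof.
move=> vS [/(_ b)[B BD Bv] _].
have : (B *m (sel b) ^t*) *m (sel b *m cplx v) = 1%:M.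
  by rewrite mulmxA -(mulmxA B) mul_sel mulmxA BD -mulmxA vS.
by case/mulmx1_unit.
Qed.

(** The blocks of [cplx v] are invertible on the slice, so their columns span the slice coordinates
    of each block, and [X] vanishes there. *)
Lemma supp_annihil v X : suppS v -> (forall b, sel b *m cplx v \in unitmx) ->
  supp blk X -> X *m cplx v = 0 -> X *m PiS = 0.
Proof.
move=> vS vU sX Xv.
have Xb b : X *m (sel b) ^t* = 0.
  apply: (can_inj (mulmxK (vU b))); rewrite mul0mx mulmxA -(mulmxA X) mul_sel.
  by rewrite -(mulmxA X) -(mulmxA (D b)) vS mulmxA -(D_suppC b sX) -mulmxA Xv mulmx0.
by rewrite PiS_sum mulmxDr !mulmxA !Xb !mul0mx addr0.
Qed.

Lemma fix_offS v X : suppS v -> nondeg k v -> Kgrp blk X -> iota X *m v = v ->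
  Kgrp offS X.
Proof.
move=> vS nd KX Xv; apply/Kgrp_offSP; split=> //; apply/eqP.
rewrite -subr_eq0 -{2}[PiS]mul1mx -mulmxBl; apply/eqP.
apply: (supp_annihil vS) => [b||]; [exact: suppS_nondeg|by case: KX|].
by rewrite mulmxBl mul1mx -cplx_iota Xv subrr.
Qed.

End Slice.

(** * Isotropy groups of slice vectors *)

Section Principal.
Variables (R : realType) (n k : nat).
Hypotheses (hk : (2 <= k)%N) (hn : (k + 2 <= n)%N).
Local Notation H := (quat R).
Local Notation C := (R[i]).
Implicit Types (v w y z : 'cV[H]_n) (b : bool) (X : 'M[C]_n) (g : 'M[H]_n).
Local Notation G := (UU R n k).
Local Notation blk := (@blk n k).
Local Notation D := (D R n k).
Local Notation inS := (@inS n k).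
Local Notation PiS := (PiS R n k).
Local Notation offS := (@offS n k).
Local Notation sel := (sel R n k).

(** One reflection reduces the block of [Cpart v] to its first coordinate. The second one leaves
    that coordinate alone, so it can confine [Jpart] to the first two coordinates without spoiling
    the first column. *)
Lemma householder_slice b v :
  exists W, Kgrp [rel i j : 'I_n | ((i < k)%N == b) && ((j < k)%N == b)] W /\
    forall (i : 'I_n) l, (i < k)%N == b -> ~~ inS i -> (W *m cplx v) i l = 0.
Proof.
have [off offE] : {off | off = if b then 0%N else k} by eexists.
have oblk (j : nat) : (j < 2)%N -> ((off + j < k)%N == b).
  by rewrite offE; case: (b); lia.
have oinS j : (j < 2)%N -> (off + j < 2)%N || (k <= off + j < k + 2)%N.
  by rewrite offE; case: (b); lia.
have lt0 : (off + 0 < n)%N by rewrite offE; case: (b); lia.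
have lt1 : (off + 1 < n)%N by rewrite offE; case: (b); lia.
pose c := fun i : 'I_n => (i < k)%N == b.
pose c' := fun i : 'I_n => c i && (i != Ordinal lt0).
have c0 : c (Ordinal lt0) by rewrite /c oblk.
have c1 : c' (Ordinal lt1) by rewrite /c' /c -val_eqE /= oblk //= eqn_add2l.
have [W1 [K1 z1]] := householder (Cpart v) c0.
have [W2 [K2 z2]] := householder (W1 *m Jpart v) c1.
exists (W2 *m W1); split.
  apply: KgrpM K1; first by move=> j i l /= /andP[-> _] /andP[_ ->].
  by apply: Kgrp_sub K2 => i j /andP[/andP[ci _] /andP[cj _]]; apply/andP.
move=> i l ci iS; have i0 : i != Ordinal lt0.
  by apply: contra iS => /eqP ->; rewrite /inS /= oinS.
have i1 : i != Ordinal lt1.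
  by apply: contra iS => /eqP ->; rewrite /inS /= oinS.
have ci' : c' i by rewrite /c' i0 /c ci.
rewrite /cplx mul_mx_row -!mulmxA mxE; case: (fintype.split l) => j; rewrite !ord1; last exact: z2.
rewrite mxE big1 // => q _; have [cq|ncq] := boolP (c' q).
  by case/andP: cq => cq q0; rewrite z1 ?mulr0.
rewrite (Kgrp_off K2) /= ?(negbTE ncq) ?andbF //.
by rewrite (_ : i == q = false) ?mul0r //; apply/eqP => iq; rewrite -iq ci' in ncq.
Qed.

Lemma blk_split b : subrel [rel i j : 'I_n | ((i < k)%N == b) && ((j < k)%N == b)] blk.
Proof. by move=> i j /andP[/eqP e1 /eqP e2]; rewrite /blk /= e1 e2. Qed.

Lemma exists_slice P : HP R n P ->
  exists W v, [/\ Kgrp blk W, unitv v, suppS k v & P = Proj (iota W *m v)].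
Proof.
move=> /HP_exists_unit[w w1 ->].
have [W1 [K1 z1]] := householder_slice true w.
have [W2 [K2 z2]] := householder_slice false (iota W1 *m w).
have KW : Kgrp blk (W2 *m W1).
  by apply: (KgrpM (@blk_trans n k)); [apply: Kgrp_sub K2|apply: Kgrp_sub K1];
    apply: blk_split.
exists ((W2 *m W1) ^t*), (iota (W2 *m W1) *m w); split.
- exact: KgrpV (@blk_sym n k) KW.
- by apply: unitvM => //; rewrite adj_iota -iotaM (Kgrp_mulmxV KW) iota1.
- apply/matrixP => i l; rewrite /PiS proj_mul.
  have [_|iS] := boolP (inS i); first by rewrite mul1r.
  rewrite mul0r; have [ik|ki] := ltnP i k; last first.
    by rewrite iotaM -mulmxA cplx_iota z2 // ltnNge ki.
  rewrite cplx_iota -mulmxA mxE; symmetry; rewrite (bigD1 i) //= z1 ?ik // mulr0 add0r.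
  rewrite big1 // => j ji; rewrite (Kgrp_off K2) /= ?ik // eq_sym (negbTE ji).
  by rewrite mul0r.
- by rewrite mulmxA -iotaM (Kgrp_mulmxV KW) iota1 mul1mx.
Qed.

Lemma suppS_PiS v : suppS k v -> iota PiS *m v = v.
Proof. by move=> vS; apply: cplx_inj; rewrite cplx_iota. Qed.

Lemma KgrpN X : Kgrp blk X -> Kgrp blk (- X).
Proof.
move=> KX; apply: KgrpE => [|i j bij].
  apply/unitarymxP; rewrite tmxCN mulNmx mulmxN opprK.
  exact: Kgrp_mulVmx KX.
by rewrite mxE (Kgrp_off KX bij) (blk_neq bij) oppr0.
Qed.

(* The sign appears because [- 1] acts trivially. *)
Definition IsoStd : set 'M[H]_n :=
  [set g | exists2 X, Kgrp offS X & g = iota X \/ g = - iota X].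

Lemma IsoStd_isotropy v g : suppS k v -> IsoStd g -> isotropy G (Proj v) g.
Proof.
move=> vS [X KX gX]; have KX' := Kgrp_sub (@offS_blk n k) KX; split.
  by apply/UUP; case: gX => ->; [exists X|exists (- X); rewrite ?iotaN //; exact: KgrpN].
rewrite act_Proj; case: gX => ->; rewrite ?mulNmx (suppS_iota KX vS) //.
by rewrite /Proj adjN mulNmx mulmxN opprK.
Qed.

Lemma isotropy_IsoStd v g : unitv v -> suppS k v -> nondeg k v ->
  isotropy G (Proj v) g -> IsoStd g.
Proof.
move=> v1 vS nd [/UUP[X KX ->] gP].
have [Xv|Xv] := nondeg_isotropy nd v1 KX gP.
  by exists X; [exact: fix_offS vS nd KX Xv|left].
exists (- X); last by right; rewrite iotaN opprK.
by apply: fix_offS vS nd (KgrpN KX) _; rewrite // iotaN mulNmx Xv opprK.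
Qed.

Lemma iota_pm X Y : iota X = iota Y \/ iota X = - iota Y -> X = Y \/ X = - Y.
Proof. by case=> [/iota_inj|]; [left|rewrite -iotaN => /iota_inj; right]. Qed.

Lemma PiS_ord (i : 'I_n) : inS i -> PiS i i = 1.
Proof. by move=> iS; rewrite !mxqE iS eqxx. Qed.

Lemma oneC_neqN : (1 : C) <> -1.
Proof. by move/eqP; rewrite -subr_eq0 opprK -(natrD _ 1 1) pnatr_eq0. Qed.

(* If the [b]-block of [v] has rank at most 1, then a reflection of the span of
   the [b]-part of [inS] fixes [v]. *)
Lemma isotropy_sel v b : unitv v -> suppS k v -> isotropy G (Proj v) `<=` IsoStd ->
  sel b *m cplx v \in unitmx.
Proof.
move=> v1 vS sub; apply: contrapT => /negP.
rewrite -row_free_unit -kermx_eq0 -nz_row_eq0.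
have := nz_row_sub (kermx (sel b *m cplx v)).
move: (nz_row _) => y /sub_kermxP yA y0.
(* A row in block [b] that annihilates [cplx v]; [X] below is the reflection that reverses it. *)
have [u uE] : {u | u = y *m sel b} by eexists.
have uA : u *m cplx v = 0 by rewrite uE -mulmxA.
have uD : u *m D b = u by rewrite uE -mulmxA sel_D.
have uP : u *m PiS = u by rewrite uE -mulmxA sel_PiS.
have [s sE] : {s : C | u *m u ^t* = s%:M} by exact: (exist _ _ (mx11_scalar _)).
have sy : s = \sum_i `|y 0 i| ^+ 2.
  have -> : s = (y *m y ^t* ) 0 0.
    have : u *m u ^t* = y *m y ^t* by rewrite uE tmxCM mulmxA -(mulmxA y) selK // mulmx1.
    by rewrite sE => <-; rewrite mxE eqxx.
  by rewrite mxE; apply: eq_bigr => i _; rewrite tmxCE normCK.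
have s0 : s != 0.
  apply: contra y0; rewrite sy psumr_eq0 => [/allP s0|i _]; last exact: exprn_ge0.
  apply/eqP/rowP => i; rewrite mxE; apply/eqP.
  by have := s0 i (mem_index_enum i); rewrite expf_eq0 normr_eq0.
have sJ : s^* = s.
  by apply/CrealP; rewrite sy; apply: rpred_sum => i _; apply: rpredX; apply: normr_real.
have [X XE] : {X : 'M[C]_n | X = 1%:M - (2 / s) *: (u ^t* *m u)} by eexists.
have XJ : X ^t* = X.
  by rewrite XE tmxCB tmxC1 tmxCZ tmxCM trmxCK rmorphM fmorphV /= sJ conjC_nat.
have Xu : X *m u ^t* = - u ^t*.
  rewrite XE mulmxBl mul1mx -scalemxAl -mulmxA sE mul_mx_scalar scalerA divfK //.
  by rewrite scaler_nat mulr2n opprD addNKr.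
have u0 (i : 'I_n) : (i < k)%N != b -> u 0 i = 0.
  by move=> /negbTE ib; rewrite -uD mul_proj ib mulr0.
have KX : Kgrp blk X.
  split.
    apply/unitarymxP; rewrite XJ {2}XE mulmxBr mulmx1 -scalemxAr mulmxA Xu mulNmx.
    by rewrite scalerN opprK XE subrK.
  rewrite XE addrAC subrr sub0r; apply: suppN => i j; rewrite /blk /= => ij.
  rewrite mxE mxE big_ord1 tmxCE.
  have [ib|/u0 ->] := eqVneq (i < k)%N b; last by rewrite conjC0 mul0r mulr0.
  by rewrite (u0 j) ?mulr0 // -ib eq_sym.
have Xv : iota X *m v = v.
  by apply: cplx_inj; rewrite cplx_iota XE mulmxBl mul1mx -scalemxAl -mulmxA uA mulmx0
    scaler0 subr0.
have [|Z KZ XZ] := sub (iota X).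
  by split; [apply/UUP; exists X|rewrite act_Proj Xv].
have [_ ZP] := (@Kgrp_offSP R n k Z).1 KZ.
have uPJ : PiS *m u ^t* = u ^t*.
  by rewrite -{2}uP tmxCM PiS_adj.
have [XZ'|XZ'] := iota_pm XZ.
  have : u ^t* = - u ^t* by rewrite -[RHS]Xu -{2}uPJ mulmxA XZ' ZP uPJ.
  move/(congr1 (mulmx u)); rewrite mulmxN sE => /matrixP/(_ 0 0); rewrite !mxE eqxx mulr1n.
  by move/eqP; rewrite -subr_eq0 opprK -mulr2n mulrn_eq0 /= (negbTE s0).
(* It remains to exclude the sign: [X] would be [-1] on all slice coordinates, but it fixes the
   first one of the other block. *)
have ltj : ((if b then k else 0) < n)%N by case: (b); lia.
have /matrixP/(_ (Ordinal ltj) (Ordinal ltj)) : X *m PiS = - PiS by rewrite XZ' mulNmx ZP.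
have jS : inS (Ordinal ltj) by rewrite /inS /=; case: (b) => //=; lia.
rewrite [RHS]mxE PiS_ord // mul_proj jS mulr1 XE !mxE big_ord1 tmxCE u0.
  by rewrite conjC0 mul0r mulr0 subr0 eqxx; exact: oneC_neqN.
by rewrite /=; case: (b) => /=; lia.
Qed.

Lemma mx11_comm (x y : 'M[H]_1) : x *m y = y *m x -> x 0 0 * y 0 0 = y 0 0 * x 0 0.
Proof. by move/(congr1 (fun M : 'M[H]_1 => M 0 0)); rewrite !mx11M. Qed.

(* If the moments commute, then some unit imaginary quaternion [h] commutes with
   both, and [X] with [X v = v h] gives [Y = 1 + X + X^2] in the isotropy group. *)
Lemma isotropy_moments v : unitv v -> suppS k v ->
  (forall b, sel b *m cplx v \in unitmx) -> isotropy G (Proj v) `<=` IsoStd ->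
  moment k true v *m moment k false v <> moment k false v *m moment k true v.
Proof.
move=> v1 vS vU sub pp.
have pp0 : moment k true v 0 0 * moment k false v 0 0 =
    moment k false v 0 0 * moment k true v 0 0.
  exact: mx11_comm pp.
have [h [aJ hh hp hp']] := commuting_unit (moment_conj k true v) (moment_conj k false v) pp0.
have [q qE] : {q : 'M[H]_1 | q = h%:M} by eexists.
have q00 : q 0 0 = h by rewrite qE mxE eqxx.
have qJ : adj q = - q by apply: mx11_eq; rewrite adjE mxE q00.
have qq : q *m q = - 1%:M by apply: mx11_eq; rewrite mx11M q00 hh !mxE eqxx.
have qp b : q *m moment k b v = moment k b v *m q.
  have hpb : h * moment k b v 0 0 = moment k b v 0 0 * h by case: b.
  apply: mx11_eq; rewrite -q00 in hpb.
  exact: (etrans (mx11M _ _) (etrans hpb (esym (mx11M _ _)))).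
pose B b := invmx (sel b *m cplx v) *m sel b.
have [|||| X [sX XJ Xv XQ]] := @solve_skew R n k v (v *m q) B.
- by move=> b; rewrite /B -mulmxA sel_D.
- by move=> b; rewrite /B -mulmxA mulVmx.
- by move=> b s; rewrite /s mulmxA -/(moment k b v) adjM adj_moment qJ mulNmx mulmxN opprK qp.
- move=> b; rewrite mulmxA; apply: conjq_anti.
  have dJ : adj (adj v *m iota (D b) *m v) = adj v *m iota (D b) *m v.
    by rewrite !adjM adjK adj_iota D_adj mulmxA.
  have dR := conjq_self (etrans (esym (adjE _ 0 0)) (congr1 (fun M : 'M[H]_1 => M 0 0) dJ)).
  by rewrite mx11M dR conjqM q00 aJ conj_real_quat mulNr real_quatC.
have PX : PiS *m X = X.
  apply: XQ; first by rewrite D_PiS.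
    by rewrite -cplx_iota mulmxA (suppS_PiS vS).
  move=> b; have -> : B b = B b *m PiS by rewrite /B -mulmxA sel_PiS.
  by rewrite tmxCM PiS_adj mulmxA PiS_idem.
have XP : X *m PiS = X.
  have /(congr1 (fun M : 'M[C]_n => M ^t* )) := PX.
  by rewrite tmxCM PiS_adj XJ mulNmx => /oppr_inj.
(* [X^2 v = v q^2 = - v], and a block matrix is determined on the slice by its action on [v]. *)
have XX : X *m X = - PiS.
  apply/eqP; rewrite -subr_eq0 opprK; apply/eqP.
  have -> : X *m X + PiS = (X *m X + PiS) *m PiS.
    by rewrite mulmxDl PiS_idem -mulmxA XP.
  apply: (supp_annihil hk hn vS vU).
    by apply: suppD; [exact: (suppM (@blk_trans n k))|exact: supp_PiS].
  rewrite -cplx_iota iotaD mulmxDl iotaM -mulmxA Xv (mulmxA (iota X)) Xv (suppS_PiS vS).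
  by rewrite -mulmxA qq mulmxN mulmx1 addNr cplx0.
have [Y YE] : {Y | Y = 1%:M - PiS + X} by eexists.
have YP : Y *m PiS = X by rewrite YE mulmxDl mulmxBl mul1mx PiS_idem XP subrr add0r.
have KY : Kgrp blk Y.
  split; last first.
    have -> : Y - 1%:M = X + - PiS by rewrite YE addrAC (addrAC 1%:M) subrr add0r addrC.
    apply: suppD; first exact: sX.
    by apply: suppN; exact: supp_PiS.
  apply/unitarymxP; rewrite {2}YE tmxCD tmxCB tmxC1 PiS_adj XJ.
  have YX : Y *m X = - PiS by rewrite -{1}PX mulmxA YP XX.
  by rewrite mulmxDr mulmxN YX opprK mulmxBr mulmx1 YP YE addrK subrK.
have Yv : iota Y *m v = v *m q.
  by rewrite YE iotaD iotaB iota1 mulmxDl mulmxBl mul1mx (suppS_PiS vS) subrr add0r Xv.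
have [|Z KZ YZ] := sub (iota Y).
  split; first by apply/UUP; exists Y.
  have qa : q *m adj q = 1%:M by rewrite qJ mulmxN qq opprK.
  rewrite act_Proj Yv; exact: Proj_mulr qa.
have [_ ZP] := (@Kgrp_offSP R n k Z).1 KZ.
(* Elements of [IsoStd] are [1] or [-1] on the slice, whereas [Y] acts there as the skew-hermitian
   [X]. *)
have XPN : X = PiS \/ X = - PiS.
  by rewrite -YP; case: (iota_pm YZ) => ->; [left|right]; rewrite ?mulNmx ZP.
have PN : PiS = - PiS.
  case: XPN => XP'.
    by rewrite -[LHS](PiS_adj R n k) -XP' XJ.
  by have := XJ; rewrite XP' tmxCN PiS_adj opprK.
have lt0 : (0 < n)%N by lia.
have S0 : inS (Ordinal lt0) by [].
have /matrixP/(_ (Ordinal lt0) (Ordinal lt0)) := PN.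
rewrite [RHS]mxE (PiS_ord S0); exact: oneC_neqN.
Qed.

Lemma isotropy_nondeg v : unitv v -> suppS k v -> isotropy G (Proj v) `<=` IsoStd ->
  nondeg k v.
Proof.
move=> v1 vS sub; have vU b := isotropy_sel b v1 vS sub.
split; last exact: isotropy_moments.
move=> b; exists (invmx (sel b *m cplx v) *m sel b).
  by rewrite -mulmxA sel_D.
by rewrite -mulmxA mulVmx.
Qed.

End Principal.

(** * An explicit principal line, and comparison of all others with it *)

Section PrincipalOrbits.
Variables (R : realType) (n k : nat).
Hypotheses (hk : (2 <= k)%N) (hn : (k + 2 <= n)%N).
Local Notation H := (quat R).
Local Notation C := (R[i]).
Implicit Types (v w y z : 'cV[H]_n) (b : bool) (X : 'M[C]_n) (g : 'M[H]_n).
Local Notation G := (UU R n k).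
Local Notation blk := (@blk n k).
Local Notation D := (D R n k).
Local Notation inS := (@inS n k).
Local Notation PiS := (PiS R n k).
Local Notation offS := (@offS n k).
Local Notation sel := (sel R n k).

(* The point [(1, 2 j; 1 + j, 3 j) / 4], with blocks separated by the semicolon,
   has moments [- 3 i / 16] and [(- 9 i + 2 k) / 16]. *)
Definition x0 b : 'cV[H]_(1 + 1) := \col_i
  if b then (if i == 0 :> nat then Quat 4^-1 0 0 0 else Quat 0 0 2^-1 0)
  else (if i == 0 :> nat then Quat 4^-1 0 4^-1 0 else Quat 0 0 (3 / 4) 0).

Definition v0 : 'cV[H]_n := iota ((sel true) ^t* ) *m x0 true + iota ((sel false) ^t* ) *m x0 false.

Lemma sel_ortho b : sel b *m (sel (~~ b)) ^t* = 0.
Proof.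
have D0 : D b *m (sel (~~ b)) ^t* = 0.
  have : (D true + D false) *m (sel (~~ b)) ^t* = (sel (~~ b)) ^t* by rewrite D_sum mul1mx.
  have e : D (~~ b) *m (sel (~~ b)) ^t* = (sel (~~ b)) ^t*.
    by rewrite -[in RHS](sel_D R hk hn (~~ b)) tmxCM D_adj.
  rewrite mulmxDl => /eqP; case: b e => /= ->; rewrite -subr_eq0.
    by rewrite addrK => /eqP.
  by rewrite addrAC subrr add0r => /eqP.
by rewrite -(sel_D R hk hn b) -mulmxA D0 mulmx0.
Qed.

Lemma sel_v0 b : iota (sel b) *m v0 = x0 b.
Proof.
rewrite /v0 mulmxDr !mulmxA -!iotaM; case: b.
  by rewrite selK // (sel_ortho true) iota1 iota0 mul1mx mul0mx addr0.
by rewrite selK // (sel_ortho false) iota1 iota0 mul1mx mul0mx add0r.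
Qed.

Lemma suppS_v0 : suppS k v0.
Proof.
have e b : PiS *m (sel b) ^t* = (sel b) ^t*.
  by rewrite -[in RHS](sel_PiS R hk hn b) tmxCM PiS_adj.
by rewrite /suppS -cplx_iota /v0 mulmxDr !mulmxA -!iotaM !e.
Qed.

Lemma col2_adj_mul (x y : 'cV[H]_(1 + 1)) :
  (adj x *m y) 0 0 = conjq (x 0 0) * y 0 0 + conjq (x 1 0) * y 1 0.
Proof.
rewrite mxE big_ord_recl big_ord1 !adjE; congr (_ + conjq (x _ 0) * y _ 0);
exact: val_inj.
Qed.

Lemma unitv_v0 : unitv v0.
Proof.
rewrite /unitv {2}/v0 mulmxDr !mulmxA.
have e b : adj v0 *m iota ((sel b) ^t* ) = adj (x0 b).
  by rewrite -(sel_v0 b) adjM adj_iota.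
rewrite !e; apply: mx11_eq; rewrite [LHS]mxE !col2_adj_mul !mxE /=.
by apply: quat_eqP; split; rewrite /=; field.
Qed.

Lemma det2 (M : 'M[C]_2) : \det M = M 0 0 * M 1 1 - M 0 1 * M 1 0.
Proof.
rewrite (expand_det_row M 0) big_ord_recl big_ord1 /cofactor !det_mx11 !mxE.
have -> : lift ord0 ord0 = 1 :> 'I_2 by exact: val_inj.
have -> : lift 1 0 = 0 :> 'I_2 by exact: val_inj.
by rewrite expr0 mul1r mulN1r mulrN.
Qed.

Lemma det_cplx (x : 'cV[H]_(1 + 1)) : \det (cplx x) =
  cpart (x 0 0) * jpart (x 1 0) - jpart (x 0 0) * cpart (x 1 0).
Proof.
have e0 i : cplx x i 0 = cpart (x i 0).
  rewrite (_ : 0 = lshift 1 0 :> 'I_(1 + 1)); last exact: val_inj.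
  by rewrite /cplx row_mxEl CpartE.
have e1 i : cplx x i 1 = jpart (x i 0).
  rewrite (_ : 1 = rshift 1 0 :> 'I_(1 + 1)); last exact: val_inj.
  by rewrite /cplx row_mxEr JpartE.
by rewrite (det2 (cplx x)) !e0 !e1.
Qed.

Lemma moment_sel v b : suppS k v ->
  moment k b v = adj (iota (sel b) *m v) *m iota (iC R)%:M *m (iota (sel b) *m v).
Proof.
move=> vS; rewrite /moment -{2}(suppS_PiS vS) adjM adj_iota -!mulmxA; congr (_ *m _).
rewrite !mulmxA -!iotaM; congr (iota _ *m _).
by rewrite mul_mx_scalar -scalemxAl -scalemxAl mul_sel.
Qed.

Lemma nondeg_v0 : nondeg k v0.
Proof.
split=> [b|].
  exists (invmx (cplx (x0 b)) *m sel b); first by rewrite -mulmxA sel_D.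
  have -> : invmx (cplx (x0 b)) *m sel b *m cplx v0 = invmx (cplx (x0 b)) *m cplx (x0 b).
    rewrite -mulmxA; congr (_ *m _).
    by rewrite -sel_v0 /cplx Cpart_iotaM Jpart_iotaM mul_mx_row.
  rewrite mulVmx // unitmxE unitfE det_cplx !mxE /=; apply/eqP => /(congr1 (@complex.Re R)).
  by case: b => /=; lra.
have iCE : iota (iC R)%:M = (Quat 0 1 0 0)%:M :> 'M[H]_(1 + 1).
  apply/matrixP => i j; rewrite !mxqE rmorphMn /=; congr (_ *+ _).
have mE b : moment k b v0 0 0 = conjq (x0 b 0 0) * (Quat 0 1 0 0 * x0 b 0 0)
    + conjq (x0 b 1 0) * (Quat 0 1 0 0 * x0 b 1 0).
  rewrite (moment_sel b suppS_v0) sel_v0 iCE -mulmxA mul_scalar_mx col2_adj_mul.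
  by rewrite !mxE.
have pt : moment k true v0 0 0 = Quat 0 (- 3 / 16) 0 0.
  by rewrite mE !mxE /=; apply: quat_eqP; split; rewrite /=; field.
have pf : moment k false v0 0 0 = Quat 0 (- 9 / 16) 0 (2 / 16).
  by rewrite mE !mxE /=; apply: quat_eqP; split; rewrite /=; field.
have npf : Quat 0 (- 3 / 16) 0 0 * Quat 0 (- 9 / 16) 0 (2 / 16) <>
    Quat 0 (- 9 / 16) 0 (2 / 16) * Quat 0 (- 3 / 16) 0 0 :> H.
  by move/(congr1 (@qj R)) => /=; lra.
by move=> /mx11_comm pp; apply: npf; rewrite -pt -pf.
Qed.

Lemma UUM g h : G g -> G h -> G (g *m h).
Proof.
move=> /UUP[X KX ->] /UUP[Y KY ->]; apply/UUP; exists (X *m Y); last by rewrite iotaM.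
exact: KgrpM (@blk_trans n k) KX KY.
Qed.

Lemma UU_iota X : Kgrp blk X -> G (iota X). Proof. by move=> KX; apply/UUP; exists X. Qed.

Lemma actM g h (P : 'M[H]_n) : act (g *m h) P = act g (act h P).
Proof. by rewrite /act !adjqE adjM !mulmxA. Qed.

Lemma iotaKV W : Kgrp blk W -> iota (W ^t* ) *m iota W = 1%:M :> 'M[H]_n.
Proof. by move=> KW; rewrite -iotaM (Kgrp_mulmxV KW) iota1. Qed.

Lemma iotaVK W : Kgrp blk W -> iota W *m iota (W ^t* ) = 1%:M :> 'M[H]_n.
Proof. by move=> KW; rewrite -iotaM (Kgrp_mulVmx KW) iota1. Qed.

Lemma isotropy_conj W g v : Kgrp blk W -> isotropy G (Proj v) g ->
  isotropy G (Proj (iota W *m v)) (iota W *m g *m iota (W ^t* )).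
Proof.
move=> KW [Gg gv]; have KW' := KgrpV (@blk_sym n k) KW; split.
  by apply: UUM; [apply: UUM => //|]; apply: UU_iota.
rewrite -act_Proj -actM -[X in act X]mulmxA (iotaKV KW) mulmx1 actM gv.
by [].
Qed.

Lemma nondeg_principal v : suppS k v -> nondeg k v -> unitv v -> principal G (Proj v).
Proof.
move=> vS nd v1; split=> [|P' HP']; first exact: HP_Proj.
have [W [w [KW w1 wS ->]]] := exists_slice hk hn HP'.
exists (iota W); first exact: UU_iota.
move=> g /(isotropy_IsoStd hk hn v1 vS nd) gI; rewrite adjqE adj_iota.
by apply: isotropy_conj => //; apply: IsoStd_isotropy.
Qed.

(* Squaring removes the sign in [IsoStd]. *)
Lemma IsoStd_sqr g : @IsoStd R n k g -> exists2 X, Kgrp offS X & g *m g = iota X.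
Proof.
move=> [X KX gX]; exists (X *m X); first exact: (KgrpM (@offS_trans n k) (KX) (KX)).
by rewrite iotaM; case: gX => ->; rewrite ?mulmxN ?mulNmx ?opprK.
Qed.

(** The witness is multiplication by [i] off the slice. The reflection [2 PiS - 1] is wanted as a
    square because squares of elements of [IsoStd] carry no sign. *)
Lemma PiS_reflection : exists2 X, Kgrp offS X & X *m X = PiS + PiS - 1%:M.
Proof.
have iC2 : iC R * iC R = -1.
  apply/eqP; by rewrite eq_complex /= !(mul0r, mulr0, mul1r) sub0r addr0 oppr0 !eqxx.
exists (PiS + iC R *: (1%:M - PiS)).
  apply/Kgrp_offSP; split; last first.
    by rewrite mulmxDl PiS_idem -scalemxAl mulmxBl mul1mx PiS_idem subrr scaler0 addr0.
  split.
    apply/unitarymxP; rewrite tmxCD tmxCZ tmxCB tmxC1 PiS_adj iC_conj.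
    rewrite mulmxDr !mulmxDl PiS_idem -!scalemxAr -!scalemxAl mulmxBl mul1mx mulmxBr mulmx1.
    rewrite PiS_idem subrr !scaler0 addr0 add0r mulmxBr mulmx1 mulmxBl mul1mx PiS_idem.
    by rewrite subrr subr0 scalerA mulNr iC2 opprK scale1r addrC subrK.
  have -> : PiS + iC R *: (1%:M - PiS) - 1%:M = (iC R - 1) *: (1%:M - PiS).
    by rewrite scalerBl scale1r opprB addrCA addrA.
  by move=> i j /blk_neq ij; rewrite !mxE ij !mulr0n subrr mulr0.
rewrite mulmxDr !mulmxDl PiS_idem -!scalemxAr -!scalemxAl mulmxBl mul1mx mulmxBr mulmx1.
rewrite PiS_idem subrr !scaler0 addr0 add0r mulmxBr mulmx1 mulmxBl mul1mx PiS_idem.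
by rewrite subrr subr0 scalerA iC2 scaleN1r opprB addrA.
Qed.

(* With [Q = B PiS B^*], the relation [(2 Q - 1) PiS = PiS] shows that [Q - PiS]
   is a projection; its trace is [0]. *)
Lemma conj_PiS (B : 'M[C]_n) : Kgrp blk B ->
  (forall X, Kgrp offS X -> @IsoStd R n k (iota (B *m X *m B ^t* ))) -> B *m PiS = PiS *m B.
Proof.
move=> Kb sub; have [X KX XX] := PiS_reflection.
have BB := Kgrp_mulmxV Kb; have BB_ := Kgrp_mulVmx Kb.
have [Z KZ] := IsoStd_sqr (sub X KX); have [_ ZP] := (@Kgrp_offSP R n k Z).1 KZ.
rewrite -iotaM => /iota_inj ZE; have [Q QE] : {Q | Q = B *m PiS *m B ^t*} by eexists.
have ZQ : Z = Q + Q - 1%:M.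
  rewrite -ZE !mulmxA -(mulmxA (B *m X)) BB mulmx1 -(mulmxA B) XX.
  by rewrite mulmxBr mulmxDr mulmx1 mulmxBl mulmxDl BB_ QE.
have QP : Q *m PiS = PiS.
  have n2 : (2 : C) != 0 by rewrite pnatr_eq0.
  move: ZP; rewrite ZQ mulmxBl mulmxDl mul1mx => /eqP; rewrite subr_eq => /eqP.
  rewrite -(mulr2n (Q *m PiS)) -(mulr2n PiS) -(scaler_nat 2 (Q *m PiS)) -(scaler_nat 2 PiS).
  exact: (scalerI n2).
have QJ : Q ^t* = Q by rewrite QE !tmxCM trmxCK PiS_adj mulmxA.
have PQ : PiS *m Q = PiS by rewrite -[LHS]trmxCK tmxCM PiS_adj QJ QP PiS_adj.
have QQ : Q *m Q = Q.
  by rewrite QE !mulmxA -(mulmxA (B *m PiS)) BB mulmx1 -(mulmxA B) PiS_idem.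
have Q0 : Q - PiS = 0.
  apply: iota_inj; rewrite iota0; apply: q1_tr_adj_eq0.
  have EE : (Q - PiS) *m (Q - PiS) = Q - PiS.
    by rewrite mulmxBl !mulmxBr QQ QP PQ PiS_idem subrr subr0.
  rewrite adj_iota tmxCB QJ PiS_adj -iotaM EE iotaB raddfB q1D q1N.
  rewrite QE !iotaM q1_mxtraceC mulmxA -iotaM BB iota1 mul1mx.
  by rewrite subrr.
have := subr0_eq Q0; rewrite QE => /(congr1 (mulmx^~ B)).
by rewrite -mulmxA BB mulmx1.
Qed.

(** Principality conjugates the isotropy group of the slice vector into that of [v0], which is
    [IsoStd]. The former contains [IsoStd], so the conjugating [B] commutes with [PiS] and preserves
    [IsoStd]. Hence the isotropy group is no larger than [IsoStd], and [v] is nondegenerate. *)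
Lemma principal_slice P : principal G P ->
  exists W v, [/\ Kgrp blk W, unitv v, suppS k v, nondeg k v & P = Proj (iota W *m v)].
Proof.
move=> [HPP prin]; have [W [v [KW v1 vS PE]]] := exists_slice hk hn HPP.
exists W, v; split; [exact: KW|exact: v1|exact: vS| |exact: PE].
apply: (isotropy_nondeg hk hn v1 vS).
have [a /UUP[Y KY ->] aP] := prin _ (HP_Proj unitv_v0).
have [B BE] : {B : 'M[C]_n | B = Y *m W} by eexists.
have Kb : Kgrp blk B by rewrite BE; exact: KgrpM (@blk_trans n k) KY KW.
have sub g : isotropy G (Proj v) g -> @IsoStd R n k (iota B *m g *m iota (B ^t* )).
  move=> /(isotropy_conj KW); rewrite -PE => /aP.
  move/(isotropy_IsoStd hk hn unitv_v0 suppS_v0 nondeg_v0).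
  by rewrite adjqE adj_iota BE tmxCM !iotaM !mulmxA.
have bP : B *m PiS = PiS *m B.
  apply: (conj_PiS Kb) => X KX; rewrite !iotaM; apply: sub.
  by apply: IsoStd_isotropy => //; exists X => //; left.
move=> g /sub[Z KZ gZ]; exists (B ^t* *m Z *m B).
  have [KZ' ZP] := (@Kgrp_offSP R n k Z).1 KZ.
  apply/Kgrp_offSP; split.
    have KBZ := KgrpM (@blk_trans n k) (KgrpV (@blk_sym n k) Kb) KZ'.
    exact: KgrpM (@blk_trans n k) KBZ Kb.
  have -> : B ^t* *m Z *m B *m PiS = B ^t* *m Z *m (B *m PiS) by rewrite -mulmxA.
  by rewrite bP mulmxA -(mulmxA _ Z) ZP -mulmxA -bP mulmxA (Kgrp_mulmxV Kb) mul1mx.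
have gE : g = iota (B ^t* ) *m (iota B *m g *m iota (B ^t* )) *m iota B.
  by rewrite !mulmxA iotaKV // mul1mx -mulmxA iotaKV // mulmx1.
by rewrite gE !iotaM; case: gZ => ->; [left|right]; rewrite ?mulmxN ?mulNmx.
Qed.

End PrincipalOrbits.

(** * Isotropy algebra, cohomogeneity and homogeneity rank *)

Section IsotropyAlgebra.
Variables (R : realType) (n k : nat).
Hypotheses (hk : (2 <= k)%N) (hn : (k + 2 <= n)%N).
Local Notation H := (quat R).
Local Notation C := (R[i]).
Implicit Types (v w y z : 'cV[H]_n) (b : bool) (X : 'M[C]_n) (g : 'M[H]_n).
Local Notation G := (UU R n k).
Local Notation blk := (@blk n k).
Local Notation D := (D R n k).
Local Notation inS := (@inS n k).
Local Notation PiS := (PiS R n k).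
Local Notation offS := (@offS n k).
Local Notation sel := (sel R n k).

Local Notation IsoStd := (@IsoStd R n k).

Lemma isotropyE W v g : Kgrp blk W -> unitv v -> suppS k v -> nondeg k v ->
  isotropy G (Proj (iota W *m v)) g <->
  IsoStd (iota (W ^t* ) *m g *m iota W).
Proof.
move=> KW v1 vS nd; have KW' := KgrpV (@blk_sym n k) KW; split=> gI.
  apply: (isotropy_IsoStd hk hn v1 vS nd).
  have := isotropy_conj KW' gI; rewrite trmxCK mulmxA (iotaKV KW) mul1mx.
  by [].
have := isotropy_conj KW (IsoStd_isotropy vS gI).
by rewrite !mulmxA (iotaVK KW) mul1mx -mulmxA (iotaVK KW) mulmx1.
Qed.

(** In [IsoStd] the equation [h^2 PiS = PiS] holds for either sign, and its derivative at [1] is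
    [2 V PiS = 0]. The vanishing of the [j]-part and of the entries between blocks is linear and
    passes to the derivative. *)
Lemma IsoStd_velocity (h : R -> 'M[H]_n) : smooth_curve h -> (forall t, IsoStd (h t)) ->
  h 0 = 1%:M -> exists X, [/\ supp offS X, X ^t* = - X & velocity h 0 = iota X].
Proof.
move=> sh Ih h0.
have [V VE] : {V | V = velocity h 0} by eexists.
have sa := smooth_curve_adj sh.
have VJ : adj V = - V.
  have : velocity (fun t => h t *m adj (h t)) 0 = 0.
    rewrite (_ : (fun t => _) = fun=> 1%:M) ?velocity_cst //; apply/funext => t.
    have [X [/unitarymxP uX _] hX] := Ih t.
    by case: hX => ->; rewrite ?adjN ?mulNmx ?mulmxN ?opprK adj_iota -iotaM uX iota1.
  rewrite (velocityM _ sh sa) (velocity_adj _ sh) h0 adj1 mulmx1 mul1mx -VE.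
  by move/eqP; rewrite addrC addr_eq0 => /eqP.
have VP : V *m iota PiS = 0.
  have : velocity (fun t => h t *m h t *m iota PiS) 0 = 0.
    rewrite (_ : (fun t => _) = fun=> iota PiS) ?velocity_cst //; apply/funext => t.
    have [X KX ->] := IsoStd_sqr (Ih t); rewrite -iotaM.
    by have /Kgrp_offSP[_ ->] := KX.
  rewrite (velocityM _ (smooth_curveM sh sh) (smooth_curve_cst _)) velocity_cst mulmx0 addr0.
  rewrite (velocityM _ sh sh) h0 mulmx1 mul1mx -VE => V2.
  apply/matrixP => i j; have /matrixP/(_ i j) := V2; rewrite mulmxDl !mxE.
  move: (\sum_l _) => q q0; apply: quat_eqP; move: q0 => [q1 q2 q3 q4].
  by split; rewrite /=; lra.
have h_entry t i j : jpart (h t i j) = 0 /\ (~~ blk i j -> h t i j = 0).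
  have [X KX hX] := Ih t.
  have Xij : ~~ blk i j -> X i j = 0.
    by move=> bij; rewrite (Kgrp_off (Kgrp_sub (@offS_blk n k) KX) bij) (blk_neq bij).
  split=> [|/Xij X0]; last by case: hX => ->; rewrite ?mxE iotaE X0 raddf0 ?oppr0.
  by case: hX => ->; rewrite ?mxE iotaE /jpart /= ?oppr0.
exists (Cpart V); rewrite -VE.
have VI : V = iota (Cpart V).
  apply: iotaP; apply/matrixP => i j; rewrite JpartE VE velocityE [RHS]mxE.
  have hj t : qj (h t i j) = 0 by have [/(congr1 (@complex.Re R))] := h_entry t i j.
  have hk' t : qk (h t i j) = 0 by have [/(congr1 (@complex.Im R))] := h_entry t i j.
  rewrite /derq /jpart /=.
  have -> : (fun t => qj (h t i j)) = fun=> 0 by apply/funext.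
  have -> : (fun t => qk (h t i j)) = fun=> 0 by apply/funext.
  by rewrite !derive1_cst.
split=> //; last by rewrite -Cpart_adj VJ (raddfN (@Cpart R n n)).
apply/supp_offSP; split.
- move=> i j bij; rewrite CpartE VE velocityE.
  rewrite (@derq_ext R _ (fun=> 0)) ?derq_cst ?raddf0 // => t.
  by have [_ ->] := h_entry t i j.
- by apply: iota_inj; rewrite iotaM -VI VP iota0.
apply: iota_inj; rewrite iotaM -VI iota0 -[LHS]adjK adjM adj_iota PiS_adj VJ.
by rewrite mulNmx VP oppr0 adj0.
Qed.

Lemma lie_isotropyE W v : Kgrp blk W -> unitv v -> suppS k v -> nondeg k v ->
  lie (isotropy G (Proj (iota W *m v))) =
  [set iota (W *m X *m W ^t* ) | X in [set X | supp offS X /\ X ^t* = - X]].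
Proof.
move=> KW v1 vS nd; have KW' := KgrpV (@blk_sym n k) KW.
have sm (g : R -> 'M[H]_n) (A B : 'M[H]_n) : smooth_curve g ->
    smooth_curve (fun t => A *m g t *m B) /\
    velocity (fun t => A *m g t *m B) 0 = A *m velocity g 0 *m B.
  move=> sg; have sAg := smooth_curveM (smooth_curve_cst A) sg.
  split; first exact: smooth_curveM sAg (smooth_curve_cst B).
  rewrite (velocityM _ sAg (smooth_curve_cst B)) velocity_cst mulmx0 addr0.
  by rewrite (velocityM _ (smooth_curve_cst A) sg) velocity_cst mul0mx add0r.
apply/seteqP; split=> [_ [g [sg Ig g0 <-]]|_ [X [sX XJ] <-]].
  have [sh vh] := sm g (iota (W ^t* )) (iota W) sg.
  have [t||X [sX XJ vX]] := IsoStd_velocity sh.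
  - exact: (isotropyE (g t) KW v1 vS nd).1.
  - by rewrite g0 mulmx1 (iotaKV KW).
  exists X => //; rewrite !iotaM -vX vh !mulmxA (iotaVK KW) mul1mx -mulmxA (iotaVK KW).
  by rewrite mulmx1.
have [g [sg Kg g0 vg]] := Kcurve_skew (@offS_sym n k) (@offS_trans n k) sX XJ.
have [sh vh] := sm _ (iota W) (iota (W ^t* )) sg.
exists (fun t => iota W *m iota (g t) *m iota (W ^t* )); split.
- exact: sh.
- move=> t; apply/(isotropyE _ KW v1 vS nd).
  rewrite !mulmxA (iotaKV KW) mul1mx -mulmxA (iotaKV KW) mulmx1.
  by exists (g t); [exact: Kg|left].
- by rewrite g0 iota1 mulmx1 (iotaVK KW).
by rewrite vh vg !iotaM.
Qed.

End IsotropyAlgebra.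

(** * The isotropy algebra as a sum of two unitary algebras *)

Section Corners.
Variables (R : realType) (n k : nat).
Hypotheses (hk : (2 <= k)%N) (hn : (k + 2 <= n)%N).
Local Notation H := (quat R).
Local Notation C := (R[i]).
Implicit Types (v w y z : 'cV[H]_n) (b : bool) (X : 'M[C]_n) (g : 'M[H]_n).
Local Notation G := (UU R n k).
Local Notation blk := (@blk n k).
Local Notation D := (D R n k).
Local Notation inS := (@inS n k).
Local Notation PiS := (PiS R n k).
Local Notation offS := (@offS n k).
Local Notation sel := (sel R n k).

Local Notation F1 := (selm R n (k - 2) 2).
Local Notation F2 := (selm R n (n - k - 2) (k + 2)).

Lemma F1K : F1 *m F1 ^t* = 1%:M. Proof. by apply: selmK; lia. Qed.
Lemma F2K : F2 *m F2 ^t* = 1%:M. Proof. by apply: selmK; lia. Qed.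

Lemma itvP1 (i : 'I_n) : itv (k - 2) 2 i = (i < k)%N && ~~ inS i.
Proof. by rewrite /itv /inS /=; lia. Qed.

Lemma itvP2 (i : 'I_n) : itv (n - k - 2) (k + 2) i = ~~ (i < k)%N && ~~ inS i.
Proof. by have := ltn_ord i; rewrite /itv /inS /=; lia. Qed.

Lemma offSE i j : offS i j = (itv (k - 2) 2 i && itv (k - 2) 2 j) ||
  (itv (n - k - 2) (k + 2) i && itv (n - k - 2) (k + 2) j).
Proof.
rewrite !itvP1 !itvP2 /offS /blk /=.
by case: (i < k)%N; case: (j < k)%N; case: (inS i); case: (inS j).
Qed.

Lemma itv_disj (i : 'I_n) : itv (k - 2) 2 i -> itv (n - k - 2) (k + 2) i -> False.
Proof. by rewrite itvP1 itvP2 => /andP[-> _]. Qed.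

Lemma F_ortho : F1 *m F2 ^t* = 0.
Proof.
apply/matrixP => i j; rewrite mxE big1 ?mxE // => l _; rewrite tmxCE !mxE conjC_nat -natrM mulnb.
case: eqP => //= l1; case: eqP => //= l2; have := ltn_ord i; lia.
Qed.

Lemma F_ortho' : F2 *m F1 ^t* = 0.
Proof. by rewrite -[LHS]trmxCK tmxCM trmxCK F_ortho trmx0 map_mx0. Qed.

Lemma corner_comm X m off : (forall i j, offS i j -> itv m off i = itv m off j) ->
  supp offS X -> proj R (itv m off) *m X = X *m proj R (itv m off).
Proof.
move=> e sX; apply/matrixP => i j; rewrite proj_mul mul_proj mulrC.
by have [/e ->|/sX ->] := boolP (offS i j); rewrite ?mul0r.
Qed.

(** Compression to a corner is multiplicative on matrices that commute with its projection, and
    matrices supported in [offS] do. *)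
Lemma corner_mul m off X Y : (off + m <= n)%N ->
  (forall i j, offS i j -> itv m off i = itv m off j) -> supp offS X ->
  let F := selm R n m off in
  F *m (X *m Y) *m F ^t* = F *m X *m F ^t* *m (F *m Y *m F ^t* ).
Proof.
move=> le e sX F; have -> : F *m X *m F ^t* *m (F *m Y *m F ^t* ) =
    F *m (X *m (F ^t* *m F)) *m Y *m F ^t* by rewrite !mulmxA.
by rewrite mul_selm -(corner_comm e sX) -mul_selm !mulmxA selmK // mul1mx.
Qed.

Lemma itv1_offS i j : offS i j -> itv (k - 2) 2 i = itv (k - 2) 2 j.
Proof.
rewrite offSE => /orP[/andP[-> ->//]|/andP[a b]].
by apply/idP/idP => c; [case: (itv_disj c a)|case: (itv_disj c b)].
Qed.

Lemma itv2_offS i j : offS i j -> itv (n - k - 2) (k + 2) i = itv (n - k - 2) (k + 2) j.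
Proof.
rewrite offSE => /orP[/andP[a b]|/andP[-> ->//]].
by apply/idP/idP => c; [case: (itv_disj a c)|case: (itv_disj b c)].
Qed.

Lemma corners_sum X : supp offS X ->
  X = F1 ^t* *m (F1 *m X *m F1 ^t* ) *m F1 + F2 ^t* *m (F2 *m X *m F2 ^t* ) *m F2.
Proof.
move=> sX.
have -> : F1 ^t* *m (F1 *m X *m F1 ^t* ) *m F1 = (F1 ^t* *m F1) *m X *m (F1 ^t* *m F1).
  by rewrite !mulmxA.
have -> : F2 ^t* *m (F2 *m X *m F2 ^t* ) *m F2 = (F2 ^t* *m F2) *m X *m (F2 ^t* *m F2).
  by rewrite !mulmxA.
rewrite !mul_selm; apply/matrixP => i j; rewrite mxE !mul_proj !proj_mul.
have [|/sX ->] := boolP (offS i j); last by rewrite !mulr0 !mul0r addr0.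
rewrite offSE => /orP[/andP[a b]|/andP[a b]]; rewrite a b mulr1 mul1r.
  by case: (boolP (itv (n - k - 2) _ i)) => [/(itv_disj a)//|_]; rewrite !mul0r addr0.
by case: (boolP (itv (k - 2) _ i)) => [/itv_disj/(_ a)//|_]; rewrite !mul0r add0r.
Qed.

Lemma supp_corners (U1 : 'M[C]_(k - 2)) (U2 : 'M[C]_(n - k - 2)) :
  supp offS (F1 ^t* *m U1 *m F1 + F2 ^t* *m U2 *m F2).
Proof.
have e1 : F1 ^t* *m U1 *m F1 = (F1 ^t* *m F1) *m (F1 ^t* *m U1 *m F1) *m (F1 ^t* *m F1).
  by rewrite -!mulmxA (mulmxA F1 _ F1) F1K mul1mx (mulmxA F1 (F1 ^t* )) F1K mul1mx.
have e2 : F2 ^t* *m U2 *m F2 = (F2 ^t* *m F2) *m (F2 ^t* *m U2 *m F2) *m (F2 ^t* *m F2).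
  by rewrite -!mulmxA (mulmxA F2 _ F2) F2K mul1mx (mulmxA F2 (F2 ^t* )) F2K mul1mx.
move=> i j oij; have /norP[/nandP h1 /nandP h2] : ~~ ((itv (k - 2) 2 i && itv (k - 2) 2 j) ||
    (itv (n - k - 2) (k + 2) i && itv (n - k - 2) (k + 2) j)).
  by rewrite -offSE.
rewrite e1 e2 !mul_selm mxE !mul_proj !proj_mul.
have -> : ((itv (k - 2) 2 i)%:R * (F1 ^t* *m U1 *m F1) i j) * (itv (k - 2) 2 j)%:R = 0 :> C.
  by case: h1 => /negbTE ->; rewrite ?mul0r ?mulr0.
by case: h2 => /negbTE ->; rewrite ?mul0r ?mulr0 addr0.
Qed.

Definition corners (W : 'M[C]_n) (M : 'M[H]_n) : 'M[C]_(k - 2) * 'M[C]_(n - k - 2) :=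
  let X := W ^t* *m Cpart M *m W in (F1 *m X *m F1 ^t*, F2 *m X *m F2 ^t* ).

Lemma corners_iota W X : Kgrp blk W ->
  corners W (iota (W *m X *m W ^t* )) = (F1 *m X *m F1 ^t*, F2 *m X *m F2 ^t* ).
Proof.
move=> KW; rewrite /corners Cpart_iota /=.
have -> : W ^t* *m (W *m X *m W ^t* ) *m W = X; last by [].
by rewrite !mulmxA (Kgrp_mulmxV KW) mul1mx -mulmxA (Kgrp_mulmxV KW) mulmx1.
Qed.

Lemma lie_isomorphic_corners W (L : set 'M[H]_n) : Kgrp blk W ->
  L = [set iota (W *m X *m W ^t* ) | X in [set X | supp offS X /\ X ^t* = - X]] ->
  lie_isomorphic_uu (k - 2) (n - k - 2) L.
Proof.
move=> KW ->; exists (corners W); split.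
- split.
  + move=> _ [X [sX XJ] <-]; rewrite corners_iota //.
    by split; rewrite /u /= !tmxCM trmxCK XJ mulNmx mulmxN mulmxA.
  + move=> _ _ /set_mem[X [sX XJ] <-] /set_mem[Y [sY YJ] <-].
    rewrite !corners_iota // => -[e1 e2].
    by rewrite (corners_sum sX) e1 e2 -(corners_sum sY).
  + move=> [U1 U2] [/= J1 J2]; rewrite /u /= in J1 J2.
    pose X := F1 ^t* *m U1 *m F1 + F2 ^t* *m U2 *m F2.
    exists (iota (W *m X *m W ^t* )).
      exists X => //; split; first exact: supp_corners.
      by rewrite /X tmxCD !tmxCM !trmxCK J1 J2 !(mulNmx, mulmxN) !mulmxA opprD.
    rewrite corners_iota //; congr (_, _); rewrite /X mulmxDr mulmxDl !mulmxA.
      by rewrite F1K mul1mx -!mulmxA F1K mulmx1 (mulmxA F1) F_ortho mul0mx addr0.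
    by rewrite F2K mul1mx F_ortho' !mul0mx add0r -mulmxA F2K mulmx1.
- move=> c X Y _ _; rewrite /corners /=.
  have -> : W ^t* *m Cpart (scaleq c X + Y) *m W =
      c%:C%C *: (W ^t* *m Cpart X *m W) + W ^t* *m Cpart Y *m W.
    have -> : Cpart (scaleq c X + Y) = c%:C%C *: Cpart X + Cpart Y.
      apply/matrixP => i j; rewrite !mxqE raddfD; congr (_ + _).
      by apply/eqP; rewrite eq_complex /=; apply/andP; split; apply/eqP; ring.
    by rewrite mulmxDr mulmxDl -scalemxAr -scalemxAl.
  by rewrite !mulmxDr !mulmxDl -!scalemxAr -!scalemxAl.
move=> _ _ [X [sX XJ] <-] [Y [sY YJ] <-].
have -> : bracket (iota (W *m X *m W ^t* )) (iota (W *m Y *m W ^t* )) =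
    iota (W *m bracket X Y *m W ^t* ).
  rewrite /bracket -!iotaM -iotaB; congr iota.
  have e A B : W *m A *m W ^t* *m (W *m B *m W ^t* ) = W *m (A *m B) *m W ^t*.
    by rewrite !mulmxA -(mulmxA (W *m A)) (Kgrp_mulmxV KW) mulmx1.
  by rewrite !e mulmxBr mulmxBl.
rewrite !corners_iota //=.
rewrite /bracket !mulmxBr !mulmxBl; congr (_ - _, _ - _).
- by apply: (corner_mul _ _ itv1_offS) => //; lia.
- by apply: (corner_mul _ _ itv1_offS) => //; lia.
- by apply: (corner_mul _ _ itv2_offS) => //; lia.
- by apply: (corner_mul _ _ itv2_offS) => //; lia.
Qed.

End Corners.

(** * Counting matrix positions *)

Section Counting.
Variables (n k : nat).
Hypotheses (hk : (2 <= k)%N) (hn : (k + 2 <= n)%N).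
Local Notation blk := (@blk n k).
Local Notation offS := (@offS n k).

Lemma cardrE (s : rel 'I_n) : cardr s = (\sum_i \sum_j s i j)%N.
Proof.
rewrite /cardr -sum1_card big_mkcond /= (pair_bigA _ (fun i j => nat_of_bool (s i j))) /=.
by apply: eq_bigr => -[i j] _; rewrite inE /=; case: (s i j).
Qed.

Lemma sum_square (c : pred 'I_n) : (\sum_i \sum_j (c i && c j : nat) = (\sum_i c i) ^ 2)%N.
Proof.
rewrite -mulnn big_distrlr /=; apply: eq_bigr => i _; apply: eq_bigr => j _.
by rewrite mulnb.
Qed.

Lemma cardr_two (c c' : pred 'I_n) : (forall i, c i -> c' i -> False) ->
  cardr [rel i j | c i && c j || c' i && c' j] = ((\sum_i c i) ^ 2 + (\sum_i c' i) ^ 2)%N.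
Proof.
move=> cc'; rewrite cardrE -!sum_square -big_split; apply: eq_bigr => i _ /=.
rewrite -big_split; apply: eq_bigr => j _ /=.
case: (boolP (c i)) => ci; case: (boolP (c' i)) => ci' //=; first by case: (cc' i).
  by rewrite orbF addn0.
Qed.

Lemma eq_cardr (s s' : rel 'I_n) : s =2 s' -> cardr s = cardr s'.
Proof.
by move=> ss'; rewrite !cardrE; apply: eq_bigr => i _; apply: eq_bigr => j _; rewrite ss'.
Qed.

Lemma cardr_offS : cardr offS = ((k - 2) ^ 2 + (n - k - 2) ^ 2)%N.
Proof.
have e1 : (\sum_(i < n) itv (k - 2) 2 i)%N = (k - 2)%N by apply: card_itv; lia.
have e2 : (\sum_(i < n) itv (n - k - 2) (k + 2) i)%N = (n - k - 2)%N by apply: card_itv; lia.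
transitivity ((\sum_(i < n) itv (k - 2) 2 i) ^ 2 +
    (\sum_(i < n) itv (n - k - 2) (k + 2) i) ^ 2)%N; last by rewrite e1 e2.
rewrite -cardr_two; last by move=> i; apply: (itv_disj hk hn).
by apply: eq_cardr => i j; exact: (offSE hk hn).
Qed.

Lemma blkE i j : blk i j = (itv k 0 i && itv k 0 j) || (itv (n - k) k i && itv (n - k) k j).
Proof. by have := ltn_ord i; have := ltn_ord j; rewrite /blk /itv /=; lia. Qed.

Lemma cardr_blk : cardr blk = (k ^ 2 + (n - k) ^ 2)%N.
Proof.
have e1 : (\sum_(i < n) itv k 0 i)%N = k by apply: card_itv; lia.
have e2 : (\sum_(i < n) itv (n - k) k i)%N = (n - k)%N by apply: card_itv; lia.
transitivity ((\sum_(i < n) itv k 0 i) ^ 2 + (\sum_(i < n) itv (n - k) k i) ^ 2)%N.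
  rewrite -cardr_two; last by move=> i; rewrite /itv /=; lia.
  by apply: eq_cardr => i j; exact: blkE.
by rewrite e1 e2.
Qed.

(** Matrix positions for a complement of the isotropy algebra in the Lie algebra of the group; their
    number is the dimension of the orbit. *)
Definition blkS := [rel i j : 'I_n | blk i j && ~~ offS i j].

Lemma cardr_blkS : cardr blkS = (4 * n - 8)%N.
Proof.
have : (cardr blkS + cardr offS = cardr blk)%N.
  rewrite !cardrE -big_split; apply: eq_bigr => i _; rewrite -big_split.
  apply: eq_bigr => j _; rewrite /blkS /offS /=.
  rewrite /blk /=; case: ((i < k)%N == (j < k)%N) => //=; lia.
rewrite cardr_offS cardr_blk; move: (cardr blkS) => c.
(* Writing [n] and [k] as sums turns the truncated subtractions into exact ones. *)
have [m ->] : exists m, n = (k + 2 + m)%N by exists (n - (k + 2))%N; lia.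
have [l ->] : exists l, k = (2 + l)%N by exists (k - 2)%N; lia.
have -> : (2 + l - 2 = l)%N by lia.
have -> : (2 + l + 2 + m - (2 + l) = 2 + m)%N by lia.
have -> : (2 + m - 2 = m)%N by lia.
by rewrite !sqrnD; lia.
Qed.

Lemma dsizeE (r : rel 'I_n) : dsize r = (\sum_i r i i)%N.
Proof.
rewrite /dsize card_sig -sum1_card big_mkcond /=.
by apply: eq_bigr => i _; rewrite inE; case: (r i i).
Qed.

Lemma dsize_blk : dsize blk = n.
Proof.
rewrite dsizeE (eq_bigr (fun=> 1%N)) => [|i _]; last by rewrite /blk /= eqxx.
by rewrite sum1_card card_ord.
Qed.

Lemma dsize_offS : dsize offS = (n - 4)%N.
Proof.
rewrite dsizeE.
have -> : (\sum_i offS i i =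
    \sum_(i < n) itv (k - 2) 2 i + \sum_(i < n) itv (n - k - 2) (k + 2) i)%N.
  rewrite -big_split; apply: eq_bigr => i _; rewrite [offS i i](offSE hk hn) !andbb.
  by rewrite /itv /=; have := ltn_ord i; lia.
rewrite !card_itv; lia.
Qed.

End Counting.

(** * Orbit dimension and ranks at a principal line *)

Section PrincipalInvariants.
Variables (R : realType) (n k : nat).
Hypotheses (hk : (2 <= k)%N) (hn : (k + 2 <= n)%N).
Local Notation H := (quat R).
Local Notation C := (R[i]).
Implicit Types (v w y z : 'cV[H]_n) (b : bool) (X : 'M[C]_n) (g : 'M[H]_n).
Local Notation G := (UU R n k).
Local Notation blk := (@blk n k).
Local Notation D := (D R n k).
Local Notation inS := (@inS n k).
Local Notation PiS := (PiS R n k).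
Local Notation offS := (@offS n k).
Local Notation sel := (sel R n k).

Local Notation blkS := (@blkS n k).

Lemma supp_conj W X : Kgrp blk W -> supp blk X -> supp blk (W *m X *m W ^t* ).
Proof.
have sK V : Kgrp blk V -> supp blk V.
  move=> KV i j bij; rewrite (Kgrp_off KV bij) (_ : i == j = false) //.
  by apply: contraNF bij => /eqP ->; rewrite /blk /=.
move=> KW sX; have KW' := KgrpV (@blk_sym n k) KW.
apply: (suppM (@blk_trans n k)); last exact: sK KW'.
by apply: (suppM (@blk_trans n k)) => //; exact: sK KW.
Qed.

Lemma skew_conj (W X : 'M[C]_n) : X ^t* = - X -> (W *m X *m W ^t* ) ^t* = - (W *m X *m W ^t* ).
Proof. by move=> XJ; rewrite !tmxCM trmxCK XJ mulNmx mulmxN mulmxA. Qed.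

Lemma blkS_sym : symmetric blkS.
Proof. by move=> i j; congr (_ && ~~ _); [exact: blk_sym | exact: offS_sym]. Qed.

Lemma supp_split X : supp blk X -> X ^t* = - X -> exists Y Z,
  [/\ X = Y + Z, supp blkS Y, Y ^t* = - Y, supp offS Z & Z ^t* = - Z].
Proof.
move=> sX XJ; have [Z ZE] : {Z | Z = \matrix_(i, j) if offS i j then X i j else 0} by eexists.
have sZ : supp offS Z by move=> i j ij; rewrite ZE mxE; case: ifP => // h; case/negP: ij.
have ZJ : Z ^t* = - Z.
  apply/matrixP => i j; rewrite tmxCE ZE !mxE; have eS : offS j i = offS i j := @offS_sym n k j i.
  rewrite eS; case: ifP => _; last by rewrite conjC0 oppr0.
  by have /matrixP/(_ i j) := XJ; rewrite tmxCE mxE.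
exists (X - Z), Z; split=> //; first by rewrite subrK.
  move=> i j ij; rewrite mxE mxE; have [oij|oij] := boolP (offS i j).
    by rewrite ZE mxE oij subrr.
  rewrite (sZ _ _ oij) subr0; apply: sX; apply: contra ij => bij.
  by apply/andP; split; [exact: bij|exact: oij].
by rewrite tmxCB XJ ZJ opprB opprK addrC.
Qed.

Lemma bracketDl (X Y P : 'M[H]_n) : bracket (X + Y) P = bracket X P + bracket Y P.
Proof. by rewrite /bracket mulmxDl mulmxDr opprD addrACA. Qed.

Lemma bracketZl c (X P : 'M[H]_n) : bracket (real_quat c *: X) P = real_quat c *: bracket X P.
Proof. by rewrite /bracket -scalemxAl scaleq_mull scalerBr. Qed.

Lemma iotaZR (c : R) X : iota (c%:C%C *: X) = real_quat c *: iota X.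
Proof. by rewrite iotaZ. Qed.

(** After conjugation by [W] the line lies in the slice. A matrix supported in [blkS] that
    annihilates [v] is also supported in [offS], hence zero; and matrices supported in [offS]
    annihilate [v], so those of [blkS] already give the whole tangent space. *)
Lemma has_dim_tangent_orbit W v : Kgrp blk W -> unitv v -> suppS k v -> nondeg k v ->
  let P := Proj (iota W *m v) in has_dim (tangent (orbit G P) P) (cardr blkS).
Proof.
move=> KW v1 vS nd P; have ndw := nondeg_unitary KW nd.
have w1 : unitv (iota W *m v).
  by apply: unitvM v1; rewrite adj_iota; exact: iotaKV KW.
have vP := suppS_PiS vS.
have [L [LD LZ L0 LE]] := skew_coord R blkS_sym.
have Ls a : supp blkS (L a) /\ (L a) ^t* = - L a by apply/LE; exists a.
have sblk X : supp blkS X -> supp blk X by apply: supp_sub => i j /andP[].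
have Wv X : iota (W *m X *m W ^t* ) *m (iota W *m v) = iota W *m (iota X *m v).
  rewrite !iotaM mulmxA -(mulmxA _ (iota (W ^t* ))) (iotaKV KW) mulmx1.
  by rewrite -mulmxA.
apply: (@has_dim_lin R n _ _ (fun a => bracket (iota (W *m L a *m W ^t* )) P)).
- by move=> a b; rewrite LD mulmxDr mulmxDl iotaD bracketDl.
- by move=> c a; rewrite LZ -scalemxAr -scalemxAl iotaZR bracketZl.
- move=> a La; apply: L0; have [sL LJ] := Ls a.
  have := nondeg_stab_lie ndw w1 (supp_conj KW (sblk _ sL)) (skew_conj W LJ) La.
  rewrite Wv => /(congr1 (mulmx (iota (W ^t* )))).
  rewrite mulmxA (iotaKV KW) mul1mx mulmx0 => Lv.
  have LP : L a *m PiS = 0.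
    apply: (supp_annihil hk hn vS) => [b||]; first exact: suppS_nondeg.
      exact: sblk.
    by rewrite -cplx_iota Lv cplx0.
  have PL : PiS *m L a = 0.
    rewrite -[LHS]trmxCK tmxCM PiS_adj LJ mulNmx LP oppr0.
    by rewrite trmx0 map_mx0.
  have /supp_offSP sL' : [/\ supp blk (L a), L a *m PiS = 0 & PiS *m L a = 0].
    by split=> //; exact: sblk.
  apply/matrixP => i j; rewrite [RHS]mxE; have [oij|] := boolP (offS i j); last exact: sL'.
  by rewrite sL // /blkS /= negb_and negbK; apply/orP; right.
rewrite /P (tangent_orbitE ndw w1); apply/seteqP; split=> [_ [X [sX XJ] <-]|_ [a _ <-]].
  have KW' := KgrpV (@blk_sym n k) KW.
  have := supp_conj KW' sX; have := skew_conj (W ^t* ) XJ; rewrite trmxCK => J s.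
  have [Y [Z [XE sY YJ sZ ZJ]]] := supp_split s J.
  have [a Ya] := (LE Y).1 (conj sY YJ).
  exists a; first exact: Logic.I.
  have -> : X = W *m Y *m W ^t* + W *m Z *m W ^t*.
    rewrite -mulmxDl -mulmxDr -XE !mulmxA (Kgrp_mulVmx KW) mul1mx -mulmxA.
    by rewrite (Kgrp_mulVmx KW) mulmx1.
  rewrite iotaD bracketDl -Ya (bracket_Proj _ (skew_conj W ZJ)) Wv.
  have -> : iota Z *m v = 0.
    have /supp_offSP[_ ZP _] := sZ.
    by rewrite -vP mulmxA -iotaM ZP iota0 mul0mx.
  by rewrite !mulmx0 adj0 mul0mx mulmx0 !addr0.
have [sL LJ] := Ls a.
exists (W *m L a *m W ^t* ) => //; split; last exact: skew_conj.
exact: supp_conj KW (sblk _ sL).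
Qed.

Lemma dim_tangent_HP m (v : 'cV[H]_m) : (0 < m)%N -> unitv v ->
  dim (tangent (HP R m) (Proj v)) = (m.-1 * 4)%N.
Proof. by case: m v => // m v _ v1; apply: dimE; exact: has_dim_tangent_HP. Qed.

Lemma cohomogeneity_slice W v : Kgrp blk W -> unitv v -> suppS k v -> nondeg k v ->
  cohomogeneity G (Proj (iota W *m v)) = 4%N.
Proof.
move=> KW v1 vS nd; rewrite /cohomogeneity (dimE (has_dim_tangent_orbit KW v1 vS nd)).
have w1 : unitv (iota W *m v).
  by apply: unitvM v1; rewrite adj_iota; exact: iotaKV KW.
rewrite dim_tangent_HP //; last by lia.
by rewrite cardr_blkS //; lia.
Qed.

Lemma rk_UU : rk G = n.
Proof.
rewrite -[RHS](@dsize_blk n k).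
apply: (@rk_Kgrp R n blk (@blk_sym n k) (@blk_trans n k) G 1%:M).
- by rewrite tmxC1 mulmx1.
- by move=> X KX; rewrite tmxC1 mulmx1 mul1mx; exact: UU_iota.
move=> t /UUP[X KX ->]; exists (X *m X); last by rewrite tmxC1 mulmx1 mul1mx iotaM.
exact: (KgrpM (@blk_trans n k) (KX) (KX)).
Qed.

Lemma rk_isotropy W v : Kgrp blk W -> unitv v -> suppS k v -> nondeg k v ->
  rk (isotropy G (Proj (iota W *m v))) = (n - 4)%N.
Proof.
move=> KW v1 vS nd; rewrite -[RHS](dsize_offS hk hn).
apply: (@rk_Kgrp R n offS (@offS_sym n k) (@offS_trans n k) _ W).
- exact: Kgrp_mulVmx KW.
- move=> X KX; rewrite !iotaM; apply: (isotropy_conj KW).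
  by apply: IsoStd_isotropy => //; exists X => //; left.
move=> t /(isotropyE hk hn t KW v1 vS nd) /IsoStd_sqr[X KX e]; exists X => //.
rewrite !iotaM -e !mulmxA (iotaVK KW) mul1mx -(mulmxA t) (iotaVK KW) mulmx1.
by rewrite -mulmxA (iotaVK KW) mulmx1.
Qed.

End PrincipalInvariants.

Theorem mainTheorem2 (R : realType) (n k : nat)
    (hk : (3 <= k)%N) (hn : (k + 2 <= n)%N) :
  (exists P : 'M[quat R]_n, principal (UU R n k) P) /\
  (forall P : 'M[quat R]_n, principal (UU R n k) P ->
     lie_isomorphic_uu (k - 2) (n - k - 2) (lie (isotropy (UU R n k) P)) /\
     cohomogeneity (UU R n k) P = 4%N /\
     hrk (UU R n k) P = 0%R) /\
  ~ quaternion_coisotropic_action (UU R n k).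
Proof.
have hk2 : (2 <= k)%N := ltnW hk.
have v1 := unitv_v0 R hk2 hn; have vS := suppS_v0 R hk2 hn.
have nd := nondeg_v0 R hk2 hn.
have pP := nondeg_principal hk2 hn vS nd v1.
split; first by exists (Proj (v0 R n k)).
split; last by move=> co; exact: (not_coisotropic nd v1 (co _ pP)).
move=> P /(principal_slice hk2 hn)[W [v [KW {}v1 {}vS {}nd ->]]].
split; first exact: (lie_isomorphic_corners hk2 hn KW (lie_isotropyE hk2 hn KW v1 vS nd)).
have c4 := cohomogeneity_slice hk2 hn KW v1 vS nd; split; first exact: c4.
(* The value is [n - (n - 4) - 4]; the natural subtraction in the rank is exact because
   [k + 2 <= n]. *)
rewrite /hrk c4 (rk_UU R n k) (rk_isotropy hk2 hn KW v1 vS nd); lia.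
Qed.
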